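(* Let $a\in(0,\infty)$, $a\notin\{2n+1\mid n\in\mathbb{N}\}$ (with $\mathbb{N}=\{0,1,2,\dots\}$). There exist functions $p_a(w_0,x)$, $q_a(w_0,x)$, smooth in $x$ and holomorphic in $w_0$ for $(x,w_0)\in[1,\infty)\times\{\mu\in\mathbb{C}\mid|\mathrm{Im}(\mu)|<\pi\}$, such that, setting $$P_a(z_0,x)=\big(1+\tfrac xa\big)^{\frac a2}e^{-\frac x2}p_a(z_0,x),\qquad Q_a(z_0,x)=\big(1+\tfrac xa\big)^{\frac a2}e^{-\frac x2}q_a(z_0,x),$$ for any $z\in\mathbb{C}\setminus\bigcup_{k\in\mathbb{Z}}\{\mu\in\mathbb{C}\mid\mathrm{Im}(\mu+i2k\pi)=\pi\}$, under the spectral equivalence $s=\frac12+i\,l(a)e^{\frac{z_0}{2}}$, we have on $Y$ $$F_{a,z}-\eta_a(z)\Psi_{a,z+2\ln(l(a))}=e^{xs}P_a(z_0,x)+\xi_a(z)e^{x(1-s)}Q_a(z_0,x),$$ where $$\xi_a(z)=\frac{i\sin\big((k_z+1)\pi\frac{a+1}{2}\big)e^{i\frac{\pi a}{2}}-C_a(z+2\ln(l(a)))\sin\big(k_z\pi\frac{a+1}{2}\big)}{\sin\big(k_z\pi\frac{a+1}{2}\big)e^{i\frac{\pi a}{2}}+iC_a(z+2\ln(l(a)))\sin\big((k_z-1)\pi\frac{a+1}{2}\big)}\,e^{-i2a\,l(a)e^{\frac{z_0}{2}}}.$$ Furthermore, for any $c\in\mathbb{R}$ and $\varepsilon\in(0,\pi)$,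 $p_a(w_0,x)\to1$ and $q_a(w_0,x)\to1$ as $a\to\infty$, uniformly in $x\in[1,\infty)$ and $$w_0\in\{\mu\in\mathbb{C}\mid\mathrm{Re}(\mu)\ge c\}\cap\{\mu\in\mathbb{C}\mid|\mathrm{Im}(\mu)|\le\pi-\varepsilon\}.$$
   Context: Geometry: $S^1=\mathbb{R}/\mathbb{Z}$, $X$ is a compact two-dimensional smooth manifold with boundary $S^1$, $Y=[1,\infty)\times S^1$ with coordinates $(x,y)$, and $M=X\cup_{S^1}Y$ (smooth, glued along the boundary). For $a\in(0,\infty)$, $M$ is endowed with a Riemannian metric $g$ with $g|_Y=dx^2+(1+\frac{x}{a})^{-2a}dy^2$ (arbitrary on $X$); $\mathbb{M}=(M,g)$. The Laplacian $\Delta_{\mathbb{M}}$ is taken non-negative, so that on $Y$ it is $-\big(\partial_x^2-\frac{1}{1+x/a}\partial_x+(1+\frac{x}{a})^{2a}\partial_y^2\big)$, and $\underline{\Delta}_{\mathbb{M}}$ is its unique self-adjoint extension in $L^2(\mathbb{M})$ from $C_0^\infty(M)$. Hankel functions: $H^{(1)}_\nu=J_\nu+iY_\nu$ and $H^{(2)}_\nu=J_\nu-iY_\nu$ are regarded as functions on the logarithmic cover of $\mathbb{C}\setminus\{0\}$: $H^{(j)}_\nu(e^w)$ is the entire function of $w\in\mathbb{C}$ obtained by analytic continuation from $w\in\mathbb{R}$; for $r>0$, $re^w$ stands for $e^{w+\ln r}$. Generalized eigenfunction: it is known that there is a unique family $E_{a,z}$ of smooth functions on $M$, meromorphic in $z\in\mathbb{C}$,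 with $(\Delta_{\mathbb{M}}-e^z)E_{a,z}=0$ on $M$ and, on $Y$, $$E_{a,z}(x,y)=(a+x)^{\frac{a+1}{2}}H^{(2)}_{\frac{a+1}{2}}\big((a+x)e^{\frac z2}\big)+C_a(z)(a+x)^{\frac{a+1}{2}}H^{(1)}_{\frac{a+1}{2}}\big((a+x)e^{\frac z2}\big)+\Psi_{a,z}(x,y),$$ where $C_a$ is a meromorphic function on $\mathbb{C}$ (the scattering matrix) and $\Psi_{a,z}$, meromorphic in $z$, comprises the non-zero Fourier modes in $y\in S^1$ and satisfies, for $\mathrm{Im}(z)\in(0,2\pi)$ and every $\varepsilon>0$, $\Psi_{a,z}(x,y)=O\big(x^{\frac a2}e^{(-\frac{2\pi}{(a+1)a^a}+\varepsilon)(a+x)^{a+1}}\big)$ as $x\to\infty$; $C_a$ and $\Psi_{a,z}$ are also uniquely determined. Explicitly, $E_{a,z}=\phi_\chi-(\underline{\Delta}_{\mathbb{M}}-e^z)^{-1}(\Delta_{\mathbb{M}}-e^z)\phi_\chi$ for $\mathrm{Im}(z)\in(0,2\pi)$, continued meromorphically to $z\in\mathbb{C}$, where $\phi_\chi=0$ on $X$ and $\phi_\chi=\chi(x)(a+x)^{\frac{a+1}{2}}H^{(2)}_{\frac{a+1}{2}}((a+x)e^{\frac z2})$ on $Y$, with $\chi\in C^\infty(\mathbb{R})$, $\chi=0$ for $x<1$, $\chi=1$ for $x>1+\varepsilon'$, for some $\varepsilon'>0$. Notation: for $z\in\mathbb{C}$ write $z=z_0+i2k_z\pi$ with $\mathrm{Im}(z_0)\in[-\pi,\pi)$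 and $k_z\in\mathbb{Z}$. Let $\rho:(0,\infty)\to[1,\infty)$ be any function with $\rho(a)\to\infty$ as $a\to\infty$, and $l(a)=2^a\Gamma(\frac{a+1}{2})\rho(a)$. For $a\notin\{2n+1\mid n\in\mathbb{N}\}$ define the generalized eigenfunction $F_{a,z}=\eta_a(z)E_{a,z+2\ln(l(a))}$, where $$\eta_a(z)=a^{-\frac a2}\sqrt{\frac{\pi l(a)e^{\frac{z_0}{2}}}{2}}\;e^{-ia\,l(a)e^{\frac{z_0}{2}}}\Big(\frac{\sin(k_z\pi\frac{a+1}{2})}{\cos(\frac{\pi a}{2})}e^{i\frac{\pi a}{4}}+iC_a(z+2\ln(l(a)))\frac{\sin((k_z-1)\pi\frac{a+1}{2})}{\cos(\frac{\pi a}{2})}e^{-i\frac{\pi a}{4}}\Big)^{-1}$$ (principal square root). Identities in $z$ are understood in the sense of meromorphic functions, i.e. wherever both sides are defined. *)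

(* Defs.v *)
(* Stdlib reals with Coquelicot. *)
From Stdlib Require Import Reals ZArith List Lra.
From Coquelicot Require Import Coquelicot.
Open Scope R_scope.

(** * Smooth functions on open subsets of the plane *)

Definition d1 (f : R * R -> R) (u : R * R) : R :=
  Derive (fun t => f (t, snd u)) (fst u).
Definition d2 (f : R * R -> R) (u : R * R) : R :=
  Derive (fun t => f (fst u, t)) (snd u).

(* Only used for open [D], so that [d1 f] and [d2 f] on [D] depend only on the
   values of [f] on [D]. *)
Fixpoint Ck (n : nat) (D : R * R -> Prop) (f : R * R -> R) : Prop :=
  (forall u, D u -> continuous f u) /\
  match n with
  | O => True
  | S k =>
      (forall u, D u ->
         ex_derive (fun t => f (t, snd u)) (fst u) /\
         ex_derive (fun t => f (fst u, t)) (snd u)) /\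
      Ck k D (d1 f) /\ Ck k D (d2 f)
  end.

Definition smooth (D : R * R -> Prop) (f : R * R -> R) : Prop :=
  forall n, Ck n D f.

Definition smooth_map (D : R * R -> Prop) (h : R * R -> R * R) : Prop :=
  smooth D (fun u => fst (h u)) /\ smooth D (fun u => snd (h u)).

Definition jacobian (h : R * R -> R * R) (u : R * R) : R :=
  d1 (fun v => fst (h v)) u * d2 (fun v => snd (h v)) u -
  d2 (fun v => fst (h v)) u * d1 (fun v => snd (h v)) u.

(** * Smooth surfaces with one end *)

(* A smooth surface is presented, as in do Carmo, by a family of injective
   parametrizations [param i] of subsets of [M] by open subsets [dom i] of the
   plane, with inverses [coord i] (whose values off [param i (dom i)] are
   irrelevant), such that the changes of parameters are smooth on open sets.
   The topology of [M] is the one for which all the [param i] are open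
   embeddings; it is required to be Hausdorff and second countable. *)
Section Atlas.
Context {M I : Type} (dom : I -> R * R -> Prop) (param : I -> R * R -> M).

Definition in_chart (i : I) (m : M) : Prop :=
  exists u, dom i u /\ param i u = m.

Definition overlap (i j : I) (u : R * R) : Prop :=
  dom i u /\ in_chart j (param i u).

Definition open_set (U : M -> Prop) : Prop :=
  forall i, open (fun u : R * R => dom i u /\ U (param i u)).

Definition compact_set (A : M -> Prop) : Prop :=
  forall F : (M -> Prop) -> Prop,
    (forall U, F U -> open_set U) ->
    (forall m, A m -> exists U, F U /\ U m) ->
    exists l : list (M -> Prop),
      (forall U, In U l -> F U) /\
      (forall m, A m -> exists U, In U l /\ U m).
End Atlas.

Record surface := {
  carrier :> Type;
  index : Type;
  dom : index -> R * R -> Prop;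
  param : index -> R * R -> carrier;
  coord : index -> carrier -> R * R;
  dom_open : forall i, open (dom i);
  coordK : forall i u, dom i u -> coord i (param i u) = u;
  charts_cover : forall m, exists i, in_chart dom param i m;
  overlap_open : forall i j, open (overlap dom param i j);
  transition_smooth : forall i j,
    smooth_map (overlap dom param i j) (fun u => coord j (param i u));
  hausdorff : forall m m', m <> m' ->
    exists U V, open_set dom param U /\ open_set dom param V /\
      U m /\ V m' /\ (forall x, ~ (U x /\ V x));
  countably_charted : exists c : nat -> index,
    forall m, exists n, in_chart dom param (c n) m
}.

Arguments dom {s}.
Arguments param {s}.
Arguments coord {s}.

(* [M = X \cup_{S^1} Y] with [Y = [1,oo) x S^1] and [S^1 = R/Z].  The map
   [cyl], 1-periodic in its second argument, restricts to the inclusion of [Y].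
   Smoothness of [M] along the boundary of [Y] is expressed by a collar: [cyl]
   is a smooth open embedding of [(collar,oo) x S^1] for some [collar < 1].
   The compact piece [X] is the complement of [(1,oo) x S^1]; thanks to the
   collar and to the closedness of [Y], it is a smooth surface with boundary
   [{1} x S^1]. *)
Record surface_with_end := {
  base :> surface;
  cyl : R * R -> base;
  collar : R;
  collar_lt1 : collar < 1;
  cyl_inj : forall u v, collar < fst u -> collar < fst v ->
    (cyl u = cyl v <->
     fst u = fst v /\ exists n : Z, snd v = snd u + IZR n);
  cyl_open : forall i : index base,
    open (fun u : R * R => collar < fst u /\ in_chart dom param i (cyl u));
  cyl_smooth : forall i : index base,
    smooth_map (fun u => collar < fst u /\ in_chart dom param i (cyl u))
               (fun u => coord i (cyl u));
  cyl_immersion : forall (i : index base) u,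
    collar < fst u -> in_chart dom param i (cyl u) ->
    jacobian (fun v => coord i (cyl v)) u <> 0;
  Y_closed : open_set dom param
    (fun m : base => ~ exists u, 1 <= fst u /\ cyl u = m);
  X_compact : compact_set dom param
    (fun m : base => ~ exists u, 1 < fst u /\ cyl u = m)
}.

Arguments cyl {s}.

(** * Riemannian metrics and the Laplacian *)

(* [g11 dx1^2 + 2 g12 dx1 dx2 + g22 dx2^2] *)
Record form := Form { g11 : R; g12 : R; g22 : R }.

Definition disc (q : form) : R := g11 q * g22 q - g12 q * g12 q.

Definition pullback (h : R * R -> R * R) (q : R * R -> form) (u : R * R) : form :=
  let a1 := d1 (fun v => fst (h v)) u in
  let a2 := d2 (fun v => fst (h v)) u in
  let b1 := d1 (fun v => snd (h v)) u in
  let b2 := d2 (fun v => snd (h v)) u in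
  let Q := q (h u) in
  Form (g11 Q * (a1 * a1) + 2 * (g12 Q * (a1 * b1)) + g22 Q * (b1 * b1))
       (g11 Q * (a1 * a2) + g12 Q * (a1 * b2 + a2 * b1) + g22 Q * (b1 * b2))
       (g11 Q * (a2 * a2) + 2 * (g12 Q * (a2 * b2)) + g22 Q * (b2 * b2)).

Record metric (M : surface) := {
  local_form :> index M -> R * R -> form;
  form_smooth : forall i,
    smooth (dom i) (fun u => g11 (local_form i u)) /\
    smooth (dom i) (fun u => g12 (local_form i u)) /\
    smooth (dom i) (fun u => g22 (local_form i u));
  form_pos : forall i u, dom i u ->
    0 < g11 (local_form i u) /\ 0 < disc (local_form i u);
  form_compat : forall i j u, overlap dom param i j u ->
    local_form i u =
    pullback (fun v => coord j (param i v)) (local_form j) u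
}.

(* [g|_Y = dx^2 + (1 + x/a)^(-2a) dy^2] *)
Definition cusp_metric (M : surface_with_end) (a : R) (g : metric M) : Prop :=
  forall (i : index M) (x y : R), 1 <= x -> in_chart dom param i (cyl (x, y)) ->
    pullback (fun v => coord i (cyl v)) (g i) (x, y) =
    Form 1 0 (Rpower (1 + x / a) (- (2 * a))).

(* The non-negative Laplacian [- |g|^(-1/2) d_i (|g|^(1/2) g^{ij} d_j f)] in a
   parametrization, where [|g|^(1/2) g^{ij}] is the adjugate of [g] divided by
   [|g|^(1/2)]. *)
Definition laplacian (q : R * R -> form) (f : R * R -> R) (u : R * R) : R :=
  let vol v := sqrt (disc (q v)) in
  - (d1 (fun v => (g22 (q v) * d1 f v - g12 (q v) * d2 f v) / vol v) u +
     d2 (fun v => (g11 (q v) * d2 f v - g12 (q v) * d1 f v) / vol v) u) / vol u.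

Definition smooth_on_surface (M : surface) (f : M -> C) : Prop :=
  forall i, smooth (dom i) (fun u => Re (f (param i u))) /\
            smooth (dom i) (fun u => Im (f (param i u))).

(* [Delta f = lambda f] *)
Definition eigenfunction (M : surface) (g : metric M) (lambda : C) (f : M -> C) :
    Prop :=
  forall i u, dom i u ->
    ((laplacian (g i) (fun v => Re (f (param i v))) u,
      laplacian (g i) (fun v => Im (f (param i v))) u) : C) =
    (lambda * f (param i u))%C.

(** * Complex functions *)

Definition Cexp (z : C) : C :=
  (exp (Re z) * cos (Im z), exp (Re z) * sin (Im z)).

(* Principal branch: [Re (Csqrt z) >= 0], and [Im (Csqrt z) >= 0] if
   [z] is a negative real. *)
Definition Csqrt (z : C) : C :=
  (sqrt ((Cmod z + Re z) / 2),
   (if Rle_dec 0 (Im z) then 1 else -1) * sqrt ((Cmod z - Re z) / 2)).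

Definition holomorphic_at (f : C -> C) (z : C) : Prop :=
  ex_derive (K := C_AbsRing) (V := C_NormedModule) f z.

(* [f] is meromorphic on the plane, with poles in the closed discrete set
   [poles]; the values of [f] on [poles] are irrelevant. *)
Definition meromorphic (poles : C -> Prop) (f : C -> C) : Prop :=
  (forall z, exists d, 0 < d /\
     forall w, poles w -> w <> z -> d <= Cmod (w - z)) /\
  (forall z, ~ poles z -> holomorphic_at f z) /\
  (forall s, poles s -> exists (n : nat) (h : C -> C) (d : R), 0 < d /\
     forall z, Cmod (z - s) < d ->
       holomorphic_at h z /\ (z <> s -> (f z * (z - s) ^ n)%C = h z)).

(** * Bessel and Hankel functions of non-integer order *)

(* Gauss' product formula
   [Gamma x = lim_n n! n^x / (x (x+1) ... (x+n))], valid for all real [x]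
   outside [{0, -1, -2, ...}]. *)
Fixpoint rising (x : R) (n : nat) : R :=
  match n with
  | O => x
  | S k => rising x k * (x + INR n)
  end.

Definition Gamma (x : R) : R :=
  real (Lim_seq (fun n => INR (fact n) * Rpower (INR n) x / rising x n)).

(* [J_nu(e^w) = sum_m (-1)^m / (m! Gamma(m+nu+1)) (e^w/2)^(2m+nu)]. *)
Definition bessel_term (nu : R) (w : C) (m : nat) : C :=
  (RtoC ((-1) ^ m / (INR (fact m) * Gamma (INR m + nu + 1))) *
   Cexp (RtoC (2 * INR m + nu) * (w - RtoC (ln 2))))%C.

Definition besselJ (nu : R) (w : C) : C :=
  (Series (fun m => Re (bessel_term nu w m)),
   Series (fun m => Im (bessel_term nu w m))).

(* For [nu] an integer this would have to be read as a limit; only non-integer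
   [nu] occurs below, since [nu = (a+1)/2] with [a] not an odd integer. *)
Definition besselY (nu : R) (w : C) : C :=
  ((RtoC (cos (nu * PI)) * besselJ nu w - besselJ (- nu) w) /
   RtoC (sin (nu * PI)))%C.

(* As for [besselJ] and [besselY], the argument is the logarithm [w] of the
   point [e^w] of the logarithmic cover. *)
Definition hankel1 (nu : R) (w : C) : C := (besselJ nu w + Ci * besselY nu w)%C.
Definition hankel2 (nu : R) (w : C) : C := (besselJ nu w - Ci * besselY nu w)%C.

(** * The generalized eigenfunctions *)

Definition not_odd (a : R) : Prop := forall n : nat, a <> 2 * INR n + 1.

(* The family [E], the scattering matrix [scat] and the remainder [Psi], a
   function of [z], [x] and [y], which are uniquely determined by these
   properties off [poles]. *)
Record generalized_eigenfunction (M : surface_with_end) (g : metric M) (a : R)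
    (poles : C -> Prop) (E : C -> M -> C) (scat : C -> C)
    (Psi : C -> R -> R -> C) : Prop := {
  E_meromorphic : forall m, meromorphic poles (fun z => E z m);
  scat_meromorphic : meromorphic poles scat;
  Psi_meromorphic : forall x y, 1 <= x -> meromorphic poles (fun z => Psi z x y);
  E_smooth : forall z, ~ poles z -> smooth_on_surface M (E z);
  E_eigen : forall z, ~ poles z -> eigenfunction M g (Cexp z) (E z);
  E_on_Y : forall z x y, ~ poles z -> 1 <= x ->
    let nu := (a + 1) / 2 in
    let w := (z / 2 + RtoC (ln (a + x)))%C in
    E z (cyl (x, y)) =
    (RtoC (Rpower (a + x) nu) * hankel2 nu w +
     scat z * RtoC (Rpower (a + x) nu) * hankel1 nu w +
     Psi z x y)%C;
  Psi_no_zero_mode : forall z x, ~ poles z -> 1 <= x ->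
    is_RInt (V := C_R_NormedModule) (fun y => Psi z x y) 0 1 (RtoC 0);
  Psi_decay : forall z eps, ~ poles z -> 0 < Im z < 2 * PI -> 0 < eps ->
    exists K x0, forall x y, 1 <= x -> x0 <= x ->
      Cmod (Psi z x y) <=
      K * (Rpower x (a / 2) *
           exp ((- (2 * PI) / ((a + 1) * Rpower a a) + eps) *
                Rpower (a + x) (a + 1)))
}.

(* [z = z_0 + 2 k_z pi i] with [- pi <= Im z_0 < pi]. *)
Definition kz (z : C) : Z := Int_part ((Im z + PI) / (2 * PI)).
Definition z0 (z : C) : C := (Re z, Im z - 2 * IZR (kz z) * PI).

Lemma z0_strip (z : C) : - PI <= Im (z0 z) < PI.
Proof.
unfold z0, kz; cbn [Im snd].
destruct (base_Int_part ((Im z + PI) / (2 * PI))) as [H1 H2].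
assert (Hpi := PI_RGT_0).
set (k := IZR _) in *.
assert (Heq : Im z + PI = (Im z + PI) / (2 * PI) * (2 * PI)) by (field; lra).
split; nra.
Qed.

Definition ell (rho : R -> R) (a : R) : R :=
  Rpower 2 a * Gamma ((a + 1) / 2) * rho a.

(* [z + 2 ln l(a)] *)
Definition zshift (rho : R -> R) (a : R) (z : C) : C :=
  (z + RtoC (2 * ln (ell rho a)))%C.

(* [sin (k pi (a+1)/2)] *)
Definition sink (a : R) (k : Z) : R := sin (IZR k * PI * ((a + 1) / 2)).

(* [e^(i t)] *)
Definition cis (t : R) : C := Cexp (Ci * RtoC t).

(* [l(a) e^(z_0/2)] *)
Definition freq (rho : R -> R) (a : R) (z : C) : C :=
  (RtoC (ell rho a) * Cexp (z0 z / 2))%C.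

(* The factor of [eta] which is inverted; its zeros are the poles of both
   [eta] and [xi], apart from the poles of [scat]. *)
Definition eta_bracket (rho : R -> R) (a : R) (scat : C -> C) (z : C) : C :=
  (RtoC (sink a (kz z) / cos (PI * a / 2)) * cis (PI * a / 4) +
   Ci * scat (zshift rho a z) *
     RtoC (sink a (kz z - 1) / cos (PI * a / 2)) * cis (- (PI * a / 4)))%C.

Definition eta (rho : R -> R) (a : R) (scat : C -> C) (z : C) : C :=
  (RtoC (Rpower a (- (a / 2))) *
   Csqrt (RtoC PI * freq rho a z / 2) *
   Cexp (- (Ci * RtoC a * freq rho a z)) *
   / eta_bracket rho a scat z)%C.

Definition xi (rho : R -> R) (a : R) (scat : C -> C) (z : C) : C :=
  ((Ci * RtoC (sink a (kz z + 1)) * cis (PI * a / 2) -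
    scat (zshift rho a z) * RtoC (sink a (kz z))) /
   (RtoC (sink a (kz z)) * cis (PI * a / 2) +
    Ci * scat (zshift rho a z) * RtoC (sink a (kz z - 1))) *
   Cexp (- (Ci * RtoC (2 * a) * freq rho a z)))%C.

Definition eigF (M : surface_with_end) (rho : R -> R) (a : R)
    (E : C -> M -> C) (scat : C -> C) (z : C) (m : M) : C :=
  (eta rho a scat z * E (zshift rho a z) m)%C.

(** * Regularity and limits of the amplitudes *)

(* Smoothness on the closed half-line [1,oo) means existence of a smooth
   extension to the real line. *)
Definition smooth_from_1 (f : R -> C) : Prop :=
  exists h : R -> C,
    (forall n t, ex_derive_n (fun x => Re (h x)) n t /\
                 ex_derive_n (fun x => Im (h x)) n t) /\
    (forall x, 1 <= x -> h x = f x).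

Definition regular_amplitude (p : C -> R -> C) : Prop :=
  (forall w x, Rabs (Im w) < PI -> 1 <= x -> holomorphic_at (fun v => p v x) w) /\
  (forall w, Rabs (Im w) < PI -> smooth_from_1 (p w)).

(* [P_a] and [Q_a] in terms of [p_a] and [q_a] *)
Definition dressed (a : R) (p : C -> R -> C) (w : C) (x : R) : C :=
  (RtoC (Rpower (1 + x / a) (a / 2) * exp (- (x / 2))) * p w x)%C.

(* [a] tends to infinity outside the odd integers. *)
Definition tends_to_1 (p : R -> C -> R -> C) (c eps : R) : Prop :=
  forall del, 0 < del -> exists A, forall a, 0 < a -> A < a -> not_odd a ->
    forall w x, 1 <= x -> c <= Re w -> Rabs (Im w) <= PI - eps ->
      Cmod (p a w x - 1) < del.

(* Main.v *)
Require Import Defs.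
From Stdlib Require Import Reals ZArith Lra Lia Psatz FunctionalExtensionality.
From Coquelicot Require Import Coquelicot.
Open Scope R_scope.

(** On [Y] the zero Fourier mode is a combination of Hankel functions of order
    [nu = (a+1)/2] at [zeta e^(i k pi)], [zeta = l(a) (a+x) e^(z_0/2)], where
    [Re zeta > 0].  The rotation formulas for [J_nu] and [J_(-nu)] rewrite it in
    terms of the Hankel functions at [zeta], and [p], [q] are these divided by
    their leading asymptotics; it remains to prove the asymptotics with an error
    controlled by [nu^2 / Re zeta], which tends to 0 since [l(a) >= 2^a / O(a^2)].

    Write [y = zeta^(1/2) H_nu = A e^(i zeta) + B e^(-i zeta)] by variation of
    constants.  Since [A' , B' = O(nu^2 / zeta^2) y], Gronwall's inequality along
    horizontal lines, on which [e^(-2 i zeta)] has constant modulus, reduces the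
    estimate to the limits of [A] and [B] on the positive real axis.  For [J_nu]
    the limit of [B] is the same along the imaginary axis, where it is read off
    from [I_nu(t) ~ e^t / sqrt (2 pi t)], and [A] is the conjugate of [B] on the
    real axis.  The growth of [I_nu] is explicit for half-integers ([Gamma (1/2) =
    sqrt pi] comes from Wallis' product) and is interpolated in between term by
    term, using the log-convexity of [Gamma] and the concentration of the series
    around its largest terms. *)

(** * The Gamma function *)

(** The Bessel functions are given by their power series, whose size at a large real argument
    results from cancellation. At an imaginary argument the terms of order nu > -1 are positive, and
    elementary comparisons suffice; this is why the connection constant is sought off the real axis.
    Only the coefficient of the exponential that dominates in the upper half-plane is visible there,
    the other one being hidden behind it; complex conjugation, available because the order is real,
    supplies the second coefficient.

    The error must be uniform in the order as well as in the argument. Staying at distance eps from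
    the boundary of the strip keeps Re zeta above sin (eps/2) |zeta|. *)

Definition nonpole (x : R) : Prop := forall n : nat, x + INR n <> 0.

Definition gauss_seq (x : R) (n : nat) : R :=
  INR (fact n) * Rpower (INR n) x / rising x n.

Lemma nonpole_pos x : 0 < x -> nonpole x.
Proof. intros Hx n; generalize (pos_INR n); lra. Qed.

Lemma nonpole_S x : nonpole x -> nonpole (x + 1).
Proof. intros H n; specialize (H (S n)); rewrite S_INR in H; lra. Qed.

Lemma nonpole_add x m : nonpole x -> nonpole (x + INR m).
Proof.
intros H n; specialize (H (m + n)%nat); rewrite plus_INR in H; lra.
Qed.

Lemma rising_ne0 x n : nonpole x -> rising x n <> 0.
Proof.
intros H; induction n as [|n IH]; simpl rising.
- specialize (H O); simpl in H; lra.
- apply Rmult_integral_contrapositive_currified; [exact IH|exact (H (S n))].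
Qed.

Lemma rising_pos x n : 0 < x -> 0 < rising x n.
Proof.
intros H; induction n as [|n IH]; simpl rising; [exact H|].
apply Rmult_lt_0_compat; [exact IH|].
generalize (pos_INR (S n)); simpl; lra.
Qed.

Lemma rising_shift x n : rising (x + 1) n * x = rising x n * (x + 1 + INR n).
Proof.
induction n as [|n IH]; cbn [rising]; [simpl; ring|].
rewrite (Rmult_assoc (rising (x + 1) n)), (Rmult_comm _ x), <- Rmult_assoc, IH,
  !S_INR; ring.
Qed.

Lemma INR_S_pos n : 0 < INR (S n).
Proof. apply lt_0_INR; lia. Qed.

Lemma fact_pos n : 0 < INR (fact n).
Proof. apply lt_0_INR, lt_O_fact. Qed.

Lemma Rpower_pos x y : 0 < Rpower x y.
Proof. apply exp_pos. Qed.

Lemma gauss_seq_pos x n : 0 < x -> 0 < gauss_seq x n.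
Proof.
intros Hx; apply Rdiv_lt_0_compat; [|exact (rising_pos _ _ Hx)].
apply Rmult_lt_0_compat; [apply fact_pos|apply Rpower_pos].
Qed.

(** Stated from index 1 on: at index 0 the convention ln 0 = 0 makes [Rpower (INR 0) x] equal to 1,
    and the identity fails. *)
Lemma gauss_seq_shift x n : nonpole x ->
  gauss_seq (x + 1) (S n) =
  gauss_seq x (S n) * (x * (INR (S n) / (x + 1 + INR (S n)))).
Proof.
intros Hx; unfold gauss_seq.
assert (Hx0 : x <> 0) by (specialize (Hx O); simpl in Hx; lra).
assert (H1 : x + 1 + INR (S n) <> 0).
{ specialize (Hx (S (S n))); rewrite S_INR in Hx; lra. }
assert (H2 := rising_ne0 x (S n) Hx).
assert (H3 := rising_ne0 (x + 1) (S n) (nonpole_S _ Hx)).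
assert (H4 := rising_shift x (S n)).
rewrite Rpower_plus, Rpower_1 by apply INR_S_pos.
set (r1 := rising (x + 1) (S n)) in *; set (r := rising x (S n)) in *.
replace r1 with (r * (x + 1 + INR (S n)) / x) by (rewrite <- H4; field; assumption).
field; auto.
Qed.

Lemma lim_INR_ratio c : is_lim_seq (fun n => INR (S n) / (c + INR (S n))) 1.
Proof.
assert (Hinf : is_lim_seq (fun n => c + INR (S n)) p_infty).
{ eapply is_lim_seq_plus;
    [apply is_lim_seq_const|apply -> is_lim_seq_incr_1; apply is_lim_seq_INR|].
  reflexivity. }
assert (H : is_lim_seq (fun n => 1 - c * / (c + INR (S n))) 1).
{ replace (Finite 1) with (Finite (1 - c * 0)) by (f_equal; ring).
  apply is_lim_seq_minus'; [apply is_lim_seq_const|].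
  apply (is_lim_seq_scal_l _ c (Finite 0)).
  apply (is_lim_seq_inv _ p_infty Hinf); discriminate. }
eapply is_lim_seq_ext_loc; [|exact H].
apply is_lim_seq_spec in Hinf; destruct (Hinf 0) as [N HN].
exists N; intros n Hn; specialize (HN n Hn); field; lra.
Qed.

Lemma lim_shift_factor x :
  is_lim_seq (fun n => x * (INR (S n) / (x + 1 + INR (S n)))) x.
Proof.
replace (Finite x) with (Finite (x * 1)) by (f_equal; ring).
apply (is_lim_seq_scal_l _ x (Finite 1)), lim_INR_ratio.
Qed.

Lemma exp_le x y : x <= y -> exp x <= exp y.
Proof.
intros [H| ->]; [apply Rlt_le, exp_increasing, H|apply Rle_refl].
Qed.

Lemma gauss_lim_up x l : nonpole x ->
  is_lim_seq (gauss_seq x) (Finite l) ->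
  is_lim_seq (gauss_seq (x + 1)) (Finite (x * l)).
Proof.
intros Hx Hl; apply is_lim_seq_incr_1.
apply is_lim_seq_ext with (1 := fun n => eq_sym (gauss_seq_shift x n Hx)).
rewrite Rmult_comm; apply is_lim_seq_mult'; [|apply lim_shift_factor].
apply -> is_lim_seq_incr_1; exact Hl.
Qed.

Lemma gauss_lim_down x l : nonpole x ->
  is_lim_seq (gauss_seq (x + 1)) (Finite l) ->
  is_lim_seq (gauss_seq x) (Finite (l / x)).
Proof.
intros Hx Hl; apply is_lim_seq_incr_1.
assert (Hx0 : x <> 0) by (specialize (Hx O); simpl in Hx; lra).
apply is_lim_seq_ext with
  (fun n => gauss_seq (x + 1) (S n) / (x * (INR (S n) / (x + 1 + INR (S n))))).
- intros n; rewrite (gauss_seq_shift x n Hx); field.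
  assert (H := INR_S_pos n); repeat split; try lra.
  specialize (Hx (S (S n))); rewrite S_INR in Hx; lra.
- apply is_lim_seq_div'; [|apply lim_shift_factor|exact Hx0].
  apply -> is_lim_seq_incr_1; exact Hl.
Qed.

Lemma ln_le_sub1 y : 0 < y -> ln y <= y - 1.
Proof.
intros Hy; generalize (exp_ineq1_le (ln y)); rewrite exp_ln by exact Hy; lra.
Qed.

(** With m = n + 1 the quotient of consecutive terms is at least 1 because (1 + 1/m)^x >= 1 + x/(m +
    1), which follows from ln (1 + 1/m) >= 1/(m + 1). *)
Lemma gauss_seq_incr x n : 0 < x ->
  gauss_seq x (S n) <= gauss_seq x (S (S n)).
Proof.
intros Hx; unfold gauss_seq.
set (m := S n); assert (Hm : 0 < INR m) by apply INR_S_pos.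
assert (Hr := rising_pos x m Hx).
change (rising x (S m)) with (rising x m * (x + INR (S m))).
rewrite fact_simpl, mult_INR, S_INR.
assert (Hf := fact_pos m).
assert (Hkey : (x + (INR m + 1)) * Rpower (INR m) x <=
               (INR m + 1) * Rpower (INR m + 1) x).
{ unfold Rpower.
  assert (Hl : ln (INR m) - ln (INR m + 1) <= INR m / (INR m + 1) - 1).
  { rewrite <- ln_div by lra; apply ln_le_sub1, Rdiv_lt_0_compat; lra. }
  assert (He : 1 + x / (INR m + 1) <= exp (x * (ln (INR m + 1) - ln (INR m)))).
  { eapply Rle_trans; [apply exp_ineq1_le|].
    apply exp_le; unfold Rdiv; apply Rmult_le_compat_l; [lra|].
    replace (INR m / (INR m + 1) - 1) with (- / (INR m + 1)) in Hl by (field; lra).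
    lra. }
  replace (x * ln (INR m + 1)) with
    (x * (ln (INR m + 1) - ln (INR m)) + x * ln (INR m)) by ring.
  rewrite exp_plus, <- Rmult_assoc; apply Rmult_le_compat_r;
    [apply Rlt_le, exp_pos|].
  apply Rle_trans with ((INR m + 1) * (1 + x / (INR m + 1))).
  - right; field; lra.
  - apply Rmult_le_compat_l; lra. }
apply Rmult_le_reg_r with (rising x m * (x + (INR m + 1))).
{ apply Rmult_lt_0_compat; lra. }
apply Rle_trans with (INR (fact m) * ((x + (INR m + 1)) * Rpower (INR m) x)).
{ right; field; lra. }
apply Rle_trans with (INR (fact m) * ((INR m + 1) * Rpower (INR m + 1) x)).
{ apply Rmult_le_compat_l; lra. }
right; field; lra.
Qed.

(** * Log-convexity and convergence of Gauss' product *)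

Lemma ln_concave a b t : 0 < a -> 0 < b -> 0 <= t <= 1 ->
  (1 - t) * ln a + t * ln b <= ln ((1 - t) * a + t * b).
Proof.
intros Ha Hb Ht; set (m := (1 - t) * a + t * b).
assert (Hm : 0 < m) by (unfold m; nra).
assert (H1 : ln a - ln m <= a / m - 1).
{ rewrite <- ln_div by lra; apply ln_le_sub1, Rdiv_lt_0_compat; lra. }
assert (H2 : ln b - ln m <= b / m - 1).
{ rewrite <- ln_div by lra; apply ln_le_sub1, Rdiv_lt_0_compat; lra. }
assert (H3 : (1 - t) * (a / m) + t * (b / m) = 1) by (unfold m; field; fold m; lra).
nra.
Qed.

Lemma ln_rising_concave x y t n : 0 < x -> 0 < y -> 0 <= t <= 1 ->
  (1 - t) * ln (rising x n) + t * ln (rising y n) <=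
  ln (rising ((1 - t) * x + t * y) n).
Proof.
intros Hx Hy Ht; assert (Hz : 0 < (1 - t) * x + t * y) by nra.
induction n as [|n IH]; [apply ln_concave; assumption|].
cbn [rising].
assert (Hn := pos_INR (S n)).
rewrite !ln_mult by (try (apply rising_pos; assumption); lra).
assert (H := ln_concave (x + INR (S n)) (y + INR (S n)) t
  ltac:(lra) ltac:(lra) Ht).
replace ((1 - t) * (x + INR (S n)) + t * (y + INR (S n))) with
  ((1 - t) * x + t * y + INR (S n)) in H by ring.
lra.
Qed.

Lemma ln_gauss_seq x n : 0 < x ->
  ln (gauss_seq x n) = ln (INR (fact n)) + x * ln (INR n) - ln (rising x n).
Proof.
intros Hx; unfold gauss_seq.
assert (Hf := fact_pos n); assert (Hp := Rpower_pos (INR n) x).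
rewrite ln_div, ln_mult by
  (try apply Rmult_lt_0_compat; try apply rising_pos; assumption).
unfold Rpower at 1; rewrite ln_exp; reflexivity.
Qed.

(** The numerator is log-affine in x and the denominator is a product of log-concave factors, so
    convexity holds before the limit is taken. *)
Lemma ln_gauss_seq_convex x y t n : 0 < x -> 0 < y -> 0 <= t <= 1 ->
  ln (gauss_seq ((1 - t) * x + t * y) n) <=
  (1 - t) * ln (gauss_seq x n) + t * ln (gauss_seq y n).
Proof.
intros Hx Hy Ht; rewrite !ln_gauss_seq by nra.
generalize (ln_rising_concave x y t n Hx Hy Ht); nra.
Qed.

Lemma rising_1 n : rising 1 n = INR (fact (S n)).
Proof.
induction n as [|n IH]; [reflexivity|].
cbn [rising]; rewrite IH, (fact_simpl (S n)), mult_INR, (S_INR (S n)); ring.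
Qed.

Lemma gauss_seq_1 n : gauss_seq 1 (S n) = INR (S n) / INR (S (S n)).
Proof.
unfold gauss_seq; rewrite rising_1, Rpower_1 by apply INR_S_pos.
rewrite (fact_simpl (S n)), mult_INR.
assert (H := fact_pos (S n)); assert (H' := INR_S_pos (S n)).
field; split; lra.
Qed.

(** At x = 1 and x = 2 the terms are explicit and at most 1; log-convexity carries the bound to the
    interval between. *)
Lemma gauss_seq_le1 x n : 1 <= x <= 2 -> gauss_seq x (S n) <= 1.
Proof.
intros Hx; assert (H1 : gauss_seq 1 (S n) <= 1).
{ rewrite gauss_seq_1, (S_INR (S n)); assert (H := INR_S_pos n).
  apply Rmult_le_reg_r with (INR (S n) + 1); [lra|].
  unfold Rdiv; rewrite Rmult_assoc, Rinv_l; lra. }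
assert (H2 : gauss_seq 2 (S n) <= 1).
{ replace 2 with (1 + 1) by ring.
  rewrite gauss_seq_shift by (apply nonpole_pos; lra).
  assert (Hp := gauss_seq_pos 1 (S n) ltac:(lra)).
  assert (H := INR_S_pos n).
  assert (1 * (INR (S n) / (1 + 1 + INR (S n))) <= 1).
  { rewrite Rmult_1_l; apply Rmult_le_reg_r with (1 + 1 + INR (S n)); [lra|].
    unfold Rdiv; rewrite Rmult_assoc, Rinv_l; lra. }
  assert (0 <= 1 * (INR (S n) / (1 + 1 + INR (S n)))).
  { rewrite Rmult_1_l; apply Rlt_le, Rdiv_lt_0_compat; lra. }
  nra. }
assert (Hc := ln_gauss_seq_convex 1 2 (x - 1) (S n)
  ltac:(lra) ltac:(lra) ltac:(lra)).
replace ((1 - (x - 1)) * 1 + (x - 1) * 2) with x in Hc by ring.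
assert (Hl1 := ln_le_sub1 _ (gauss_seq_pos 1 (S n) ltac:(lra))).
assert (Hl2 := ln_le_sub1 _ (gauss_seq_pos 2 (S n) ltac:(lra))).
assert (Hl : ln (gauss_seq x (S n)) <= ln 1) by (rewrite ln_1; nra).
destruct (Rle_lt_dec (gauss_seq x (S n)) 1) as [H|H]; [exact H|].
apply ln_increasing in H; lra.
Qed.

(** On [1,2] the sequence is increasing and bounded. The functional equation moves convergence
    upwards to [1,oo) and then downwards past the poles. *)
Lemma gauss_lim_ex x : nonpole x ->
  exists l : R, is_lim_seq (gauss_seq x) l.
Proof.
assert (H12 : forall x, 1 <= x <= 2 -> exists l : R, is_lim_seq (gauss_seq x) l).
{ clear x; intros x Hx.
  destruct (ex_finite_lim_seq_incr (fun n => gauss_seq x (S n)) 1) as [l Hl].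
  - intros n; apply gauss_seq_incr; lra.
  - intros n; apply gauss_seq_le1; exact Hx.
  - exists l; apply is_lim_seq_incr_1; exact Hl. }
assert (Hup : forall n x, 1 <= x <= INR n + 2 ->
  exists l : R, is_lim_seq (gauss_seq x) l).
{ clear x; induction n as [|n IH]; intros x Hx.
  - apply H12; simpl in Hx; lra.
  - rewrite S_INR in Hx; destruct (Rle_lt_dec x 2) as [H|H].
    + apply H12; lra.
    + destruct (IH (x - 1)) as [l Hl]; [lra|].
      exists ((x - 1) * l); replace x with (x - 1 + 1) at 1 by ring.
      apply gauss_lim_up; [apply nonpole_pos; lra|exact Hl]. }
assert (Hge1 : forall x, 1 <= x -> exists l : R, is_lim_seq (gauss_seq x) l).
{ clear x; intros x Hx; destruct (INR_unbounded x) as [n Hn].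
  apply (Hup n); lra. }
assert (Hdown : forall n x, nonpole x -> 1 <= x + INR n ->
  exists l : R, is_lim_seq (gauss_seq x) l).
{ clear x; induction n as [|n IH]; intros x Hx H.
  - apply Hge1; simpl in H; lra.
  - rewrite S_INR in H; destruct (IH (x + 1) (nonpole_S _ Hx)) as [l Hl]; [lra|].
    exists (l / x); apply gauss_lim_down; assumption. }
intros Hx; destruct (INR_unbounded (1 - x)) as [n Hn].
apply (Hdown n); [exact Hx|lra].
Qed.

Lemma Gamma_lim x : nonpole x -> is_lim_seq (gauss_seq x) (Gamma x).
Proof.
intros Hx; destruct (gauss_lim_ex x Hx) as [l Hl].
unfold Gamma; fold (gauss_seq x).
rewrite (is_lim_seq_unique _ _ Hl); exact Hl.
Qed.

Lemma Gamma_S x : nonpole x -> Gamma (x + 1) = x * Gamma x.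
Proof.
intros Hx.
assert (H := is_lim_seq_unique _ _ (gauss_lim_up _ _ Hx (Gamma_lim x Hx))).
unfold Gamma at 1; fold (gauss_seq (x + 1)); rewrite H; reflexivity.
Qed.

(** The left side is the term of index 1 of the increasing sequence. This crude bound is all that is
    used about the size of l(a). *)
Lemma Gamma_ge x : 0 < x -> / (x * (x + 1)) <= Gamma x.
Proof.
intros Hx; assert (Hl := Gamma_lim x (nonpole_pos x Hx)).
apply is_lim_seq_incr_1 in Hl.
assert (H := is_lim_seq_incr_compare _ _ Hl (fun n => gauss_seq_incr x n Hx) O).
unfold gauss_seq in H; simpl in H; unfold Rpower in H.
rewrite ln_1, Rmult_0_r, exp_0, !Rmult_1_l in H.
unfold Rdiv in H; rewrite Rmult_1_l in H; exact H.
Qed.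

Lemma Gamma_pos x : 0 < x -> 0 < Gamma x.
Proof.
intros Hx; eapply Rlt_le_trans; [|exact (Gamma_ge x Hx)].
apply Rinv_0_lt_compat; nra.
Qed.

Lemma Gamma_ne0 x : nonpole x -> Gamma x <> 0.
Proof.
assert (H : forall n x, nonpole x -> 0 < x + INR n -> Gamma x <> 0).
{ clear x; induction n as [|n IH]; intros x Hx Hn.
  - simpl in Hn; apply Rgt_not_eq, Gamma_pos; lra.
  - rewrite S_INR in Hn.
    assert (H := IH (x + 1) (nonpole_S _ Hx) ltac:(lra)).
    rewrite (Gamma_S x Hx) in H; intros H0; rewrite H0, Rmult_0_r in H; lra. }
intros Hx; destruct (INR_unbounded (- x)) as [n Hn].
apply (H n); [exact Hx|lra].
Qed.

Lemma ln_Gamma_convex x y t : 0 < x -> 0 < y -> 0 <= t <= 1 ->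
  ln (Gamma ((1 - t) * x + t * y)) <= (1 - t) * ln (Gamma x) + t * ln (Gamma y).
Proof.
intros Hx Hy Ht.
assert (Hln : forall u, 0 < u ->
  is_lim_seq (fun n => ln (gauss_seq u n)) (ln (Gamma u))).
{ intros u Hu; apply (is_lim_seq_continuous ln).
  - apply continuity_pt_filterlim, continuous_ln, Gamma_pos, Hu.
  - apply Gamma_lim, nonpole_pos, Hu. }
assert (Hz : 0 < (1 - t) * x + t * y) by nra.
apply (is_lim_seq_le _ _ (Finite _) (Finite _)
  (fun n => ln_gauss_seq_convex x y t n Hx Hy Ht) (Hln _ Hz)).
apply is_lim_seq_plus'; apply (is_lim_seq_scal_l _ _ (Finite _));
  apply Hln; assumption.
Qed.

(** Log-convexity twice: z - d lies between z - 1 and z, and z lies between z - d and z - d + 1;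
    [Gamma_S] evaluates the unit steps. *)
Lemma Gamma_ratio_bounds z d : 1 < z -> 0 <= d <= 1 ->
  Rpower (z - 1) d <= Gamma z / Gamma (z - d) <= Rpower (z - d) d.
Proof.
intros Hz Hd; assert (Hzd : 0 < z - d) by lra.
assert (H1 := ln_Gamma_convex z (z - 1) d ltac:(lra) ltac:(lra) Hd).
replace ((1 - d) * z + d * (z - 1)) with (z - d) in H1 by ring.
assert (H2 := ln_Gamma_convex (z - d) (z - d + 1) d ltac:(lra) ltac:(lra) Hd).
replace ((1 - d) * (z - d) + d * (z - d + 1)) with z in H2 by ring.
assert (G1 := Gamma_S (z - 1) (nonpole_pos (z - 1) ltac:(lra))).
replace (z - 1 + 1) with z in G1 by ring.
assert (G2 := Gamma_S (z - d) (nonpole_pos (z - d) ltac:(lra))).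
assert (P0 := Gamma_pos z ltac:(lra)); assert (P1 := Gamma_pos (z - 1) ltac:(lra)).
assert (P2 := Gamma_pos (z - d) ltac:(lra)).
assert (L1 : ln (Gamma z) = ln (z - 1) + ln (Gamma (z - 1)))
  by (rewrite G1 at 1; apply ln_mult; lra).
rewrite G2, ln_mult in H2 by lra.
assert (E : Gamma z / Gamma (z - d) = exp (ln (Gamma z) - ln (Gamma (z - d)))).
{ rewrite <- ln_div by lra; rewrite exp_ln; [reflexivity|].
  apply Rdiv_lt_0_compat; lra. }
rewrite E; unfold Rpower; split; apply exp_le; nra.
Qed.

(** * Wallis' integrals and the value of Gamma at 1/2 *)

Definition wallis (n : nat) : R := RInt (fun x => sin x ^ n) 0 (PI / 2).

Lemma ex_RInt_sin_pow n : ex_RInt (fun x => sin x ^ n) 0 (PI / 2).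
Proof.
apply (ex_RInt_continuous (V := R_CompleteNormedModule)); intros x _.
apply (ex_derive_continuous (V := R_NormedModule)); auto_derive; trivial.
Qed.

Lemma wallis_rec n : INR (n + 2) * wallis (n + 2) = INR (n + 1) * wallis n.
Proof.
assert (H : is_RInt (fun x => INR (n + 2) * sin x ^ (n + 2) -
                              INR (n + 1) * sin x ^ n) 0 (PI / 2)
  (minus (- cos (PI / 2) * sin (PI / 2) ^ (n + 1)) (- cos 0 * sin 0 ^ (n + 1)))).
{ apply (is_RInt_derive (V := R_CompleteNormedModule)
    (fun x => - cos x * sin x ^ (n + 1))).
  - intros x _; auto_derive; trivial.
    replace (Init.Nat.pred (n + 1)) with n by lia.
    rewrite !pow_add, !plus_INR; simpl.
    assert (Hsc := sin2_cos2 x); unfold Rsqr in Hsc.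
    ring_simplify; replace (cos x ^ 2) with (1 - sin x ^ 2) by (simpl; lra); ring.
  - intros x _; apply (ex_derive_continuous (V := R_NormedModule)).
    auto_derive; trivial. }
assert (H' : is_RInt (fun x => INR (n + 2) * sin x ^ (n + 2) -
                              INR (n + 1) * sin x ^ n) 0 (PI / 2)
  (minus (scal (INR (n + 2)) (wallis (n + 2))) (scal (INR (n + 1)) (wallis n)))).
{ apply (is_RInt_minus (V := R_NormedModule));
  apply (is_RInt_scal (V := R_NormedModule));
  apply (RInt_correct (V := R_CompleteNormedModule)), ex_RInt_sin_pow. }
assert (E := eq_trans (eq_sym (is_RInt_unique _ _ _ _ H))
  (is_RInt_unique _ _ _ _ H')).
rewrite cos_PI2, sin_0, (pow_i (n + 1)) in E by lia.
change (- 0 * sin (PI / 2) ^ (n + 1) - - cos 0 * 0 =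
  INR (n + 2) * wallis (n + 2) - INR (n + 1) * wallis n) in E.
lra.
Qed.

Lemma wallis_decr n : wallis (S n) <= wallis n.
Proof.
assert (Hpi := PI_RGT_0).
apply RInt_le; [lra|apply ex_RInt_sin_pow|apply ex_RInt_sin_pow|].
intros x Hx.
assert (0 <= sin x) by (apply sin_ge_0; lra).
assert (sin x <= 1) by apply SIN_bound.
assert (0 <= sin x ^ n) by (apply pow_le; assumption).
simpl; nra.
Qed.

Lemma wallis_0 : wallis 0 = PI / 2.
Proof.
unfold wallis; simpl; rewrite RInt_const; unfold scal; simpl; unfold mult; simpl; lra.
Qed.

Lemma wallis_1 : wallis 1 = 1.
Proof.
unfold wallis.
assert (H : is_RInt (fun x => sin x ^ 1) 0 (PI / 2)
  (minus (- cos (PI / 2)) (- cos 0))).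
{ apply (is_RInt_derive (V := R_CompleteNormedModule) (fun x => - cos x)).
  - intros x _; auto_derive; trivial; ring.
  - intros x _; apply (ex_derive_continuous (V := R_NormedModule)).
    auto_derive; trivial. }
rewrite (is_RInt_unique _ _ _ _ H), cos_PI2, cos_0.
change (- 0 - - (1) = 1); ring.
Qed.

(** The usual double factorials are expressed by [rising (1 / 2)], the denominator of Gauss' product
    at 1/2, so that [gauss_seq (1 / 2) n] equals 2 sqrt n W_(2n+1) for n >= 1. *)
Lemma wallis_values n :
  wallis (2 * n + 1) = INR (fact n) / (2 * rising (1 / 2) n) /\
  wallis (2 * n + 2) = PI / 2 * rising (1 / 2) n / INR (fact (S n)).
Proof.
induction n as [|n [IH1 IH2]].
- change (2 * 0 + 1)%nat with 1%nat; change (2 * 0 + 2)%nat with 2%nat.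
  assert (H := wallis_rec 0); change (0 + 2)%nat with 2%nat in H.
  rewrite wallis_0 in H; rewrite wallis_1; simpl in H |- *; lra.
- assert (Hr := rising_pos (1 / 2) n ltac:(lra)).
  assert (Hf := fact_pos n).
  assert (H1 := wallis_rec (2 * n + 1)); assert (H2 := wallis_rec (2 * n + 2)).
  replace (2 * n + 1 + 2)%nat with (2 * S n + 1)%nat in H1 by lia.
  replace (2 * n + 2 + 2)%nat with (2 * S n + 2)%nat in H2 by lia.
  rewrite IH1 in H1; rewrite IH2 in H2; clear IH1 IH2.
  replace (2 * n + 1 + 1)%nat with (2 * S n)%nat in H1 by lia.
  replace (2 * n + 2 + 1)%nat with (2 * S n + 1)%nat in H2 by lia.
  rewrite !plus_INR, !mult_INR in H1; rewrite !plus_INR, !mult_INR in H2.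
  cbn [rising]; rewrite !fact_simpl, !mult_INR, !(S_INR (S n)) in *.
  rewrite !(S_INR n) in *; change (INR 1) with 1 in *; change (INR 2) with 2 in *.
  assert (Hn := pos_INR n).
  split.
  + apply Rmult_eq_reg_l with (2 * (INR n + 1) + 1); [|lra].
    rewrite H1; field; repeat split; lra.
  + apply Rmult_eq_reg_l with (2 * (INR n + 1) + 2); [|lra].
    rewrite H2; field; repeat split; lra.
Qed.

(* Squeezes [n W_(2n+1)^2] between neighbouring products [n W_k W_(k+1)], where
   [W_k W_(k+1) = pi / (2 (k+1))]. *)
Lemma Gamma_half : Gamma (1 / 2) = sqrt PI.
Proof.
assert (Hpi := PI_RGT_0).
assert (HG := Gamma_pos (1 / 2) ltac:(lra)).
assert (Hl := Gamma_lim (1 / 2) (nonpole_pos (1 / 2) ltac:(lra))).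
apply is_lim_seq_incr_1 in Hl.
assert (Hsq := is_lim_seq_mult' _ _ _ _ Hl Hl).
assert (HW : forall n, gauss_seq (1 / 2) (S n) * gauss_seq (1 / 2) (S n) =
  4 * INR (S n) * (wallis (2 * S n + 1) * wallis (2 * S n + 1))).
{ intros n; rewrite (proj1 (wallis_values (S n))); unfold gauss_seq.
  replace (1 / 2) with (/ 2) at 1 3 by lra.
  rewrite Rpower_sqrt by apply INR_S_pos.
  assert (Hr := rising_pos (1 / 2) (S n) ltac:(lra)).
  assert (Hs := sqrt_sqrt (INR (S n)) (Rlt_le _ _ (INR_S_pos n))).
  set (t := sqrt (INR (S n))) in *; rewrite <- Hs; field; lra. }
assert (Hlow : forall n, PI * (INR (S n) / (1 + INR (S n))) <=
  gauss_seq (1 / 2) (S n) * gauss_seq (1 / 2) (S n)).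
{ intros n; rewrite HW.
  assert (Hn := INR_S_pos n).
  apply Rle_trans with
    (4 * INR (S n) * (wallis (2 * S n + 1) * wallis (2 * S n + 2))).
  - destruct (wallis_values (S n)) as [-> ->]; right.
    assert (Hr := rising_pos (1 / 2) (S n) ltac:(lra)).
    assert (Hf := fact_pos (S n)).
    rewrite (fact_simpl (S n)), mult_INR, (S_INR (S n)); field; lra.
  - apply Rmult_le_compat_l; [lra|]; apply Rmult_le_compat_l.
    + rewrite (proj1 (wallis_values (S n))); apply Rlt_le, Rdiv_lt_0_compat.
      * apply fact_pos.
      * assert (Hr := rising_pos (1 / 2) (S n) ltac:(lra)); lra.
    + replace (2 * S n + 2)%nat with (S (2 * S n + 1)) by lia; apply wallis_decr. }
assert (Hup : forall n, gauss_seq (1 / 2) (S n) * gauss_seq (1 / 2) (S n) <= PI).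
{ intros n; rewrite HW.
  assert (Hn := INR_S_pos n).
  apply Rle_trans with
    (4 * INR (S n) * (wallis (2 * S n) * wallis (2 * S n + 1))).
  - apply Rmult_le_compat_l; [lra|]; apply Rmult_le_compat_r.
    + rewrite (proj1 (wallis_values (S n))); apply Rlt_le, Rdiv_lt_0_compat.
      * apply fact_pos.
      * assert (Hr := rising_pos (1 / 2) (S n) ltac:(lra)); lra.
    + replace (2 * S n + 1)%nat with (S (2 * S n)) by lia; apply wallis_decr.
  - replace (2 * S n)%nat with (2 * n + 2)%nat at 1 by lia.
    rewrite (proj1 (wallis_values (S n))), (proj2 (wallis_values n)).
    assert (Hr := rising_pos (1 / 2) n ltac:(lra)).
    assert (Hf := fact_pos (S n)).
    cbn [rising].
    apply Rle_trans with (PI * (INR (S n) / (1 / 2 + INR (S n)))).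
    + right; field; repeat split; lra.
    + rewrite <- (Rmult_1_r PI) at 2; apply Rmult_le_compat_l; [lra|].
      apply Rmult_le_reg_r with (1 / 2 + INR (S n)); [lra|].
      unfold Rdiv at 1; rewrite Rmult_assoc, Rinv_l; lra. }
assert (HL : is_lim_seq (fun n => PI * (INR (S n) / (1 + INR (S n)))) PI).
{ rewrite <- (Rmult_1_r PI) at 1.
  apply (is_lim_seq_scal_l _ PI (Finite 1)), lim_INR_ratio. }
assert (E : Gamma (1 / 2) * Gamma (1 / 2) = PI).
{ apply Rle_antisym.
  - exact (is_lim_seq_le _ _ (Finite _) (Finite _) Hup Hsq (is_lim_seq_const PI)).
  - exact (is_lim_seq_le _ _ (Finite _) (Finite _) Hlow HL Hsq). }
rewrite <- E; symmetry; apply sqrt_square; lra.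
Qed.

(** * The complex exponential and derivatives of complex functions *)

Lemma C_ext (z w : C) : Re z = Re w -> Im z = Im w -> z = w.
Proof. destruct z, w; simpl; intros -> ->; reflexivity. Qed.

Lemma RtoC_ne0 x : x <> 0 -> RtoC x <> RtoC 0.
Proof. intros H E; exact (H (RtoC_inj _ _ E)). Qed.

Lemma Cexp_add z w : Cexp (z + w)%C = (Cexp z * Cexp w)%C.
Proof.
unfold Cexp; rewrite re_plus, im_plus, exp_plus, cos_plus, sin_plus.
apply C_ext; simpl; ring.
Qed.

Lemma Cexp_0 : Cexp (RtoC 0) = RtoC 1.
Proof. unfold Cexp; simpl; rewrite exp_0, cos_0, sin_0; apply C_ext; simpl; ring. Qed.

Lemma Cexp_R x : Cexp (RtoC x) = RtoC (exp x).
Proof. unfold Cexp; simpl; rewrite cos_0, sin_0; apply C_ext; simpl; ring. Qed.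

Lemma Cexp_opp_l z : (Cexp (- z) * Cexp z)%C = RtoC 1.
Proof. rewrite <- Cexp_add, <- Cexp_0; f_equal; ring. Qed.

Lemma Cexp_ne0 z : Cexp z <> RtoC 0.
Proof.
intros H; assert (H' := Cexp_opp_l z); rewrite H, Cmult_0_r in H'.
apply C1_nz; symmetry; exact H'.
Qed.

Lemma Cexp_opp z : Cexp (- z)%C = (/ Cexp z)%C.
Proof.
rewrite <- (Cmult_1_r (Cexp (- z))), <- (Cinv_r (Cexp z)), Cmult_assoc, Cexp_opp_l.
- ring.
- apply Cexp_ne0.
Qed.

Lemma Cexp_sub z w : Cexp (z - w)%C = (Cexp z / Cexp w)%C.
Proof. unfold Cminus; rewrite Cexp_add, Cexp_opp; reflexivity. Qed.

Lemma Cmod_sqr z : Cmod z * Cmod z = Re z * Re z + Im z * Im z.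
Proof. generalize (Cmod2_alt z); simpl; lra. Qed.

Lemma Cmod_Cexp z : Cmod (Cexp z) = exp (Re z).
Proof.
unfold Cmod, Cexp; simpl.
replace (exp (Re z) * cos (Im z) * (exp (Re z) * cos (Im z) * 1) +
  exp (Re z) * sin (Im z) * (exp (Re z) * sin (Im z) * 1))
with (exp (Re z) * exp (Re z)).
- apply sqrt_square, Rlt_le, exp_pos.
- assert (H := sin2_cos2 (Im z)); unfold Rsqr in H.
  transitivity (exp (Re z) * exp (Re z) *
    (sin (Im z) * sin (Im z) + cos (Im z) * cos (Im z))); [rewrite H; ring|ring].
Qed.

Lemma Cexp_conj z : Cexp (Cconj z) = Cconj (Cexp z).
Proof.
destruct z; unfold Cexp; simpl; rewrite cos_neg, sin_neg; apply C_ext; simpl; ring.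
Qed.

Lemma Cmod_minus_triangle x y : Cmod (x - y) <= Cmod x + Cmod y.
Proof. unfold Cminus; rewrite <- (Cmod_opp y); apply Cmod_triangle. Qed.

Lemma Cmod_le_sub x y : Cmod x <= Cmod (x - y) + Cmod y.
Proof. replace x with (x - y + y)%C at 1 by ring; apply Cmod_triangle. Qed.

Lemma Re_le_Cmod z : Rabs (Re z) <= Cmod z.
Proof. exact (Rle_trans _ _ _ (Rmax_l _ _) (Rmax_Cmod z)). Qed.

Lemma Im_le_Cmod z : Rabs (Im z) <= Cmod z.
Proof. exact (Rle_trans _ _ _ (Rmax_r _ _) (Rmax_Cmod z)). Qed.

Lemma Cmod_le_Re_Im z : Cmod z <= Rabs (Re z) + Rabs (Im z).
Proof.
replace z with (RtoC (Re z) + Ci * RtoC (Im z))%C by (apply C_ext; simpl; ring).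
eapply Rle_trans; [apply Cmod_triangle|].
rewrite Cmod_mult, Cmod_Ci, !Cmod_R; simpl; right.
rewrite !Rmult_1_l; f_equal; f_equal; ring.
Qed.

(** * Derivatives in a complex and in a real variable *)

Definition cderiv (f : C -> C) (z l : C) : Prop :=
  forall eps, 0 < eps -> exists d, 0 < d /\ forall h : C, Cmod h < d ->
    Cmod (f (z + h) - f z - l * h)%C <= eps * Cmod h.

(** As for [cderiv], the remainder is bounded without dividing by h and with a weak inequality, so h
    = 0 needs no exclusion and the chain rule no case distinction. *)
Definition rderiv (f : R -> C) (t : R) (l : C) : Prop :=
  forall eps, 0 < eps -> exists d, 0 < d /\ forall h : R, Rabs h < d ->
    Cmod (f (t + h)%R - f t - l * RtoC h)%C <= eps * Rabs h.

Lemma cderiv_eq f z l l' : cderiv f z l -> l = l' -> cderiv f z l'.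
Proof. intros H <-; exact H. Qed.

Lemma rderiv_eq f z l l' : rderiv f z l -> l = l' -> rderiv f z l'.
Proof. intros H <-; exact H. Qed.

Lemma cderiv_ext f g z l : (forall w, f w = g w) -> cderiv f z l -> cderiv g z l.
Proof.
intros E H eps He; destruct (H eps He) as [d [Hd H']].
exists d; split; [exact Hd|]; intros h Hh; rewrite <- !E; apply H', Hh.
Qed.

Lemma rderiv_ext f g t l : (forall w, f w = g w) -> rderiv f t l -> rderiv g t l.
Proof.
intros E H eps He; destruct (H eps He) as [d [Hd H']].
exists d; split; [exact Hd|]; intros h Hh; rewrite <- !E; apply H', Hh.
Qed.

Lemma cderiv_holomorphic f z l : cderiv f z l -> holomorphic_at f z.
Proof.
intros H; exists l; split; [apply is_linear_scal_l|].
intros x Hx.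
apply (is_filter_lim_locally_unique (V := AbsRing_NormedModule C_AbsRing)) in Hx.
simpl in Hx; subst x.
intros eps; destruct (H eps (cond_pos eps)) as [d [Hd H']].
exists (mkposreal d Hd); intros y0 Hy; set (y := y0 : C).
change (Cmod (y - z) < d) in Hy.
specialize (H' (y - z)%C Hy).
replace (z + (y - z))%C with y in H' by ring.
eapply Rle_trans; [|exact H'].
right; change (Cmod (f y - f z - (y - z) * l) = Cmod (f y - f z - l * (y - z)))%C.
f_equal; ring.
Qed.

Lemma rderiv_Re_Im f t l : rderiv f t l ->
  is_derive (fun s => Re (f s)) t (Re l) /\
  is_derive (fun s => Im (f s)) t (Im l).
Proof.
intros H; split; apply is_derive_Reals; intros eps He;
  destruct (H (eps / 2) ltac:(lra)) as [d [Hd H']];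
  exists (mkposreal d Hd); intros h Hh0 Hh; specialize (H' h Hh);
  assert (Hh1 := Rabs_pos_lt h Hh0).
- assert (H1 := Re_le_Cmod (f (t + h)%R - f t - l * RtoC h)%C).
  replace (Re (f (t + h)%R - f t - l * RtoC h)%C) with
    (((Re (f (t + h)%R) - Re (f t)) / h - Re l) * h) in H1
    by (unfold Re, Im; simpl; field; exact Hh0).
  rewrite Rabs_mult in H1; nra.
- assert (H1 := Im_le_Cmod (f (t + h)%R - f t - l * RtoC h)%C).
  replace (Im (f (t + h)%R - f t - l * RtoC h)%C) with
    (((Im (f (t + h)%R) - Im (f t)) / h - Im l) * h) in H1
    by (unfold Re, Im; simpl; field; exact Hh0).
  rewrite Rabs_mult in H1; nra.
Qed.

Lemma rderiv_of_Re_Im f t l :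
  is_derive (fun s => Re (f s)) t (Re l) ->
  is_derive (fun s => Im (f s)) t (Im l) -> rderiv f t l.
Proof.
intros H1 H2 eps He; apply is_derive_Reals in H1; apply is_derive_Reals in H2.
destruct (H1 (eps / 2) ltac:(lra)) as [d1 D1].
destruct (H2 (eps / 2) ltac:(lra)) as [d2 D2].
assert (Hd1 := cond_pos d1); assert (Hd2 := cond_pos d2).
exists (Rmin d1 d2); split; [apply Rmin_pos; assumption|]; intros h Hh.
destruct (Req_dec h 0) as [->|Hh0].
{ replace (f (t + 0)%R - f t - l * RtoC 0)%C with (RtoC 0).
  - rewrite Cmod_0, Rabs_R0; lra.
  - rewrite Rplus_0_r; ring. }
specialize (D1 h Hh0 (Rlt_le_trans _ _ _ Hh (Rmin_l _ _))).
specialize (D2 h Hh0 (Rlt_le_trans _ _ _ Hh (Rmin_r _ _))).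
eapply Rle_trans; [apply Cmod_le_Re_Im|].
replace (Re (f (t + h)%R - f t - l * RtoC h)%C) with
    (((Re (f (t + h)%R) - Re (f t)) / h - Re l) * h)
  by (unfold Re, Im; simpl; field; exact Hh0).
replace (Im (f (t + h)%R - f t - l * RtoC h)%C) with
    (((Im (f (t + h)%R) - Im (f t)) / h - Im l) * h)
  by (unfold Re, Im; simpl; field; exact Hh0).
rewrite !Rabs_mult; assert (Hh1 := Rabs_pos_lt h Hh0); nra.
Qed.

Lemma cderiv_const c z : cderiv (fun _ => c) z (RtoC 0).
Proof.
intros eps He; exists 1; split; [lra|]; intros h _.
replace (c - c - RtoC 0 * h)%C with (RtoC 0) by ring.
rewrite Cmod_0; generalize (Cmod_ge_0 h); nra.
Qed.

Lemma cderiv_id z : cderiv (fun w => w) z (RtoC 1).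
Proof.
intros eps He; exists 1; split; [lra|]; intros h _.
replace (z + h - z - RtoC 1 * h)%C with (RtoC 0) by ring.
rewrite Cmod_0; generalize (Cmod_ge_0 h); nra.
Qed.

Lemma cderiv_plus f g z l m : cderiv f z l -> cderiv g z m ->
  cderiv (fun w => f w + g w)%C z (l + m)%C.
Proof.
intros Hf Hg eps He.
destruct (Hf (eps / 2) ltac:(lra)) as [d1 [D1 H1]].
destruct (Hg (eps / 2) ltac:(lra)) as [d2 [D2 H2]].
exists (Rmin d1 d2); split; [apply Rmin_pos; assumption|]; intros h Hh.
specialize (H1 h (Rlt_le_trans _ _ _ Hh (Rmin_l _ _))).
specialize (H2 h (Rlt_le_trans _ _ _ Hh (Rmin_r _ _))).
replace (f (z + h) + g (z + h) - (f z + g z) - (l + m) * h)%C with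
  ((f (z + h) - f z - l * h) + (g (z + h) - g z - m * h))%C by ring.
eapply Rle_trans; [apply Cmod_triangle|]; lra.
Qed.

Lemma cderiv_lip f z l : cderiv f z l -> exists d, 0 < d /\
  forall h, Cmod h < d -> Cmod (f (z + h) - f z)%C <= (Cmod l + 1) * Cmod h.
Proof.
intros H; destruct (H 1 ltac:(lra)) as [d [Hd H']]; exists d; split; [exact Hd|].
intros h Hh; specialize (H' h Hh).
replace (f (z + h) - f z)%C with ((f (z + h) - f z - l * h) + l * h)%C by ring.
eapply Rle_trans; [apply Cmod_triangle|]; rewrite Cmod_mult; lra.
Qed.

Lemma cderiv_mult f g z l m : cderiv f z l -> cderiv g z m ->
  cderiv (fun w => f w * g w)%C z (l * g z + f z * m)%C.
Proof.
intros Hf Hg eps He.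
set (K := Cmod (g z) + Cmod (f z) + (Cmod l + 1) + 1).
assert (HK : 0 < K).
{ unfold K; generalize (Cmod_ge_0 (g z)) (Cmod_ge_0 (f z)) (Cmod_ge_0 l); lra. }
assert (He' : 0 < eps / K) by (apply Rdiv_lt_0_compat; assumption).
destruct (Hf (eps / K) He') as [d1 [D1 H1]].
destruct (Hg (eps / K) He') as [d2 [D2 H2]].
destruct (cderiv_lip _ _ _ Hf) as [d3 [D3 H3]].
destruct (cderiv_lip _ _ _ Hg) as [d4 [D4 H4]].
set (d5 := eps / K / (Cmod m + 1)).
assert (D5 : 0 < d5).
{ apply Rdiv_lt_0_compat; [exact He'|]; generalize (Cmod_ge_0 m); lra. }
exists (Rmin (Rmin d1 d2) (Rmin (Rmin d3 d4) d5)); split.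
{ repeat apply Rmin_pos; assumption. }
intros h Hh.
assert (Hh1 := Rlt_le_trans _ _ _ Hh (Rmin_l _ _)).
assert (Hh2 := Rlt_le_trans _ _ _ Hh (Rmin_r _ _)).
assert (Hh5 := Rlt_le_trans _ _ _ Hh2 (Rmin_r _ _)).
assert (Hh3 := Rlt_le_trans _ _ _ Hh2 (Rmin_l _ _)).
specialize (H1 h (Rlt_le_trans _ _ _ Hh1 (Rmin_l _ _))).
specialize (H2 h (Rlt_le_trans _ _ _ Hh1 (Rmin_r _ _))).
specialize (H3 h (Rlt_le_trans _ _ _ Hh3 (Rmin_l _ _))).
specialize (H4 h (Rlt_le_trans _ _ _ Hh3 (Rmin_r _ _))).
replace (f (z + h) * g (z + h) - f z * g z - (l * g z + f z * m) * h)%C with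
  ((f (z + h) - f z - l * h) * g z + f z * (g (z + h) - g z - m * h) +
   (f (z + h) - f z) * (g (z + h) - g z))%C by ring.
eapply Rle_trans; [apply Cmod_triangle|].
eapply Rle_trans; [apply Rplus_le_compat_r, Cmod_triangle|].
rewrite !Cmod_mult.
assert (P := Cmod_ge_0 h); assert (Pf := Cmod_ge_0 (f z));
assert (Pg := Cmod_ge_0 (g z)); assert (Pl := Cmod_ge_0 l);
assert (Pm := Cmod_ge_0 m).
assert (H5 : Cmod (f (z + h) - f z)%C * Cmod (g (z + h) - g z)%C <=
  (Cmod l + 1) * (eps / K) * Cmod h).
{ apply Rle_trans with (((Cmod l + 1) * Cmod h) * ((Cmod m + 1) * Cmod h)).
  - apply Rmult_le_compat; try apply Cmod_ge_0; assumption.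
  - assert (Hq : (Cmod m + 1) * Cmod h <= eps / K).
    { apply Rle_trans with ((Cmod m + 1) * d5); [nra|].
      unfold d5; right; field; lra. }
    apply Rle_trans with ((Cmod l + 1) * Cmod h * (eps / K)); [|right; ring].
    apply Rmult_le_compat_l; [nra|exact Hq]. }
assert (E : eps * Cmod h = eps / K * Cmod h * K) by (field; lra).
rewrite E; unfold K at 2.
assert (Hfirst : Cmod (f (z + h) - f z - l * h)%C * Cmod (g z) <=
  eps / K * Cmod h * Cmod (g z)) by (apply Rmult_le_compat_r; assumption).
assert (Hsec : Cmod (f z) * Cmod (g (z + h) - g z - m * h)%C <=
  Cmod (f z) * (eps / K * Cmod h)) by (apply Rmult_le_compat_l; assumption).
assert (0 <= eps / K * Cmod h) by nra.
nra.
Qed.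

Lemma cderiv_scal c f z l : cderiv f z l ->
  cderiv (fun w => c * f w)%C z (c * l)%C.
Proof.
intros H; eapply cderiv_eq.
- apply (cderiv_mult (fun _ => c) f); [apply cderiv_const|exact H].
- ring.
Qed.

(** Common core of both chain rules: the inner function enters only through its increment k, whether
    its variable is real or complex. *)
Lemma comp_estimate f (u l m : C) eps : cderiv f u l -> 0 < eps ->
  exists e d, 0 < e /\ 0 < d /\ forall h k : C,
    Cmod h < d -> Cmod (k - m * h)%C <= e * Cmod h ->
    Cmod (f (u + k) - f u - l * m * h)%C <= eps * Cmod h.
Proof.
intros Hf He; assert (Pl := Cmod_ge_0 l); assert (Pm := Cmod_ge_0 m).
set (e1 := eps / 2 / (Cmod m + 1)); set (e2 := eps / 2 / (Cmod l + 1)).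
assert (He1 : 0 < e1) by (apply Rdiv_lt_0_compat; lra).
assert (He2 : 0 < e2) by (apply Rdiv_lt_0_compat; lra).
assert (E1 : e1 * (Cmod m + 1) = eps / 2) by (unfold e1; field; lra).
assert (E2 : (Cmod l + 1) * e2 = eps / 2) by (unfold e2; field; lra).
destruct (Hf e1 He1) as [d1 [D1 H1]].
exists (Rmin 1 e2), (d1 / (Cmod m + 1)).
split; [apply Rmin_pos; lra|split; [apply Rdiv_lt_0_compat; lra|]].
intros h k Hh Hk; assert (P := Cmod_ge_0 h).
assert (Hk1 : Cmod (k - m * h)%C <= Cmod h).
{ eapply Rle_trans; [exact Hk|]; generalize (Rmin_l 1 e2); nra. }
assert (Hk2 : Cmod (k - m * h)%C <= e2 * Cmod h).
{ eapply Rle_trans; [exact Hk|]; apply Rmult_le_compat_r; [exact P|apply Rmin_r]. }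
assert (Hk3 : Cmod k <= (Cmod m + 1) * Cmod h).
{ replace k with ((k - m * h) + m * h)%C by ring.
  eapply Rle_trans; [apply Cmod_triangle|]; rewrite Cmod_mult; lra. }
assert (Hkd : Cmod k < d1).
{ eapply Rle_lt_trans; [exact Hk3|].
  apply Rlt_le_trans with ((Cmod m + 1) * (d1 / (Cmod m + 1)));
    [apply Rmult_lt_compat_l; lra|right; field; lra]. }
specialize (H1 k Hkd).
replace (f (u + k) - f u - l * m * h)%C with
  ((f (u + k) - f u - l * k) + l * (k - m * h))%C by ring.
eapply Rle_trans; [apply Cmod_triangle|]; rewrite Cmod_mult.
assert (H2 : Cmod l * Cmod (k - m * h)%C <= Cmod l * (e2 * Cmod h))
  by (apply Rmult_le_compat_l; assumption).
assert (H3 : e1 * Cmod k <= e1 * ((Cmod m + 1) * Cmod h))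
  by (apply Rmult_le_compat_l; lra).
nra.
Qed.

Lemma cderiv_comp f g z l m : cderiv f (g z) l -> cderiv g z m ->
  cderiv (fun w => f (g w)) z (l * m)%C.
Proof.
intros Hf Hg eps He.
destruct (comp_estimate f (g z) l m eps Hf He) as [e [d1 [He' [D1 H]]]].
destruct (Hg e He') as [d2 [D2 H2]].
exists (Rmin d1 d2); split; [apply Rmin_pos; assumption|]; intros h Hh.
specialize (H2 h (Rlt_le_trans _ _ _ Hh (Rmin_r _ _))).
specialize (H h (g (z + h)%C - g z)%C (Rlt_le_trans _ _ _ Hh (Rmin_l _ _)) H2).
replace (g z + (g (z + h)%C - g z))%C with (g (z + h)%C) in H by ring; exact H.
Qed.

Lemma rderiv_comp f g t l m : cderiv f (g t) l -> rderiv g t m ->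
  rderiv (fun s => f (g s)) t (l * m)%C.
Proof.
intros Hf Hg eps He.
destruct (comp_estimate f (g t) l m eps Hf He) as [e [d1 [He' [D1 H]]]].
destruct (Hg e He') as [d2 [D2 H2]].
exists (Rmin d1 d2); split; [apply Rmin_pos; assumption|]; intros h Hh.
specialize (H2 h (Rlt_le_trans _ _ _ Hh (Rmin_r _ _))).
rewrite <- Cmod_R in Hh, H2 |- *.
specialize (H (RtoC h) (g (t + h)%R - g t)%C (Rlt_le_trans _ _ _ Hh (Rmin_l _ _)) H2).
replace (g t + (g (t + h)%R - g t))%C with (g (t + h)%R) in H by ring; exact H.
Qed.

(** * Mean value inequality and Taylor estimate *)

Lemma nonneg_deriv_le (f f' : R -> R) a b : a <= b ->
  (forall t, a <= t <= b -> is_derive f t (f' t)) ->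
  (forall t, a <= t <= b -> 0 <= f' t) -> f a <= f b.
Proof.
intros Hab Hd Hp.
destruct (MVT_gen f a b f') as [c [Hc E]].
- intros t Ht; rewrite Rmin_left, Rmax_right in Ht by lra; apply Hd; lra.
- intros t Ht; rewrite Rmin_left, Rmax_right in Ht by lra.
  apply continuity_pt_filterlim, (ex_derive_continuous (V := R_NormedModule)).
  exists (f' t); apply Hd; exact Ht.
- rewrite Rmin_left, Rmax_right in Hc by lra; specialize (Hp c Hc); nra.
Qed.

(** With the constant u = f b - f a, the real function |u| g - Re (conj u f) is nondecreasing; this
    avoids differentiating a modulus, which fails at zeros. *)
Lemma Cmod_increment_le (f f' : R -> C) (g g' : R -> R) a b : a <= b ->
  (forall t, a <= t <= b -> rderiv f t (f' t)) ->
  (forall t, a <= t <= b -> is_derive g t (g' t)) ->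
  (forall t, a <= t <= b -> Cmod (f' t) <= g' t) ->
  Cmod (f b - f a) <= g b - g a.
Proof.
intros Hab Hf Hg Hle; set (u := (f b - f a)%C).
assert (Eu1 : Re u = Re (f b) - Re (f a)) by reflexivity.
assert (Eu2 : Im u = Im (f b) - Im (f a)) by reflexivity.
clearbody u.
assert (H : Cmod u * Cmod u <= Cmod u * (g b - g a)).
{ assert (H := nonneg_deriv_le
    (fun t => Cmod u * g t - (Re u * Re (f t) + Im u * Im (f t)))
    (fun t => Cmod u * g' t - (Re u * Re (f' t) + Im u * Im (f' t))) a b Hab).
  rewrite Cmod_sqr.
  cut (Cmod u * g a - (Re u * Re (f a) + Im u * Im (f a)) <=
       Cmod u * g b - (Re u * Re (f b) + Im u * Im (f b))).
  { replace (Re u * Re u + Im u * Im u) with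
      (Re u * Re (f b) + Im u * Im (f b) - (Re u * Re (f a) + Im u * Im (f a)))
      by (rewrite Eu1, Eu2; ring).
    lra. }
  apply H; clear H.
  - intros t Ht; destruct (rderiv_Re_Im _ _ _ (Hf t Ht)) as [H1 H2].
    apply (is_derive_minus (V := R_NormedModule)).
    + apply (is_derive_scal g t (Cmod u)), Hg, Ht.
    + apply (is_derive_plus (V := R_NormedModule));
        apply (is_derive_scal (fun s => _ (f s))); assumption.
  - intros t Ht; specialize (Hle t Ht).
    assert (Hc := Re_le_Cmod (Cconj u * f' t)%C).
    rewrite Cmod_mult, Cmod_conj in Hc; simpl in Hc.
    assert (P := Cmod_ge_0 u); apply Rabs_le_between in Hc.
    unfold Re, Im in *; nra. }
assert (H0 : g a <= g b).
{ apply (nonneg_deriv_le g g' a b Hab Hg).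
  intros t Ht; eapply Rle_trans; [apply Cmod_ge_0|apply Hle, Ht]. }
destruct (Cmod_ge_0 u) as [Hu|<-]; [|lra].
apply Rmult_le_reg_l with (Cmod u); assumption.
Qed.

Lemma rderiv_const c t : rderiv (fun _ => c) t (RtoC 0).
Proof.
intros eps He; exists 1; split; [lra|]; intros h _.
replace (c - c - RtoC 0 * RtoC h)%C with (RtoC 0) by ring.
rewrite Cmod_0; generalize (Rabs_pos h); nra.
Qed.

Lemma rderiv_affine (c d : C) t : rderiv (fun s => c + RtoC s * d)%C t d.
Proof.
intros eps He; exists 1; split; [lra|]; intros h _.
replace (c + RtoC (t + h)%R * d - (c + RtoC t * d) - d * RtoC h)%C with (RtoC 0)
  by (rewrite RtoC_plus; ring).
rewrite Cmod_0; generalize (Rabs_pos h); nra.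
Qed.

Lemma rderiv_Cexp_line (c d : C) t :
  rderiv (fun s => Cexp (c + RtoC s * d)%C) t (d * Cexp (c + RtoC t * d))%C.
Proof.
destruct c, d; apply rderiv_of_Re_Im; unfold Cexp; simpl;
  auto_derive; trivial; unfold Rminus; ring.
Qed.

(** The mean value inequality along the segment from 0 to h, first for e^(sh) - 1 and then for
    e^(sh) - sh, each application giving one factor |h|. *)
Lemma Cexp_taylor (h : C) :
  Cmod (Cexp h - 1 - h) <= Cmod h * Cmod h * exp (Cmod h).
Proof.
assert (P := Cmod_ge_0 h).
assert (He : forall t, 0 <= t <= 1 -> Cmod (Cexp (RtoC t * h)) <= exp (Cmod h)).
{ intros t Ht; rewrite Cmod_Cexp; apply exp_le.
  rewrite re_scal_l.
  assert (H := Re_le_Cmod h); apply Rabs_le_between in H; nra. }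
assert (H1 : forall t, 0 <= t <= 1 ->
  Cmod (Cexp (RtoC t * h) - 1) <= Cmod h * exp (Cmod h)).
{ intros t Ht.
  assert (H := Cmod_increment_le (fun s : R => Cexp (0 + RtoC s * h)%C)
    (fun s : R => h * Cexp (0 + RtoC s * h))%C
    (fun s => s * (Cmod h * exp (Cmod h)))
    (fun s => Cmod h * exp (Cmod h)) 0 t ltac:(lra)).
  cbv beta in H; replace (Cexp (0 + RtoC 0 * h)) with (RtoC 1) in H
    by (rewrite <- Cexp_0; f_equal; ring).
  replace (0 + RtoC t * h)%C with (RtoC t * h)%C in H by ring.
  eapply Rle_trans; [apply H|].
  - intros s _; apply rderiv_Cexp_line.
  - intros s _; auto_derive; trivial; unfold Rminus; ring.
  - intros s Hs; rewrite Cmod_mult; apply Rmult_le_compat_l; [exact P|].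
    replace (0 + RtoC s * h)%C with (RtoC s * h)%C by ring.
    apply He; lra.
  - assert (0 < exp (Cmod h)) by apply exp_pos.
    assert (0 <= Cmod h * exp (Cmod h)) by nra; nra. }
assert (H := Cmod_increment_le
  (fun s : R => Cexp (0 + RtoC s * h) - RtoC s * h)%C
  (fun s : R => h * Cexp (0 + RtoC s * h) - h)%C
  (fun s => s * (Cmod h * Cmod h * exp (Cmod h)))
  (fun s => Cmod h * Cmod h * exp (Cmod h)) 0 1 ltac:(lra)).
cbv beta in H; replace (Cexp (0 + RtoC 0 * h)) with (RtoC 1) in H
    by (rewrite <- Cexp_0; f_equal; ring).
replace (0 + RtoC 1 * h)%C with h in H by ring.
replace (Cexp h - 1 - h)%C with
  (Cexp h - RtoC 1 * h - (RtoC 1 - RtoC 0 * h))%C by ring.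
eapply Rle_trans; [apply H|lra].
- intros s _; clear; destruct h; apply rderiv_of_Re_Im; unfold Cexp; simpl;
    auto_derive; trivial; unfold Rminus; ring.
- intros s _; auto_derive; trivial; unfold Rminus; ring.
- intros s Hs.
  replace (h * Cexp (0 + RtoC s * h) - h)%C with (h * (Cexp (RtoC s * h) - 1))%C.
  + rewrite Cmod_mult, Rmult_assoc; apply Rmult_le_compat_l; [exact P|].
    apply H1; lra.
  + replace (0 + RtoC s * h)%C with (RtoC s * h)%C by ring; ring.
Qed.

Lemma cderiv_of_quadratic f z l d M : 0 < d -> 0 <= M ->
  (forall h, Cmod h < d ->
     Cmod (f (z + h) - f z - l * h)%C <= M * (Cmod h * Cmod h)) ->
  cderiv f z l.
Proof.
intros Hd HM H eps He.
assert (Hq : 0 < eps / (M + 1)) by (apply Rdiv_lt_0_compat; lra).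
exists (Rmin d (eps / (M + 1))); split; [apply Rmin_pos; assumption|].
intros h Hh; specialize (H h (Rlt_le_trans _ _ _ Hh (Rmin_l _ _))).
assert (Hh2 := Rlt_le_trans _ _ _ Hh (Rmin_r _ _)).
assert (P := Cmod_ge_0 h).
eapply Rle_trans; [exact H|].
rewrite <- Rmult_assoc; apply Rmult_le_compat_r; [exact P|].
apply Rle_trans with ((M + 1) * (eps / (M + 1))); [nra|right; field; lra].
Qed.

Lemma cderiv_Cexp z : cderiv Cexp z (Cexp z).
Proof.
apply (cderiv_of_quadratic _ _ _ 1 (exp (Re z) * exp 1)); [lra| |].
{ generalize (exp_pos (Re z)) (exp_pos 1); nra. }
intros h Hh.
replace (Cexp (z + h) - Cexp z - Cexp z * h)%C with (Cexp z * (Cexp h - 1 - h))%C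
  by (rewrite Cexp_add; ring).
rewrite Cmod_mult, Cmod_Cexp, Rmult_assoc.
apply Rmult_le_compat_l; [apply Rlt_le, exp_pos|].
eapply Rle_trans; [apply Cexp_taylor|].
rewrite (Rmult_comm (exp 1)); apply Rmult_le_compat_l.
- generalize (Cmod_ge_0 h); nra.
- apply exp_le; lra.
Qed.

(** * Complex series *)

Lemma ex_series_bound (f g : nat -> R) :
  (forall m, Rabs (f m) <= g m) -> ex_series g -> ex_series f.
Proof. exact (ex_series_le (V := R_CompleteNormedModule) f g). Qed.

Lemma ex_series_Rscal x (f : nat -> R) :
  ex_series f -> ex_series (fun m => x * f m).
Proof. exact (ex_series_scal_l (K := R_AbsRing) x f). Qed.

Definition summable (t : nat -> C) : Prop := ex_series (fun m => Cmod (t m)).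

(** Coordinatewise, so that [besselJ] is of this form by conversion. *)
Definition CSeries (t : nat -> C) : C :=
  (Series (fun m => Re (t m)), Series (fun m => Im (t m))).

Lemma summable_le t (g : nat -> R) :
  (forall m, Cmod (t m) <= g m) -> ex_series g -> summable t.
Proof.
intros H; apply ex_series_bound; intros m.
rewrite Rabs_pos_eq; [apply H|apply Cmod_ge_0].
Qed.

Lemma summable_Re t : summable t -> ex_series (fun m => Re (t m)).
Proof. apply ex_series_bound; intros m; apply Re_le_Cmod. Qed.

Lemma summable_Im t : summable t -> ex_series (fun m => Im (t m)).
Proof. apply ex_series_bound; intros m; apply Im_le_Cmod. Qed.

Lemma summable_scal c t : summable t -> summable (fun m => c * t m)%C.
Proof.
intros H; apply summable_le with (fun m => Cmod c * Cmod (t m)).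
- intros m; rewrite Cmod_mult; apply Rle_refl.
- apply ex_series_Rscal; exact H.
Qed.

Lemma summable_plus t u : summable t -> summable u ->
  summable (fun m => t m + u m)%C.
Proof.
intros Ht Hu; apply summable_le with (fun m => Cmod (t m) + Cmod (u m)).
- intros m; apply Cmod_triangle.
- apply (ex_series_plus (V := R_NormedModule)); assumption.
Qed.

Lemma CSeries_ext t u : (forall m, t m = u m) -> CSeries t = CSeries u.
Proof.
intros H; unfold CSeries; f_equal; apply Series_ext; intros m; rewrite H;
  reflexivity.
Qed.

Lemma CSeries_plus t u : summable t -> summable u ->
  CSeries (fun m => t m + u m)%C = (CSeries t + CSeries u)%C.
Proof.
intros Ht Hu; apply C_ext; simpl.
- rewrite <- Series_plus by (apply summable_Re; assumption); reflexivity.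
- rewrite <- Series_plus by (apply summable_Im; assumption); reflexivity.
Qed.

Lemma CSeries_scal c t : summable t ->
  CSeries (fun m => c * t m)%C = (c * CSeries t)%C.
Proof.
intros Ht; assert (H1 := summable_Re t Ht); assert (H2 := summable_Im t Ht).
apply C_ext; simpl; rewrite <- !Series_scal_l.
- rewrite <- Series_minus by (apply ex_series_Rscal; assumption); reflexivity.
- rewrite <- Series_plus by (apply ex_series_Rscal; assumption); reflexivity.
Qed.

Lemma CSeries_minus t u : summable t -> summable u ->
  CSeries (fun m => t m - u m)%C = (CSeries t - CSeries u)%C.
Proof.
intros Ht Hu.
rewrite (CSeries_ext _ (fun m => t m + (- (1)) * u m)%C) by (intros m; ring).
rewrite CSeries_plus, CSeries_scal by (try apply summable_scal; assumption).
ring.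
Qed.

Lemma CSeries_shift t : summable t ->
  CSeries t = (t O + CSeries (fun m => t (S m)))%C.
Proof.
intros Ht; apply C_ext; simpl.
- apply Series_incr_1, summable_Re, Ht.
- apply Series_incr_1, summable_Im, Ht.
Qed.

(** The factor 2 comes from bounding the real and imaginary parts separately. *)
Lemma Cmod_CSeries_le t (g : nat -> R) :
  (forall m, Cmod (t m) <= g m) -> ex_series g ->
  Cmod (CSeries t) <= 2 * Series g.
Proof.
intros H Hg; eapply Rle_trans; [apply Cmod_le_Re_Im|].
assert (B : forall f : nat -> R, (forall m, Rabs (f m) <= g m) ->
  Rabs (Series f) <= Series g).
{ intros f Hf; eapply Rle_trans; [apply Series_Rabs|apply Series_le].
  - apply (ex_series_bound _ g); [|exact Hg].
    intros m; rewrite Rabs_Rabsolu; apply Hf.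
  - intros m; split; [apply Rabs_pos|apply Hf].
  - exact Hg. }
unfold CSeries; simpl.
assert (B1 := B (fun m => Re (t m)) (fun m => Rle_trans _ _ _ (Re_le_Cmod _) (H m))).
assert (B2 := B (fun m => Im (t m)) (fun m => Rle_trans _ _ _ (Im_le_Cmod _) (H m))).
lra.
Qed.

(** * Exponential series and Bessel's equation *)

Definition entire (b : nat -> R) : Prop :=
  forall r, 0 <= r -> ex_series (fun m => Rabs (b m) * r ^ m).

(** Frobenius series in the logarithmic variable: the many-valued power of order nu becomes entire,
    and d/dv acts on the coefficients diagonally, by [dcoef]. *)
Definition exps_term (b : nat -> R) (nu : R) (v : C) (m : nat) : C :=
  (RtoC (b m) * Cexp (RtoC (2 * INR m + nu) * v))%C.

Definition exps (b : nat -> R) (nu : R) (v : C) : C := CSeries (exps_term b nu v).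

Definition dcoef (nu : R) (b : nat -> R) (m : nat) : R := (2 * INR m + nu) * b m.

Lemma INR_le_pow2 m : INR m <= 2 ^ m.
Proof.
induction m as [|m IH]; [simpl; lra|].
rewrite S_INR; simpl; assert (1 <= 2 ^ m) by (apply pow_R1_Rle; lra); lra.
Qed.

Lemma entire_dcoef nu b : entire b -> entire (dcoef nu b).
Proof.
intros Hb r Hr.
apply (ex_series_bound _ (fun m => (2 + Rabs nu) * (Rabs (b m) * (2 * r) ^ m))).
- intros m; assert (Hrm := pow_le r m Hr); assert (Hbm := Rabs_pos (b m)).
  rewrite Rabs_pos_eq by (apply Rmult_le_pos; [apply Rabs_pos|exact Hrm]).
  unfold dcoef; rewrite Rabs_mult, Rpow_mult_distr.
  assert (H2 : Rabs (2 * INR m + nu) <= (2 + Rabs nu) * 2 ^ m).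
  { eapply Rle_trans; [apply Rabs_triang|].
    assert (Hm := pos_INR m); rewrite (Rabs_pos_eq (2 * INR m)) by lra.
    assert (H := INR_le_pow2 m); assert (1 <= 2 ^ m) by (apply pow_R1_Rle; lra).
    assert (Hn := Rabs_pos nu); nra. }
  replace ((2 + Rabs nu) * (Rabs (b m) * (2 ^ m * r ^ m))) with
    ((2 + Rabs nu) * 2 ^ m * (Rabs (b m) * r ^ m)) by ring.
  rewrite Rmult_assoc; apply Rmult_le_compat_r; [nra|exact H2].
- apply ex_series_Rscal; apply Hb; lra.
Qed.

Lemma exp_INR_mult m x : exp (INR m * x) = exp x ^ m.
Proof.
induction m as [|m IH]; [simpl; rewrite Rmult_0_l; apply exp_0|].
rewrite S_INR, Rmult_plus_distr_r, exp_plus, IH, Rmult_1_l; simpl; ring.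
Qed.

Lemma Cmod_exps_term b nu v m :
  Cmod (exps_term b nu v m) =
  exp (nu * Re v) * (Rabs (b m) * exp (2 * Re v) ^ m).
Proof.
unfold exps_term; rewrite Cmod_mult, Cmod_R, Cmod_Cexp, re_scal_l.
replace ((2 * INR m + nu) * Re v) with (nu * Re v + INR m * (2 * Re v)) by ring.
rewrite exp_plus, exp_INR_mult; ring.
Qed.

Lemma summable_exps b nu v : entire b -> summable (exps_term b nu v).
Proof.
intros Hb; apply summable_le with
  (fun m => exp (nu * Re v) * (Rabs (b m) * exp (2 * Re v) ^ m)).
- intros m; rewrite Cmod_exps_term; apply Rle_refl.
- apply ex_series_Rscal, Hb, Rlt_le, exp_pos.
Qed.

(** The remainders of the terms are quadratic in h by [Cexp_taylor]; they are summed against a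
    majorant built from the coefficients of the second derivative. *)
Lemma exps_deriv b nu v : entire b ->
  cderiv (exps b nu) v (exps (dcoef nu b) nu v).
Proof.
intros Hb; assert (Hb1 := entire_dcoef nu b Hb).
assert (Hb2 := entire_dcoef nu _ Hb1).
(* With L = 2m + nu and |h| < 1, the exponent L Re v + |L| |h| is at most (2m + |nu|) (|Re v| + 1);
   [r] and the prefactor of [g] are its exponential, split according to m. *)
set (r := exp (2 * (Rabs (Re v) + 1))).
set (g := fun m => exp (Rabs nu * (Rabs (Re v) + 1)) *
                   (Rabs (dcoef nu (dcoef nu b) m) * r ^ m)).
assert (Hr : 0 < r) by apply exp_pos.
assert (Hg : ex_series g).
{ apply ex_series_Rscal, Hb2; lra. }
assert (Hg0 : forall m, 0 <= g m).
{ intros m; apply Rmult_le_pos; [apply Rlt_le, exp_pos|].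
  apply Rmult_le_pos; [apply Rabs_pos|apply pow_le; lra]. }
apply (cderiv_of_quadratic _ _ _ 1 (2 * Series g)); [lra| |].
{ rewrite <- (Rmult_0_l 0) at 1; apply Rmult_le_compat; try lra.
  rewrite <- (Rmult_0_l (Series g)), <- Series_scal_l.
  apply Series_le; [|exact Hg]; intros m; specialize (Hg0 m); lra. }
intros h Hh; assert (P := Cmod_ge_0 h).
replace (exps b nu (v + h) - exps b nu v - exps (dcoef nu b) nu v * h)%C with
  (CSeries (fun m => exps_term b nu (v + h) m - exps_term b nu v m -
                     h * exps_term (dcoef nu b) nu v m)%C).
- replace (2 * Series g * (Cmod h * Cmod h)) with
    (2 * Series (fun m => (Cmod h * Cmod h) * g m))
    by (rewrite Series_scal_l; ring).
  apply Cmod_CSeries_le;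
    [|apply ex_series_Rscal; exact Hg].
  intros m; unfold exps_term, dcoef.
  set (L := 2 * INR m + nu).
  replace (RtoC (b m) * Cexp (RtoC L * (v + h)) - RtoC (b m) * Cexp (RtoC L * v) -
    h * (RtoC (L * b m) * Cexp (RtoC L * v)))%C with
    (RtoC (b m) * Cexp (RtoC L * v) * (Cexp (RtoC L * h) - 1 - RtoC L * h))%C
    by (rewrite Cmult_plus_distr_l, Cexp_add, RtoC_mult; ring).
  rewrite !Cmod_mult, Cmod_R, Cmod_Cexp, re_scal_l.
  assert (HT := Cexp_taylor (RtoC L * h)); rewrite Cmod_mult, Cmod_R in HT.
  unfold g, dcoef; fold L; rewrite !Rabs_mult.
  assert (HL := Rabs_pos L); assert (Hbm := Rabs_pos (b m)).
  assert (HE : exp (L * Re v) * exp (Rabs L * Cmod h) <=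
    exp (Rabs nu * (Rabs (Re v) + 1)) * r ^ m).
  { unfold r; rewrite <- exp_INR_mult, <- !exp_plus; apply exp_le.
    assert (HLa : Rabs L <= 2 * INR m + Rabs nu).
    { unfold L; eapply Rle_trans; [apply Rabs_triang|].
      assert (Hm := pos_INR m); rewrite (Rabs_pos_eq (2 * INR m)); lra. }
    assert (H1 : L * Re v <= Rabs L * Rabs (Re v)).
    { rewrite <- Rabs_mult; apply Rle_abs. }
    assert (Hv := Rabs_pos (Re v)); nra. }
  assert (Hx := exp_pos (L * Re v)).
  apply Rle_trans with (Rabs (b m) * exp (L * Re v) *
    (Rabs L * Cmod h * (Rabs L * Cmod h) * exp (Rabs L * Cmod h))).
  + apply Rmult_le_compat_l; [nra|exact HT].
  + apply Rle_trans with (Rabs (b m) * (Rabs L * Cmod h * (Rabs L * Cmod h)) *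
      (exp (Rabs nu * (Rabs (Re v) + 1)) * r ^ m)); [|right; ring].
    replace (Rabs (b m) * exp (L * Re v) *
      (Rabs L * Cmod h * (Rabs L * Cmod h) * exp (Rabs L * Cmod h))) with
      (Rabs (b m) * (Rabs L * Cmod h * (Rabs L * Cmod h)) *
       (exp (L * Re v) * exp (Rabs L * Cmod h))) by ring.
    apply Rmult_le_compat_l; [|exact HE].
    apply Rmult_le_pos; [exact Hbm|apply Rmult_le_pos; nra].
- rewrite CSeries_minus.
  + rewrite CSeries_minus, CSeries_scal by (apply summable_exps; assumption).
    unfold exps; ring.
  + apply (summable_plus _ (fun m => - exps_term b nu v m)%C).
    * apply summable_exps; exact Hb.
    * apply (summable_le _ (fun m => Cmod (exps_term b nu v m))).
      -- intros m; rewrite Cmod_opp; apply Rle_refl.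
      -- apply summable_exps; exact Hb.
  + apply summable_scal, summable_exps; exact Hb1.
Qed.

Lemma CSeries_conj t : CSeries (fun m => Cconj (t m)) = Cconj (CSeries t).
Proof.
apply C_ext; simpl; [reflexivity|].
rewrite <- Series_opp; reflexivity.
Qed.

Lemma exps_conj b nu v : exps b nu (Cconj v) = Cconj (exps b nu v).
Proof.
unfold exps; rewrite <- CSeries_conj; apply CSeries_ext; intros m.
unfold exps_term; rewrite Cmult_conj, <- Cexp_conj, Cmult_conj.
f_equal; [|f_equal; f_equal]; apply C_ext; simpl; ring.
Qed.

(** * Bessel's equation for the series of J *)

Definition bessel_coef (nu : R) (m : nat) : R :=
  (-1) ^ m / (INR (fact m) * Gamma (INR m + nu + 1)).

Definition half_shift (w : C) : C := (w - RtoC (ln 2))%C.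

Lemma besselJ_exps nu w : besselJ nu w = exps (bessel_coef nu) nu (half_shift w).
Proof. reflexivity. Qed.

Definition order_ok (nu : R) : Prop := nonpole (nu + 1).

Lemma order_ok_gamma nu m : order_ok nu -> nonpole (INR m + nu + 1).
Proof.
intros H; replace (INR m + nu + 1) with (nu + 1 + INR m) by ring.
apply nonpole_add, H.
Qed.

Lemma bessel_coef_ne0 nu m : order_ok nu -> bessel_coef nu m <> 0.
Proof.
intros H; assert (Hf := fact_pos m).
assert (HG := Gamma_ne0 _ (order_ok_gamma nu m H)).
apply Rmult_integral_contrapositive_currified.
- apply pow_nonzero; lra.
- apply Rinv_neq_0_compat, Rmult_integral_contrapositive_currified; lra.
Qed.

Lemma bessel_coef_S nu m : order_ok nu ->
  bessel_coef nu (S m) = - bessel_coef nu m / (INR (S m) * (INR (S m) + nu)).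
Proof.
intros H; unfold bessel_coef.
assert (Hn := order_ok_gamma nu m H).
assert (HG := Gamma_ne0 _ Hn).
assert (HG' := Gamma_S _ Hn).
replace (INR (S m) + nu + 1) with (INR m + nu + 1 + 1) by (rewrite S_INR; ring).
rewrite HG', fact_simpl, mult_INR; simpl pow.
assert (Hf := fact_pos m); assert (Hm := INR_S_pos m).
assert (Hn0 : INR (S m) + nu <> 0).
{ specialize (Hn O); simpl INR in Hn at 2; rewrite S_INR; lra. }
replace (INR m + nu + 1) with (INR (S m) + nu) in * by (rewrite S_INR; ring).
field; repeat split; try assumption; lra.
Qed.

Lemma bessel_coef_shift nu m : order_ok nu ->
  bessel_coef (nu + 1) m = - INR (S m) * bessel_coef nu (S m).
Proof.
intros H; unfold bessel_coef.
replace (INR m + (nu + 1) + 1) with (INR (S m) + nu + 1) by (rewrite S_INR; ring).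
rewrite fact_simpl, mult_INR; simpl pow.
assert (Hf := fact_pos m); assert (Hm := INR_S_pos m).
assert (HG := Gamma_ne0 _ (order_ok_gamma nu (S m) H)).
field; repeat split; try assumption; lra.
Qed.

Lemma entire_bessel_coef nu : order_ok nu -> entire (bessel_coef nu).
Proof.
intros H r Hr.
assert (Hd : CV_disk (bessel_coef nu) r).
{ apply (CV_disk_DAlembert _ _ 0); [intros m; apply bessel_coef_ne0, H| |left; reflexivity].
  assert (Hinf : is_lim_seq (fun m => INR (S m)) p_infty)
    by (apply -> is_lim_seq_incr_1; apply is_lim_seq_INR).
  assert (Hinf2 : is_lim_seq (fun m => INR (S m) + nu) p_infty).
  { eapply is_lim_seq_plus; [exact Hinf|apply is_lim_seq_const|reflexivity]. }
  assert (Hz : is_lim_seq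
    (fun m => Rabs (/ INR (S m) * / (INR (S m) + nu))) 0).
  { replace (Finite 0) with (Rbar_abs (Finite (0 * 0)))
      by (simpl; rewrite Rmult_0_l, Rabs_R0; reflexivity).
    apply is_lim_seq_abs, is_lim_seq_mult'.
    - exact (is_lim_seq_inv _ _ Hinf ltac:(discriminate)).
    - exact (is_lim_seq_inv _ _ Hinf2 ltac:(discriminate)). }
  eapply is_lim_seq_ext; [|exact Hz].
  intros m; cbv beta; rewrite (bessel_coef_S nu m H).
  assert (Hm := INR_S_pos m).
  assert (Hn0 : INR (S m) + nu <> 0).
  { assert (Hn := order_ok_gamma nu m H O); simpl INR in Hn at 2; rewrite S_INR; lra. }
  assert (Hc := bessel_coef_ne0 nu m H).
  rewrite <- Rabs_Ropp; f_equal; field; repeat split; try assumption; lra. }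
unfold CV_disk in Hd; eapply ex_series_ext; [|exact Hd].
intros m; cbv beta; rewrite Rabs_mult; f_equal.
apply Rabs_pos_eq, pow_le, Hr.
Qed.

Definition besselJ' (nu : R) (w : C) : C :=
  exps (dcoef nu (bessel_coef nu)) nu (half_shift w).

Lemma cderiv_half_shift w : cderiv half_shift w (RtoC 1).
Proof.
eapply cderiv_eq.
- apply (cderiv_plus (fun w => w) (fun _ => - RtoC (ln 2))%C);
    [apply cderiv_id|apply cderiv_const].
- ring.
Qed.

Lemma exps_half_shift_deriv b nu w : entire b ->
  cderiv (fun w => exps b nu (half_shift w)) w (exps (dcoef nu b) nu (half_shift w)).
Proof.
intros Hb; eapply cderiv_eq.
- apply cderiv_comp; [apply exps_deriv, Hb|apply cderiv_half_shift].
- ring.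
Qed.

Lemma besselJ_deriv nu w : order_ok nu -> cderiv (besselJ nu) w (besselJ' nu w).
Proof. intros H; apply exps_half_shift_deriv, entire_bessel_coef, H. Qed.

Lemma exps_term_shift b nu v m :
  exps_term b nu v (S m) =
  (Cexp (RtoC 2 * v) * exps_term (fun k => b (S k)) nu v m)%C.
Proof.
unfold exps_term; rewrite S_INR.
replace (RtoC (2 * (INR m + 1) + nu) * v)%C with
  (RtoC 2 * v + RtoC (2 * INR m + nu) * v)%C.
- rewrite Cexp_add; ring.
- replace (2 * (INR m + 1) + nu) with (2 + (2 * INR m + nu)) by ring.
  rewrite (RtoC_plus 2); ring.
Qed.

Lemma half_shift_exp w : Cexp w = (RtoC 2 * Cexp (half_shift w))%C.
Proof.
unfold half_shift; rewrite Cexp_sub, Cexp_R, exp_ln by lra.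
field; intros H; apply RtoC_inj in H; lra.
Qed.

(** Since (2m + nu)^2 - nu^2 = 4 m (m + nu), the term m = 0 drops out, and the coefficient
    recurrence turns term m + 1 into -4 e^(2v) times term m, where e^w = 2 e^v. *)
Lemma besselJ'_deriv nu w : order_ok nu ->
  cderiv (besselJ' nu) w
    ((RtoC (nu * nu) - Cexp w * Cexp w) * besselJ nu w)%C.
Proof.
intros H; assert (Hb := entire_bessel_coef nu H).
assert (Hb1 := entire_dcoef nu _ Hb); assert (Hb2 := entire_dcoef nu _ Hb1).
eapply cderiv_eq; [apply exps_half_shift_deriv, Hb1|].
rewrite besselJ_exps, half_shift_exp; set (v := half_shift w).
assert (E : (exps (dcoef nu (dcoef nu (bessel_coef nu))) nu v -
  RtoC (nu * nu) * exps (bessel_coef nu) nu v)%C =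
  (- (RtoC 4 * Cexp (RtoC 2 * v)) * exps (bessel_coef nu) nu v)%C).
{ unfold exps; rewrite <- !CSeries_scal, <- CSeries_minus by
    (try apply summable_scal; apply summable_exps; assumption).
  rewrite CSeries_shift.
  - replace (exps_term (dcoef nu (dcoef nu (bessel_coef nu))) nu v 0 -
      RtoC (nu * nu) * exps_term (bessel_coef nu) nu v 0)%C with (RtoC 0).
    + rewrite Cplus_0_l; apply CSeries_ext; intros m; rewrite !exps_term_shift.
      unfold exps_term, dcoef; rewrite (bessel_coef_S nu m H).
      assert (Hm := INR_S_pos m).
      assert (Hn0 : INR (S m) + nu <> 0).
      { assert (Hn := order_ok_gamma nu m H O); simpl INR in Hn at 2; rewrite S_INR; lra. }
      set (e := Cexp (RtoC (2 * INR m + nu) * v)).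
      set (c := bessel_coef nu m).
      replace (- c / (INR (S m) * (INR (S m) + nu))) with
        (- c * / (INR (S m) * (INR (S m) + nu))) by reflexivity.
      transitivity (Cexp (RtoC 2 * v) * e * RtoC (
        ((2 * INR (S m) + nu) * ((2 * INR (S m) + nu) *
         (- c * / (INR (S m) * (INR (S m) + nu)))) -
        nu * nu * (- c * / (INR (S m) * (INR (S m) + nu))))))%C.
      { rewrite RtoC_minus, (RtoC_mult (nu * nu)); ring. }
      replace ((2 * INR (S m) + nu) * ((2 * INR (S m) + nu) *
         (- c * / (INR (S m) * (INR (S m) + nu)))) -
        nu * nu * (- c * / (INR (S m) * (INR (S m) + nu)))) with (- 4 * c)
        by (field; split; [assumption|lra]).
      rewrite RtoC_mult; ring.
    + unfold exps_term, dcoef; simpl INR.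
      replace (2 * 0 + nu) with nu by ring.
      rewrite !RtoC_mult; ring.
  - apply (summable_plus _ (fun m =>
      - (RtoC (nu * nu) * exps_term (bessel_coef nu) nu v m))%C).
    + apply summable_exps; exact Hb2.
    + eapply summable_le; [|exact (summable_scal (RtoC (nu * nu)) _
        (summable_exps _ nu v Hb))].
      intros m; rewrite Cmod_opp; apply Rle_refl. }
replace (RtoC 2 * v)%C with (v + v)%C in E by ring.
rewrite Cexp_add in E.
transitivity ((exps (dcoef nu (dcoef nu (bessel_coef nu))) nu v -
  RtoC (nu * nu) * exps (bessel_coef nu) nu v) +
  RtoC (nu * nu) * exps (bessel_coef nu) nu v)%C; [ring|].
rewrite E; replace (RtoC 4) with (RtoC 2 * RtoC 2)%C
  by (rewrite <- RtoC_mult; f_equal; ring).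
ring.
Qed.

(** Expresses the derivative by Bessel functions again, so that the amplitudes on the imaginary axis
    reduce to the growth of two functions I of neighbouring orders. *)
Lemma besselJ'_eq nu w : order_ok nu ->
  besselJ' nu w = (RtoC nu * besselJ nu w - Cexp w * besselJ (nu + 1) w)%C.
Proof.
intros H; assert (Hb := entire_bessel_coef nu H).
assert (Hb1 := entire_dcoef nu _ Hb).
assert (Hb' := entire_bessel_coef (nu + 1) (nonpole_S _ H)).
rewrite !besselJ_exps, half_shift_exp; unfold besselJ'; set (v := half_shift w).
assert (E : (exps (dcoef nu (bessel_coef nu)) nu v -
  RtoC nu * exps (bessel_coef nu) nu v)%C =
  (- (RtoC 2 * Cexp v) * exps (bessel_coef (nu + 1)) (nu + 1) v)%C).
{ unfold exps; rewrite <- !CSeries_scal, <- CSeries_minus by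
    (try apply summable_scal; apply summable_exps; assumption).
  rewrite CSeries_shift.
  - replace (exps_term (dcoef nu (bessel_coef nu)) nu v 0 -
      RtoC nu * exps_term (bessel_coef nu) nu v 0)%C with (RtoC 0).
    + rewrite Cplus_0_l; apply CSeries_ext; intros m; rewrite !exps_term_shift.
      unfold exps_term, dcoef; rewrite (bessel_coef_shift nu m H).
      replace (RtoC (2 * INR m + (nu + 1)) * v)%C with
        (v + RtoC (2 * INR m + nu) * v)%C
        by (replace (2 * INR m + (nu + 1)) with (1 + (2 * INR m + nu)) by ring;
            rewrite (RtoC_plus 1); ring).
      replace (RtoC 2 * v)%C with (v + v)%C by ring.
      rewrite !Cexp_add.
      rewrite !RtoC_mult, !RtoC_plus, !RtoC_mult, RtoC_opp; ring.
    + unfold exps_term, dcoef; simpl INR.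
      replace (2 * 0 + nu) with nu by ring.
      rewrite !RtoC_mult; ring.
  - apply (summable_plus _ (fun m =>
      - (RtoC nu * exps_term (bessel_coef nu) nu v m))%C).
    + apply summable_exps; exact Hb1.
    + eapply summable_le; [|exact (summable_scal (RtoC nu) _
        (summable_exps _ nu v Hb))].
      intros m; rewrite Cmod_opp; apply Rle_refl. }
transitivity ((exps (dcoef nu (bessel_coef nu)) nu v -
  RtoC nu * exps (bessel_coef nu) nu v) +
  RtoC nu * exps (bessel_coef nu) nu v)%C; [ring|].
rewrite E; ring.
Qed.

Lemma besselJ_conj nu w : besselJ nu (Cconj w) = Cconj (besselJ nu w).
Proof.
rewrite !besselJ_exps, <- exps_conj; f_equal.
unfold half_shift; apply C_ext; simpl; ring.
Qed.

(** * Growth of the modified Bessel functions *)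

(* [besselI nu s] is [I_nu (2 e^s)]. *)
Definition besselI_term (nu s : R) (m : nat) : R :=
  exp ((2 * INR m + nu) * s) / (INR (fact m) * Gamma (INR m + nu + 1)).

Definition besselI (nu s : R) : R := Series (besselI_term nu s).

Lemma besselI_term_abs nu s m :
  Rabs (besselI_term nu s m) =
  exp (nu * s) * (Rabs (bessel_coef nu m) * exp (2 * s) ^ m).
Proof.
unfold besselI_term, bessel_coef, Rdiv; rewrite !Rabs_mult, pow_1_abs, Rmult_1_l.
rewrite (Rabs_pos_eq (exp _)) by apply Rlt_le, exp_pos.
replace ((2 * INR m + nu) * s) with (nu * s + INR m * (2 * s)) by ring.
rewrite exp_plus, exp_INR_mult; ring.
Qed.

Lemma ex_besselI nu s : order_ok nu -> ex_series (besselI_term nu s).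
Proof.
intros H; apply (ex_series_bound _
  (fun m => exp (nu * s) * (Rabs (bessel_coef nu m) * exp (2 * s) ^ m))).
- intros m; right; apply besselI_term_abs.
- apply ex_series_Rscal, entire_bessel_coef; [exact H|apply Rlt_le, exp_pos].
Qed.

Lemma besselI_term_lower nu s m : nonpole nu ->
  besselI_term (nu - 1) s m = exp (- s) * (INR m + nu) * besselI_term nu s m.
Proof.
intros H; unfold besselI_term.
assert (Hm : nonpole (INR m + nu))
  by (rewrite Rplus_comm; apply nonpole_add; exact H).
replace (INR m + (nu - 1) + 1) with (INR m + nu) by ring.
rewrite (Gamma_S _ Hm).
replace ((2 * INR m + (nu - 1)) * s) with ((2 * INR m + nu) * s + - s) by ring.
rewrite exp_plus.
assert (Hf := fact_pos m); assert (HG := Gamma_ne0 _ Hm).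
assert (H0 := Hm O); simpl INR in H0 at 2.
field; repeat split; try assumption; lra.
Qed.

Lemma besselI_term_upper nu s m :
  exp (- s) * INR (S m) * besselI_term nu s (S m) = besselI_term (nu + 1) s m.
Proof.
unfold besselI_term.
replace (INR m + (nu + 1) + 1) with (INR (S m) + nu + 1) by (rewrite S_INR; ring).
replace ((2 * INR m + (nu + 1)) * s) with (- s + (2 * INR (S m) + nu) * s)
  by (rewrite S_INR; ring).
rewrite exp_plus, fact_simpl, mult_INR.
assert (Hf := fact_pos m); assert (Hm := INR_S_pos m).
unfold Rdiv; rewrite !Rinv_mult; set (g := / Gamma _); field; lra.
Qed.

Lemma ex_besselI_weighted nu s : nonpole nu ->
  ex_series (fun m => exp (- s) * INR m * besselI_term nu s m).
Proof.
intros H; apply (ex_series_incr_1 (V := R_NormedModule)).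
eapply ex_series_ext; [|apply (ex_besselI (nu + 1) s)].
- intros m; symmetry; apply besselI_term_upper.
- apply nonpole_S, nonpole_S, H.
Qed.

Lemma besselI_weighted nu s : nonpole nu ->
  Series (fun m => exp (- s) * INR m * besselI_term nu s m) = besselI (nu + 1) s.
Proof.
intros H; rewrite Series_incr_1 by (apply ex_besselI_weighted; exact H).
simpl INR at 1; rewrite Rmult_0_r, Rmult_0_l, Rplus_0_l.
apply Series_ext; intros m; apply besselI_term_upper.
Qed.

(** The weights (m + nu) e^(-s) and m e^(-s) turn the terms of I_nu into those of I_(nu-1) and, one
    index lower, of I_(nu+1); the recurrence is the difference of the two. *)
Lemma besselI_rec nu s : nonpole nu ->
  besselI (nu - 1) s = besselI (nu + 1) s + nu * exp (- s) * besselI nu s.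
Proof.
intros H; rewrite <- (besselI_weighted nu s H); unfold besselI at 2.
assert (Hn : order_ok nu) by (apply nonpole_S, H).
rewrite <- Series_scal_l, <- Series_plus.
- apply Series_ext; intros m; rewrite (besselI_term_lower nu s m H); ring.
- apply ex_besselI_weighted, H.
- apply ex_series_Rscal, ex_besselI, Hn.
Qed.

(** The inverse of e^t / sqrt (2 pi t) at t = 2 e^s. *)
Definition growth_norm (s : R) : R := 2 * sqrt PI * exp (s / 2 - 2 * exp s).

Definition I_growth (nu : R) : Prop :=
  is_lim (fun s => besselI nu s * growth_norm s) p_infty 1.

Lemma growth_norm_pos s : 0 < growth_norm s.
Proof.
assert (H := sqrt_lt_R0 _ PI_RGT_0); assert (H' := exp_pos (s / 2 - 2 * exp s)).
unfold growth_norm; nra.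
Qed.

Lemma is_lim_exp_opp : is_lim (fun s => exp (- s)) p_infty 0.
Proof.
apply (is_lim_comp exp Ropp p_infty 0 m_infty).
- apply is_lim_exp_m.
- apply (is_lim_opp (fun x => x) p_infty p_infty), is_lim_id.
- exists 0; intros x _; discriminate.
Qed.

(** The exponential series at x and at -x, split into even and odd indices, gives two linear
    equations for the two power series. *)
Lemma PSeries_cosh x :
  PSeries (fun n => / INR (fact (2 * n))) (x ^ 2) = (exp x + exp (- x)) / 2 /\
  x * PSeries (fun n => / INR (fact (2 * n + 1))) (x ^ 2) =
    (exp x - exp (- x)) / 2.
Proof.
set (a := fun n => / INR (fact n)).
assert (Hcv : forall y, ex_series (fun n => Rabs (a n * y ^ n))).
{ intros y; apply (CV_disk_DAlembert a y 0); [| |left; reflexivity].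
  - intros n; apply Rinv_neq_0_compat; generalize (fact_pos n); lra.
  - eapply is_lim_seq_ext; [|apply (is_lim_seq_inv (fun n => INR (S n)) p_infty);
      [apply -> is_lim_seq_incr_1; apply is_lim_seq_INR|discriminate]].
    intros n; unfold a; rewrite fact_simpl, mult_INR.
    assert (Hf := fact_pos n); assert (Hn := INR_S_pos n).
    symmetry; replace (/ (INR (S n) * INR (fact n)) / / INR (fact n)) with
      (/ INR (S n)) by (field; lra).
    apply Rabs_pos_eq, Rlt_le, Rinv_0_lt_compat, Hn. }
assert (Hsub : forall (k : nat -> nat) y, (forall n, (n <= k n)%nat) ->
  ex_pseries (fun n => a (k n)) y).
{ intros k y Hk; apply CV_disk_correct; unfold CV_disk.
  apply (ex_series_bound _ (fun n => Rabs (a n * y ^ n))); [|apply Hcv].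
  intros n; rewrite Rabs_Rabsolu, !Rabs_mult; apply Rmult_le_compat_r; [apply Rabs_pos|].
  assert (Hf := fact_pos n); assert (Hf' := fact_pos (k n)).
  unfold a; rewrite !Rabs_pos_eq by (apply Rlt_le, Rinv_0_lt_compat; assumption).
  apply Rinv_le_contravar; [exact Hf|]; apply le_INR, fact_le, Hk. }
assert (Hy : forall y, (y ^ 2 = x ^ 2 -> exp y =
  PSeries (fun n => a (2 * n)%nat) (x ^ 2) +
  y * PSeries (fun n => a (2 * n + 1)%nat) (x ^ 2))).
{ intros y E; rewrite <- E.
  rewrite <- PSeries_odd_even.
  - symmetry; apply is_pseries_unique, is_exp_Reals.
  - apply (Hsub (fun n => (2 * n)%nat)); intros n; lia.
  - apply (Hsub (fun n => (2 * n + 1)%nat)); intros n; lia. }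
assert (H1 := Hy x eq_refl); assert (H2 := Hy (- x) ltac:(simpl; ring)).
unfold a in *; split; lra.
Qed.

(** The duplication formula at half-integers. The induction alternates: the even identity at m gives
    the odd one at m, and this gives the even one at m + 1. *)
Lemma fact_Gamma_half m :
  INR (fact m) * Gamma (INR m + 1 / 2) * 2 ^ (2 * m) =
    INR (fact (2 * m)) * sqrt PI /\
  INR (fact m) * Gamma (INR m + 3 / 2) * 2 ^ (2 * m + 1) =
    INR (fact (2 * m + 1)) * sqrt PI.
Proof.
assert (G : forall m, Gamma (INR m + 3 / 2) = (INR m + 1 / 2) * Gamma (INR m + 1 / 2)).
{ clear m; intros m; rewrite <- Gamma_S.
  - f_equal; field.
  - apply nonpole_pos; generalize (pos_INR m); lra. }
assert (O : forall m, INR (fact m) * Gamma (INR m + 1 / 2) * 2 ^ (2 * m) =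
    INR (fact (2 * m)) * sqrt PI ->
  INR (fact m) * Gamma (INR m + 3 / 2) * 2 ^ (2 * m + 1) =
    INR (fact (2 * m + 1)) * sqrt PI).
{ clear m; intros m H; rewrite G, pow_add.
  replace (2 * m + 1)%nat with (S (2 * m)) by lia.
  rewrite (fact_simpl (2 * m)), (mult_INR _ (fact (2 * m))),
    (Rmult_assoc _ (INR (fact (2 * m)))), <- H, S_INR, mult_INR.
  change (INR 2) with 2; simpl (2 ^ 1); field. }
assert (E : INR (fact m) * Gamma (INR m + 1 / 2) * 2 ^ (2 * m) =
    INR (fact (2 * m)) * sqrt PI).
{ induction m as [|m IH].
  - simpl; rewrite Rplus_0_l, Gamma_half; ring.
  - apply O in IH.
    replace (INR (S m) + 1 / 2) with (INR m + 3 / 2) by (rewrite S_INR; field).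
    replace (2 * S m)%nat with (S (2 * m + 1)) by lia.
    rewrite (fact_simpl (2 * m + 1)), (mult_INR _ (fact (2 * m + 1))),
      (Rmult_assoc _ (INR (fact (2 * m + 1)))), <- IH.
    rewrite fact_simpl, mult_INR, <- tech_pow_Rmult, !S_INR, plus_INR, mult_INR.
    change (INR 2) with 2; simpl (INR 1); ring. }
split; [exact E|exact (O m E)].
Qed.

(** For t = 2 e^s, the functions I_(-1/2)(t) and I_(1/2)(t) are sqrt (2 / (pi t)) times cosh t and
    sinh t. *)
Lemma besselI_half s :
  besselI (- (1 / 2)) s * growth_norm s = 1 + exp (- (4 * exp s)) /\
  besselI (1 / 2) s * growth_norm s = 1 - exp (- (4 * exp s)).
Proof.
destruct (PSeries_cosh (2 * exp s)) as [Hc Hs].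
assert (Hpi := sqrt_lt_R0 _ PI_RGT_0).
assert (Hpow : forall n, (2 * exp s) ^ n = 2 ^ n * exp (INR n * s))
  by (intros n; rewrite Rpow_mult_distr, exp_INR_mult; reflexivity).
assert (E1 : besselI (- (1 / 2)) s =
  exp (- (s / 2)) / sqrt PI * ((exp (2 * exp s) + exp (- (2 * exp s))) / 2)).
{ rewrite <- Hc; unfold PSeries; rewrite <- Series_scal_l; apply Series_ext.
  intros m; unfold besselI_term; rewrite <- pow_mult, Hpow.
  assert (Hf := proj1 (fact_Gamma_half m)).
  replace (INR m + - (1 / 2) + 1) with (INR m + 1 / 2) by field.
  assert (Hf1 := fact_pos m); assert (Hf2 := fact_pos (2 * m)).
  assert (HG : 0 < Gamma (INR m + 1 / 2))
    by (apply Gamma_pos; generalize (pos_INR m); lra).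
  assert (H2 : 0 < 2 ^ (2 * m)) by (apply pow_lt; lra).
  replace (INR (fact m) * Gamma (INR m + 1 / 2)) with
    (INR (fact (2 * m)) * sqrt PI / 2 ^ (2 * m)) by (rewrite <- Hf; field; lra).
  replace ((2 * INR m + - (1 / 2)) * s) with (- (s / 2) + INR (2 * m) * s)
    by (rewrite mult_INR; change (INR 2) with 2; field).
  rewrite exp_plus; field; lra. }
assert (E2 : besselI (1 / 2) s =
  exp (- (s / 2)) / sqrt PI * ((exp (2 * exp s) - exp (- (2 * exp s))) / 2)).
{ rewrite <- Hs; unfold PSeries; rewrite <- !Series_scal_l; apply Series_ext.
  intros m; unfold besselI_term; rewrite <- pow_mult.
  replace (2 * exp s * (/ INR (fact (2 * m + 1)) * (2 * exp s) ^ (2 * m))) with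
    ((2 * exp s) ^ (2 * m + 1) / INR (fact (2 * m + 1)))
    by (rewrite pow_add; simpl (_ ^ 1); unfold Rdiv; ring).
  rewrite Hpow; assert (Hf := proj2 (fact_Gamma_half m)).
  replace (INR m + 1 / 2 + 1) with (INR m + 3 / 2) by field.
  assert (Hf1 := fact_pos m); assert (Hf2 := fact_pos (2 * m + 1)).
  assert (HG : 0 < Gamma (INR m + 3 / 2))
    by (apply Gamma_pos; generalize (pos_INR m); lra).
  assert (H2 : 0 < 2 ^ (2 * m + 1)) by (apply pow_lt; lra).
  replace (INR (fact m) * Gamma (INR m + 3 / 2)) with
    (INR (fact (2 * m + 1)) * sqrt PI / 2 ^ (2 * m + 1)) by (rewrite <- Hf; field; lra).
  replace ((2 * INR m + 1 / 2) * s) with (- (s / 2) + INR (2 * m + 1) * s)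
    by (rewrite plus_INR, mult_INR; change (INR 2) with 2; simpl (INR 1); field).
  rewrite exp_plus; field; lra. }
rewrite E1, E2; unfold growth_norm.
replace (s / 2 - 2 * exp s) with (s / 2 + - (2 * exp s)) by ring.
replace (- (4 * exp s)) with (- (2 * exp s) + - (2 * exp s)) by ring.
rewrite !exp_plus, !(exp_Ropp (s / 2)), !(exp_Ropp (2 * exp s)).
assert (H1 := exp_pos (s / 2)); assert (H2 := exp_pos (2 * exp s)).
split; field; lra.
Qed.

Lemma I_growth_half : I_growth (- (1 / 2)) /\ I_growth (1 / 2).
Proof.
assert (H : is_lim (fun s => exp (- (4 * exp s))) p_infty 0).
{ apply (is_lim_comp exp (fun s => - (4 * exp s)) p_infty 0 m_infty).
  - apply is_lim_exp_m.
  - apply (is_lim_opp (fun s => 4 * exp s) p_infty p_infty).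
    assert (H := is_lim_scal_l exp 4 p_infty p_infty is_lim_exp_p).
    replace (Rbar_mult 4 p_infty) with p_infty in H; [exact H|].
    symmetry; apply is_Rbar_mult_unique, is_Rbar_mult_sym, is_Rbar_mult_p_infty_pos.
    simpl; lra.
  - exists 0; intros x _; discriminate. }
unfold I_growth.
split; [replace (Finite 1) with (Finite (1 + 0)) by (f_equal; ring)|
        replace (Finite 1) with (Finite (1 - 0)) by (f_equal; ring)].
- eapply is_lim_ext; [intros s; symmetry; apply besselI_half|].
  apply is_lim_plus'; [apply is_lim_const|exact H].
- eapply is_lim_ext; [intros s; symmetry; apply besselI_half|].
  apply is_lim_minus'; [apply is_lim_const|exact H].
Qed.

Lemma is_lim_mult_R f g x (l m : R) : is_lim f x l -> is_lim g x m ->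
  is_lim (fun y => f y * g y) x (l * m).
Proof. intros Hf Hg; apply (is_lim_mult f g x l m); auto; exact I. Qed.

Lemma I_growth_small c nu : I_growth nu ->
  is_lim (fun s => c * exp (- s) * (besselI nu s * growth_norm s)) p_infty 0.
Proof.
intros H; replace (Finite 0) with (Finite (c * 0 * 1)) by (f_equal; ring).
apply is_lim_mult_R; [|exact H].
apply (is_lim_scal_l _ c _ 0), is_lim_exp_opp.
Qed.

Lemma I_growth_up nu : nonpole nu ->
  I_growth (nu - 1) -> I_growth nu -> I_growth (nu + 1).
Proof.
intros Hn H1 H2; unfold I_growth.
replace (Finite 1) with (Finite (1 - 0)) by (f_equal; ring).
eapply is_lim_ext; [|exact (is_lim_minus' _ _ _ _ _ H1 (I_growth_small nu nu H2))].
intros s; cbv beta; rewrite (besselI_rec nu s Hn); ring.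
Qed.

Lemma I_growth_down nu : nonpole nu ->
  I_growth (nu + 1) -> I_growth nu -> I_growth (nu - 1).
Proof.
intros Hn H1 H2; unfold I_growth.
replace (Finite 1) with (Finite (1 + 0)) by (f_equal; ring).
eapply is_lim_ext; [|exact (is_lim_plus' _ _ _ _ _ H1 (I_growth_small nu nu H2))].
intros s; cbv beta; rewrite (besselI_rec nu s Hn); ring.
Qed.

Lemma I_growth_half_integers n : I_growth (INR n - 1 / 2) /\ I_growth (INR n + 1 / 2).
Proof.
induction n as [|n [IH1 IH2]].
- simpl INR; unfold Rminus; rewrite !Rplus_0_l; apply I_growth_half.
- rewrite !S_INR; replace (INR n + 1 - 1 / 2) with (INR n + 1 / 2) by field.
  split; [exact IH2|].
  replace (INR n + 1 + 1 / 2) with (INR n + 1 / 2 + 1) by ring.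
  apply I_growth_up; [apply nonpole_pos; generalize (pos_INR n); lra| |exact IH2].
  replace (INR n + 1 / 2 - 1) with (INR n - 1 / 2) by field; exact IH1.
Qed.

(** * Interpolation between half-integer orders *)

Lemma Rpower_near_1 x d : 0 < x -> 0 <= d <= 1 ->
  1 - Rabs (x - 1) <= Rpower x d <= 1 + Rabs (x - 1).
Proof.
intros Hx Hd.
assert (H0 : Rpower x 0 = 1) by (apply Rpower_O, Hx).
assert (H1 : Rpower x 1 = x) by (apply Rpower_1, Hx).
destruct (Rle_lt_dec 1 x) as [H|H].
- assert (Hl : 0 <= ln x) by (rewrite <- ln_1; apply ln_le; lra).
  rewrite (Rabs_pos_eq (x - 1)) by lra.
  split.
  + apply Rle_trans with (Rpower x 0); [lra|apply exp_le; nra].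
  + replace (1 + (x - 1)) with (Rpower x 1) by lra; apply exp_le; nra.
- assert (Hl : ln x <= 0) by (rewrite <- ln_1; apply ln_le; lra).
  rewrite (Rabs_left (x - 1)) by lra.
  split.
  + replace (1 - - (x - 1)) with (Rpower x 1) by (rewrite H1; ring).
    apply exp_le; nra.
  + apply Rle_trans with (Rpower x 0); [apply exp_le; nra|rewrite H0; lra].
Qed.

Lemma besselI_term_pos nu s m : 0 < nu + 1 -> 0 < besselI_term nu s m.
Proof.
intros H; apply Rdiv_lt_0_compat; [apply exp_pos|].
apply Rmult_lt_0_compat; [apply fact_pos|apply Gamma_pos].
generalize (pos_INR m); lra.
Qed.

(** With x = (m + nu) e^(-s), [Gamma_ratio_bounds] places the quotient of the two terms between x^d
    and (x + e^(-s))^d; both are close to 1 when x is, because a power x^d with 0 <= d <= 1 lies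
    between 1 and x. *)
Lemma besselI_term_interp nu s d m : 0 < nu -> 0 <= d <= 1 ->
  Rabs (besselI_term (nu - d) s m - besselI_term nu s m) <=
  besselI_term nu s m * (Rabs (exp (- s) * (INR m + nu) - 1) + exp (- s)).
Proof.
intros Hnu Hd.
assert (Hm := pos_INR m); assert (Hs := exp_pos (- s)).
assert (HT := besselI_term_pos nu s m ltac:(lra)).
set (z := INR m + nu + 1).
assert (HB := Gamma_ratio_bounds z d ltac:(unfold z; lra) Hd).
assert (Gz : 0 < Gamma z) by (apply Gamma_pos; unfold z; lra).
assert (Gzd : 0 < Gamma (z - d)) by (apply Gamma_pos; unfold z; lra).
assert (E : besselI_term (nu - d) s m =
  besselI_term nu s m * (Rpower (exp (- s)) d * (Gamma z / Gamma (z - d)))).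
{ unfold besselI_term, Rpower; rewrite ln_exp; fold z.
  replace (INR m + (nu - d) + 1) with (z - d) by (unfold z; ring).
  replace ((2 * INR m + (nu - d)) * s) with ((2 * INR m + nu) * s + d * - s) by ring.
  rewrite exp_plus; assert (Hf := fact_pos m); field; lra. }
set (x := exp (- s) * (INR m + nu)) in *.
assert (Hx : 0 < x) by (unfold x; nra).
assert (B1 : Rpower x d <= Rpower (exp (- s)) d * (Gamma z / Gamma (z - d))).
{ unfold x; replace (INR m + nu) with (z - 1) by (unfold z; ring).
  rewrite <- Rpower_mult_distr; [|exact Hs|unfold z; lra].
  apply Rmult_le_compat_l; [apply Rlt_le, Rpower_pos|apply HB]. }
assert (B2 : Rpower (exp (- s)) d * (Gamma z / Gamma (z - d)) <=
  Rpower (x + exp (- s)) d).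
{ replace (x + exp (- s)) with (exp (- s) * z) by (unfold x, z; ring).
  rewrite <- Rpower_mult_distr; [|exact Hs|unfold z; lra].
  apply Rmult_le_compat_l; [apply Rlt_le, Rpower_pos|].
  eapply Rle_trans; [apply HB|].
  apply Rle_Rpower_l; [lra|]; unfold z; lra. }
assert (P1 := Rpower_near_1 x d Hx Hd).
assert (P2 := Rpower_near_1 (x + exp (- s)) d ltac:(lra) Hd).
assert (P3 : Rabs (x + exp (- s) - 1) <= Rabs (x - 1) + exp (- s)).
{ replace (x + exp (- s) - 1) with ((x - 1) + exp (- s)) by ring.
  eapply Rle_trans; [apply Rabs_triang|]; rewrite (Rabs_pos_eq (exp _)); lra. }
rewrite E; set (rho := Rpower (exp (- s)) d * (Gamma z / Gamma (z - d))) in *.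
replace (besselI_term nu s m * rho - besselI_term nu s m) with
  (besselI_term nu s m * (rho - 1)) by ring.
rewrite Rabs_mult, (Rabs_pos_eq (besselI_term nu s m)) by lra.
apply Rmult_le_compat_l; [lra|]; apply Rabs_le; lra.
Qed.

(* With [x_m = (m + nu) e^(-s)], multiplying the terms of [I_nu] by [x_m] gives
   those of [I_(nu-1)]; hence the second moment of [x_m - 1] is explicit. *)
Lemma besselI_second_moment nu s : 0 < nu ->
  is_series (fun m => besselI_term nu s m * (exp (- s) * (INR m + nu) - 1) ^ 2)
    (2 * besselI nu s - 2 * besselI (nu - 1) s +
     nu * exp (- s) * besselI (nu - 1) s).
Proof.
intros Hnu; assert (Hn := nonpole_pos nu Hnu).
assert (Ho : order_ok nu) by (apply nonpole_S, Hn).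
assert (Ho' : order_ok (nu - 1)).
{ unfold order_ok; replace (nu - 1 + 1) with nu by ring; exact Hn. }
assert (S1 := Series_correct _ (ex_besselI nu s Ho)).
assert (S2 := Series_correct _ (ex_besselI (nu - 1) s Ho')).
assert (S3 : is_series (fun m => exp (- s) * INR m * besselI_term (nu - 1) s m)
  (besselI nu s)).
{ apply is_series_decr_1.
  match goal with |- is_series _ ?l => assert (El : l = besselI nu s) end.
  { change (besselI nu s + - (exp (- s) * INR 0 * besselI_term (nu - 1) s 0) =
      besselI nu s); simpl INR; ring. }
  rewrite El; eapply is_series_ext; [|exact S1].
  intros m; cbv beta; rewrite besselI_term_upper; f_equal; ring. }
assert (S4 := is_series_plus _ _ _ _ (is_series_plus _ _ _ _ S3
  (is_series_scal_l (K := R_AbsRing) (nu * exp (- s) - 2) _ _ S2)) S1).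
assert (E : plus (plus (besselI nu s)
  (scal (nu * exp (- s) - 2) (Series (besselI_term (nu - 1) s))))
  (Series (besselI_term nu s)) = 2 * besselI nu s - 2 * besselI (nu - 1) s +
     nu * exp (- s) * besselI (nu - 1) s).
{ change (besselI nu s + (nu * exp (- s) - 2) * besselI (nu - 1) s + besselI nu s =
  2 * besselI nu s - 2 * besselI (nu - 1) s +
     nu * exp (- s) * besselI (nu - 1) s); ring. }
rewrite <- E; eapply is_series_ext; [|exact S4].
intros m.
change (exp (- s) * INR m * besselI_term (nu - 1) s m +
  (nu * exp (- s) - 2) * besselI_term (nu - 1) s m + besselI_term nu s m =
  besselI_term nu s m * (exp (- s) * (INR m + nu) - 1) ^ 2).
rewrite (besselI_term_lower nu s m Hn); ring.
Qed.

(** The first absolute moment of x_m - 1 is bounded through |u| <= eta/2 + u^2 / (2 eta). The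
    normalized second moment tends to 2 - 2 + 0 = 0, so only the arbitrarily small eta/2
    survives. *)
Lemma I_growth_interp nu d : 0 < nu -> 0 <= d <= 1 ->
  I_growth nu -> I_growth (nu - 1) -> I_growth (nu - d).
Proof.
intros Hnu Hd H1 H2.
assert (Ho : order_ok nu) by (apply nonpole_S, nonpole_pos, Hnu).
assert (Ho' : order_ok (nu - d)) by (apply nonpole_pos; lra).
set (V := fun s => 2 * besselI nu s - 2 * besselI (nu - 1) s +
     nu * exp (- s) * besselI (nu - 1) s).
assert (Hb : forall eta s, 0 < eta ->
  Rabs (besselI (nu - d) s * growth_norm s - besselI nu s * growth_norm s) <=
  (eta / 2 + exp (- s)) * (besselI nu s * growth_norm s) +
  / (2 * eta) * (V s * growth_norm s)).
{ intros eta s Heta.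
  assert (SV := besselI_second_moment nu s Hnu).
  assert (Hg := growth_norm_pos s).
  assert (Hbound : Rabs (besselI (nu - d) s - besselI nu s) <=
    (eta / 2 + exp (- s)) * besselI nu s + / (2 * eta) * V s).
  { unfold V; rewrite <- (is_series_unique _ _ SV).
    unfold besselI; rewrite <- Series_minus by (apply ex_besselI; assumption).
    rewrite <- !Series_scal_l, <- Series_plus.
    - set (g := fun m => (eta / 2 + exp (- s)) * besselI_term nu s m +
        / (2 * eta) * (besselI_term nu s m * (exp (- s) * (INR m + nu) - 1) ^ 2)).
      assert (Hg2 : ex_series g).
      { apply (ex_series_plus (V := R_NormedModule)); apply ex_series_Rscal;
          [apply ex_besselI, Ho|eexists; exact SV]. }
      assert (Hterm : forall m,
        Rabs (besselI_term (nu - d) s m - besselI_term nu s m) <= g m).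
      { intros m; eapply Rle_trans; [apply besselI_term_interp; assumption|].
        unfold g; set (x := exp (- s) * (INR m + nu)).
        assert (HT := besselI_term_pos nu s m ltac:(lra)).
        assert (Ham : Rabs (x - 1) <= eta / 2 + / (2 * eta) * (x - 1) ^ 2).
        { rewrite <- (pow2_abs (x - 1)); set (u := Rabs (x - 1)).
          assert (Hq : 0 <= / (2 * eta) * (u - eta) ^ 2).
          { apply Rmult_le_pos; [apply Rlt_le, Rinv_0_lt_compat; lra|apply pow2_ge_0]. }
          replace (/ (2 * eta) * (u - eta) ^ 2) with
            (eta / 2 + / (2 * eta) * u ^ 2 - u) in Hq by (field; lra).
          lra. }
        apply Rle_trans with (besselI_term nu s m *
          ((eta / 2 + / (2 * eta) * (x - 1) ^ 2) + exp (- s))).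
        - apply Rmult_le_compat_l; lra.
        - right; ring. }
      eapply Rle_trans; [apply Series_Rabs|apply Series_le].
      + apply (ex_series_bound _ g); [|exact Hg2].
        intros m; rewrite Rabs_Rabsolu; apply Hterm.
      + intros m; split; [apply Rabs_pos|apply Hterm].
      + exact Hg2.
    - apply ex_series_Rscal, ex_besselI, Ho.
    - apply ex_series_Rscal; eexists; exact SV. }
  rewrite <- Rmult_minus_distr_r, Rabs_mult, (Rabs_pos_eq (growth_norm s)) by lra.
  eapply Rle_trans; [apply Rmult_le_compat_r; [lra|exact Hbound]|right; ring]. }
assert (HV : is_lim (fun s => V s * growth_norm s) p_infty 0).
{ replace (Finite 0) with (Finite (2 * 1 - 2 * 1 + 0)) by (f_equal; ring).
  eapply is_lim_ext; [|apply is_lim_plus'; [apply is_lim_minus'|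
    exact (I_growth_small nu (nu - 1) H2)];
    [exact (is_lim_scal_l _ 2 _ _ H1)|exact (is_lim_scal_l _ 2 _ _ H2)]].
  intros s; unfold V; cbv beta; ring. }
apply is_lim_spec; intros eps; simpl.
assert (Heps := cond_pos eps).
(* The choice eta = eps/2 makes this bound tend to eps/4, hence eventually below eps/2; the other
   eps/2 is spent on the limit for nu itself. *)
assert (HR : is_lim (fun s => (eps / 2 / 2 + exp (- s)) * (besselI nu s * growth_norm s) +
  / (2 * (eps / 2)) * (V s * growth_norm s)) p_infty (eps / 4)).
{ replace (Finite (eps / 4)) with
    (Finite ((eps / 2 / 2 + 0) * 1 + / (2 * (eps / 2)) * 0)) by (f_equal; field; lra).
  apply is_lim_plus'.
  - apply is_lim_mult_R; [|exact H1].
    apply is_lim_plus'; [apply is_lim_const|apply is_lim_exp_opp].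
  - exact (is_lim_scal_l _ _ _ _ HV). }
apply is_lim_spec in HR; apply is_lim_spec in H1.
destruct (HR (mkposreal (eps / 4) ltac:(lra))) as [M1 HM1].
destruct (H1 (mkposreal (eps / 2) ltac:(lra))) as [M2 HM2].
simpl in HM1, HM2.
exists (Rmax M1 M2); intros s Hs.
specialize (HM1 s (Rle_lt_trans _ _ _ (Rmax_l _ _) Hs)).
specialize (HM2 s (Rle_lt_trans _ _ _ (Rmax_r _ _) Hs)).
specialize (Hb (eps / 2) s ltac:(lra)).
apply Rabs_lt_between in HM1; apply Rabs_lt_between in HM2.
apply Rabs_le_between in Hb; apply Rabs_lt_between; lra.
Qed.

(** Orders from -1/2 on are interpolated; lower ones are reached by k downward steps of the
    recurrence, each of which uses the two orders above. *)
Lemma besselI_growth nu : order_ok nu -> I_growth nu.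
Proof.
assert (H : forall k nu, order_ok nu -> - (1 / 2) <= nu + INR k -> I_growth nu).
{ clear nu; induction k as [|k IH]; intros nu Ho Hk.
  - simpl INR in Hk.
    (* This n satisfies n - 1/2 <= nu < n + 1/2, so nu lies between neighbouring half-integers. *)
    destruct (nfloor_ex (nu + 1 / 2) ltac:(lra)) as [n Hn].
    destruct (I_growth_half_integers (S n)) as [G1 G2]; rewrite S_INR in G1, G2.
    assert (Hn' := pos_INR n).
    replace (INR n + 1 - 1 / 2) with (INR n + 1 / 2) in G1 by field.
    destruct (I_growth_half_integers n) as [G0 _].
    replace nu with (INR n + 1 / 2 - (INR n + 1 / 2 - nu)) by ring.
    apply I_growth_interp; [lra|lra|exact G1|].
    replace (INR n + 1 / 2 - 1) with (INR n - 1 / 2) by field; exact G0.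
  - rewrite S_INR in Hk.
    replace nu with (nu + 1 - 1) by ring; apply I_growth_down; [exact Ho| |].
    + apply IH; [apply nonpole_S, nonpole_S, Ho|lra].
    + apply IH; [apply nonpole_S, Ho|lra]. }
intros Ho; destruct (INR_unbounded (- (1 / 2) - nu)) as [k Hk].
apply (H k); [exact Ho|lra].
Qed.

(** * Solutions of Bessel's equation and their amplitudes *)

(* In the logarithmic variable, Bessel's equation reads [U'' = (nu^2 - e^(2w)) U]. *)
Definition bessel_sol (nu : R) (U U' : C -> C) : Prop :=
  forall w, cderiv U w (U' w) /\
    cderiv U' w ((RtoC (nu * nu) - Cexp w * Cexp w) * U w)%C.

(* With [zeta = e^w], [Liouville] is [y = zeta^(1/2) U] and [Liouville'] its
   derivative in [zeta]; they satisfy [y'' = (kappa / zeta^2 - 1) y]. *)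
Definition Liouville (U : C -> C) (w : C) : C := (Cexp (w / 2) * U w)%C.
Definition Liouville' (U U' : C -> C) (w : C) : C :=
  (Cexp (- (w / 2)) * (U' w + U w / 2))%C.

Definition kappa (nu : R) : R := nu * nu - 1 / 4.

(* For [tau = i] and [tau = - i] these are the variable coefficients [A], [B] in
   [y = A e^(i zeta) + B e^(- i zeta)], [y' = i A e^(i zeta) - i B e^(- i zeta)]. *)
Definition amp (tau : C) (U U' : C -> C) (w : C) : C :=
  (Cexp (- (tau * Cexp w)) * ((Liouville U w - tau * Liouville' U U' w) / 2))%C.

Definition amp' (nu : R) (tau : C) (U : C -> C) (w : C) : C :=
  (- (tau / 2) * (RtoC (kappa nu) / Cexp w) *
   (Cexp (- (tau * Cexp w)) * Liouville U w))%C.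

Lemma C2_nz : RtoC 2 <> RtoC 0.
Proof. apply RtoC_ne0; lra. Qed.

Lemma cderiv_half w : cderiv (fun z => z / 2)%C w (/ 2)%C.
Proof.
apply (cderiv_eq _ _ (1 * / 2 + w * RtoC 0)%C); [|ring].
apply (cderiv_mult (fun z => z) (fun _ => (/ 2)%C)).
- apply cderiv_id.
- apply cderiv_const.
Qed.

Lemma cderiv_opp f z l : cderiv f z l -> cderiv (fun w => - f w)%C z (- l)%C.
Proof.
intros H; apply (cderiv_ext (fun w => - (1) * f w)%C); [intros w; ring|].
eapply cderiv_eq; [apply cderiv_scal, H|ring].
Qed.

Lemma Cexp_halves w : Cexp w = (Cexp (w / 2) * Cexp (w / 2))%C.
Proof. rewrite <- Cexp_add; f_equal; field; apply C2_nz. Qed.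

Lemma Liouville_deriv nu U U' w : bessel_sol nu U U' ->
  cderiv (Liouville U) w (Cexp w * Liouville' U U' w)%C.
Proof.
intros H; destruct (H w) as [H1 _]; eapply cderiv_eq.
- apply cderiv_mult; [|exact H1].
  apply (cderiv_comp Cexp (fun z => z / 2)%C); [apply cderiv_Cexp|apply cderiv_half].
- unfold Liouville'; rewrite Cexp_opp, (Cexp_halves w).
  field; repeat split; try apply Cexp_ne0; apply C2_nz.
Qed.

Lemma Liouville'_deriv nu U U' w : bessel_sol nu U U' ->
  cderiv (Liouville' U U') w
    ((RtoC (kappa nu) / Cexp w - Cexp w) * Liouville U w)%C.
Proof.
intros H; destruct (H w) as [H1 H2]; eapply cderiv_eq.
- apply (cderiv_mult (fun w => Cexp (- (w / 2)))%C (fun w => U' w + U w / 2)%C).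
  + apply (cderiv_comp Cexp (fun z => - (z / 2))%C);
      [apply cderiv_Cexp|apply cderiv_opp, cderiv_half].
  + apply cderiv_plus; [exact H2|].
    apply (cderiv_mult U (fun _ => (/ 2)%C)); [exact H1|apply cderiv_const].
- unfold Liouville; rewrite Cexp_opp, (Cexp_halves w).
  unfold kappa; rewrite RtoC_minus, RtoC_div by lra.
  field; repeat split; try apply Cexp_ne0; apply C2_nz.
Qed.

(** The condition on tau makes the amplitude constant for the unperturbed equation y'' = -y; only
    the term kappa / zeta^2 contributes. The derivative is taken in w, that is, as zeta d/dzeta. *)
Lemma amp_deriv nu tau U U' w : (tau * tau = - (1))%C -> bessel_sol nu U U' ->
  cderiv (amp tau U U') w (amp' nu tau U w).
Proof.
intros Ht H; unfold amp'; eapply cderiv_eq.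
- apply (cderiv_mult (fun w => Cexp (- (tau * Cexp w)))%C
    (fun w => (Liouville U w - tau * Liouville' U U' w) * / 2)%C).
  + apply (cderiv_comp Cexp (fun z => - (tau * Cexp z))%C); [apply cderiv_Cexp|].
    apply cderiv_opp, cderiv_scal, cderiv_Cexp.
  + apply (cderiv_mult (fun w => Liouville U w - tau * Liouville' U U' w)%C
      (fun _ => (/ 2)%C)); [|apply cderiv_const].
    apply cderiv_plus; [eapply Liouville_deriv, H|].
    apply cderiv_opp, cderiv_scal; eapply Liouville'_deriv, H.
- set (e := Cexp w); set (x := Cexp (- (tau * e))).
  assert (He : e <> RtoC 0) by apply Cexp_ne0.
  set (y := Liouville U w); set (v := Liouville' U U' w).
  transitivity (x * (- (tau / 2) * (RtoC (kappa nu) / e) * y +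
    e * v * / 2 * (1 + tau * tau)))%C; [|rewrite Ht; ring].
  field; repeat split; try exact He; apply C2_nz.
Qed.

Lemma Liouville_amp U U' w :
  Liouville U w = (amp Ci U U' w * Cexp (Ci * Cexp w) +
                   amp (- Ci) U U' w * Cexp (- (Ci * Cexp w)))%C.
Proof.
unfold amp; replace (- (- Ci * Cexp w))%C with (Ci * Cexp w)%C by ring.
rewrite Cexp_opp; field; repeat split; try apply Cexp_ne0; apply C2_nz.
Qed.

(** * Gronwall estimates *)

Lemma nonneg_deriv_le_ex (f : R -> R) a b : a <= b ->
  (forall t, a <= t <= b -> exists d, is_derive f t d /\ 0 <= d) -> f a <= f b.
Proof.
intros Hab H; apply (nonneg_deriv_le f (Derive f) a b Hab); intros t Ht;
  destruct (H t Ht) as [d [Hd H0]]; rewrite (is_derive_unique _ _ _ Hd); assumption.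
Qed.

(** Squares are used because they stay differentiable where an amplitude vanishes. *)
Definition sqnorm2 (f g : C) : R := Cmod f ^ 2 + Cmod g ^ 2.

Lemma is_derive_Cmod2 (f : R -> C) t l : rderiv f t l ->
  is_derive (fun s => Cmod (f s) ^ 2) t (2 * Re (Cconj (f t) * l)%C).
Proof.
intros H; destruct (rderiv_Re_Im _ _ _ H) as [H1 H2].
apply (is_derive_ext (fun s => Re (f s) ^ 2 + Im (f s) ^ 2));
  [intros s; symmetry; apply Cmod2_alt|].
replace (2 * Re (Cconj (f t) * l)%C) with
  (plus (INR 2 * Re l * Re (f t) ^ 1) (INR 2 * Im l * Im (f t) ^ 1))
  by (unfold plus, Re, Im; simpl; ring).
apply (is_derive_plus (V := R_NormedModule));
  [apply (is_derive_pow (fun s => Re (f s)) 2)|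
   apply (is_derive_pow (fun s => Im (f s)) 2)]; assumption.
Qed.

Lemma Cmod_sum_sq_le f g : (Cmod f + Cmod g) ^ 2 <= 2 * sqnorm2 f g.
Proof. unfold sqnorm2; generalize (pow2_ge_0 (Cmod f - Cmod g)); nra. Qed.

Lemma sqnorm2_le f g : sqnorm2 f g <= (Cmod f + Cmod g) ^ 2.
Proof. unfold sqnorm2; generalize (Cmod_ge_0 f) (Cmod_ge_0 g); nra. Qed.

(** The coefficient L enters only through its real part, so an oscillation or a damping of any size
    costs nothing. *)
Lemma sqnorm2_deriv (f g : R -> C) t (L E1 E2 : C) k :
  rderiv f t (L * f t + E1)%C -> rderiv g t E2 ->
  Cmod E1 <= k / 2 * (Cmod (f t) + Cmod (g t)) ->
  Cmod E2 <= k / 2 * (Cmod (f t) + Cmod (g t)) ->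
  exists D, is_derive (fun s => sqnorm2 (f s) (g s)) t
    (2 * Re L * Cmod (f t) ^ 2 + D) /\
    Rabs D <= 2 * k * sqnorm2 (f t) (g t).
Proof.
intros Hf Hg B1 B2.
exists (2 * (Re (Cconj (f t) * E1)%C + Re (Cconj (g t) * E2)%C)); split.
- replace (2 * Re L * Cmod (f t) ^ 2 +
    2 * (Re (Cconj (f t) * E1)%C + Re (Cconj (g t) * E2)%C)) with
    (plus (2 * Re (Cconj (f t) * (L * f t + E1))%C) (2 * Re (Cconj (g t) * E2)%C)).
  + apply (is_derive_plus (V := R_NormedModule)); apply is_derive_Cmod2; assumption.
  + rewrite Cmod2_alt; unfold plus, Re, Im; simpl; ring.
- assert (H1 := Re_le_Cmod (Cconj (f t) * E1)%C).
  assert (H2 := Re_le_Cmod (Cconj (g t) * E2)%C).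
  rewrite Cmod_mult, Cmod_conj in H1, H2.
  assert (P1 := Cmod_ge_0 (f t)); assert (P2 := Cmod_ge_0 (g t)).
  assert (Hs := Cmod_sum_sq_le (f t) (g t)).
  set (S := Cmod (f t) + Cmod (g t)) in *.
  assert (Hb : Cmod (f t) * Cmod E1 + Cmod (g t) * Cmod E2 <= k / 2 * S ^ 2).
  { replace (k / 2 * S ^ 2) with (Cmod (f t) * (k / 2 * S) + Cmod (g t) * (k / 2 * S))
      by (unfold S; field).
    apply Rplus_le_compat; apply Rmult_le_compat_l; assumption. }
  rewrite Rabs_mult, (Rabs_pos_eq 2) by lra.
  assert (Ht := Rabs_triang (Re (Cconj (f t) * E1)%C) (Re (Cconj (g t) * E2)%C)).
  assert (Hk : k / 2 * S ^ 2 <= k * sqnorm2 (f t) (g t)).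
  (* If k < 0, the bound on |E1| forces both amplitudes to vanish. *)
  { destruct (Rle_lt_dec 0 k) as [Hk|Hk]; [nra|].
    assert (P3 := Cmod_ge_0 E1).
    assert (S = 0) by (unfold S in *; nra).
    assert (Cmod (f t) = 0) by (unfold S in *; lra).
    assert (Cmod (g t) = 0) by (unfold S in *; lra).
    unfold sqnorm2; replace (Cmod (f t)) with 0; replace (Cmod (g t)) with 0.
    replace S with 0; lra. }
  lra.
Qed.

Lemma sqnorm2_ge0 f g : 0 <= sqnorm2 f g.
Proof. unfold sqnorm2; generalize (pow2_ge_0 (Cmod f)) (pow2_ge_0 (Cmod g)); lra. Qed.

(** The quantity |f|^2 + |g|^2 times e^(-2K) is nonincreasing. Damping of f restricts the estimate
    to one direction of travel. *)
Lemma gronwall_forward (f g E1 E2 L : R -> C) (K k : R -> R) a b : a <= b ->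
  (forall t, a <= t <= b -> rderiv f t (L t * f t + E1 t)%C /\ Re (L t) <= 0 /\
     rderiv g t (E2 t) /\ is_derive K t (k t) /\
     Cmod (E1 t) <= k t / 2 * (Cmod (f t) + Cmod (g t)) /\
     Cmod (E2 t) <= k t / 2 * (Cmod (f t) + Cmod (g t))) ->
  sqnorm2 (f b) (g b) <= sqnorm2 (f a) (g a) * exp (2 * (K b - K a)).
Proof.
intros Hab H.
assert (Hm : forall t, a <= t <= b -> exists D,
  is_derive (fun s => - (sqnorm2 (f s) (g s) * exp (- (2 * K s)))) t D /\ 0 <= D).
{ intros t Ht; destruct (H t Ht) as [Hf [HL [Hg [HK [B1 B2]]]]].
  destruct (sqnorm2_deriv f g t (L t) (E1 t) (E2 t) (k t) Hf Hg B1 B2)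
    as [D [HD HDb]].
  exists (- ((2 * Re (L t) * Cmod (f t) ^ 2 + D) * exp (- (2 * K t)) +
     sqnorm2 (f t) (g t) * (- (2 * k t) * exp (- (2 * K t))))).
  split.
  - apply (is_derive_opp (V := R_NormedModule)
      (fun s => sqnorm2 (f s) (g s) * exp (- (2 * K s)))).
    apply (is_derive_mult (K := R_AbsRing) (fun s => sqnorm2 (f s) (g s))
      (fun s => exp (- (2 * K s)))); [exact HD| |exact Rmult_comm].
    apply (is_derive_comp (K := R_AbsRing) (V := R_NormedModule) exp
      (fun s => - (2 * K s)) t (exp (- (2 * K t))) (- (2 * k t))).
    + apply is_derive_exp.
    + apply (is_derive_opp (V := R_NormedModule) (fun s => 2 * K s)).
      apply (is_derive_scal K t 2 (k t)), HK.
  - assert (He := exp_pos (- (2 * K t))); apply Rabs_le_between in HDb.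
    assert (0 <= Cmod (f t) ^ 2) by apply pow2_ge_0.
    replace (- ((2 * Re (L t) * Cmod (f t) ^ 2 + D) * exp (- (2 * K t)) +
     sqnorm2 (f t) (g t) * (- (2 * k t) * exp (- (2 * K t))))) with
     ((2 * (- Re (L t)) * Cmod (f t) ^ 2 +
      (2 * k t * sqnorm2 (f t) (g t) - D)) * exp (- (2 * K t))) by ring.
    apply Rmult_le_pos; [nra|lra]. }
assert (Hle := nonneg_deriv_le_ex _ a b Hab Hm).
cbv beta in Hle.
replace (2 * (K b - K a)) with (- (2 * K a) + 2 * K b) by ring.
rewrite exp_plus, <- Rmult_assoc.
replace (sqnorm2 (f b) (g b)) with
  (sqnorm2 (f b) (g b) * exp (- (2 * K b)) * exp (2 * K b)).
- apply Rmult_le_compat_r; [apply Rlt_le, exp_pos|lra].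
- rewrite Rmult_assoc, <- exp_plus, Rplus_opp_l, exp_0; ring.
Qed.

Lemma rderiv_opp_arg f t l : rderiv f (- t) l ->
  rderiv (fun s => f (- s)) t (- l)%C.
Proof.
intros H eps He; destruct (H eps He) as [d [Hd H']].
exists d; split; [exact Hd|]; intros h Hh.
rewrite <- Rabs_Ropp in Hh |- *; specialize (H' _ Hh).
replace (- (t + h)) with (- t + - h) by ring.
replace (- l * RtoC h)%C with (l * RtoC (- h))%C by (rewrite RtoC_opp; ring).
exact H'.
Qed.

(** Without damping, both directions are possible, and the increment is measured by the values at
    either end c: a near point on the real axis, or a far point where the limits are known. *)
Lemma gronwall_increment (f g f' g' : R -> C) (K k : R -> R) a b : a <= b ->
  (forall t, a <= t <= b -> rderiv f t (f' t) /\ rderiv g t (g' t) /\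
     is_derive K t (k t) /\ 0 <= k t /\
     Cmod (f' t) <= k t / 2 * (Cmod (f t) + Cmod (g t)) /\
     Cmod (g' t) <= k t / 2 * (Cmod (f t) + Cmod (g t))) ->
  let D := K b - K a in
  forall c, c = a \/ c = b ->
  Cmod (f b - f a)%C <= D * exp D * (Cmod (f c) + Cmod (g c)) /\
  Cmod (g b - g a)%C <= D * exp D * (Cmod (f c) + Cmod (g c)).
Proof.
intros Hab H D c Hc.
assert (HKm : forall u v, a <= u -> u <= v -> v <= b -> K u <= K v).
{ intros u v H1 H2 H3; apply (nonneg_deriv_le K k u v H2);
    intros t Ht; apply H; lra. }
assert (HN : forall t, a <= t <= b ->
  sqnorm2 (f t) (g t) <= sqnorm2 (f c) (g c) * exp (2 * D)).
{ intros t Ht.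
  assert (HA : sqnorm2 (f c) (g c) * exp (2 * Rabs (K t - K c)) <=
    sqnorm2 (f c) (g c) * exp (2 * D)).
  { apply Rmult_le_compat_l; [apply sqnorm2_ge0|apply exp_le].
    apply Rmult_le_compat_l; [lra|].
    assert (H1 := HKm a t ltac:(lra) ltac:(lra) ltac:(lra)).
    assert (H2 := HKm t b ltac:(lra) ltac:(lra) ltac:(lra)).
    unfold D; destruct Hc as [-> | ->]; apply Rabs_le; lra. }
  eapply Rle_trans; [|exact HA]; clear HA.
  destruct Hc as [-> | ->].
  - rewrite Rabs_pos_eq by (generalize (HKm a t ltac:(lra) ltac:(lra) ltac:(lra)); lra).
    apply (gronwall_forward f g f' g' (fun _ => RtoC 0) K k); [lra|].
    intros u Hu; destruct (H u ltac:(lra)) as [Hf [Hg [HK [Hk [B1 B2]]]]].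
    refine (conj _ (conj _ (conj Hg (conj HK (conj B1 B2))))).
    + eapply rderiv_eq; [exact Hf|ring].
    + simpl; lra.
  (* Starting from the right end, the forward estimate is applied to the functions reflected by t ->
     -t. *)
  - rewrite Rabs_left1 by (generalize (HKm t b ltac:(lra) ltac:(lra) ltac:(lra)); lra).
    assert (G := gronwall_forward (fun s => f (- s)) (fun s => g (- s))
      (fun s => - f' (- s)%R)%C (fun s => - g' (- s)%R)%C (fun _ => RtoC 0)
      (fun s => - K (- s)) (fun s => k (- s)) (- b) (- t) ltac:(lra)).
    cbv beta in G; rewrite !Ropp_involutive in G.
    replace (- (K t - K b)) with (- K t - - K b) by ring; apply G; clear G.
    intros u Hu; destruct (H (- u) ltac:(lra)) as [Hf [Hg [HK [Hk [B1 B2]]]]].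
    rewrite !Cmod_opp.
    refine (conj _ (conj _ (conj _ (conj _ (conj B1 B2))))).
    + eapply rderiv_eq; [apply rderiv_opp_arg, Hf|ring].
    + simpl; lra.
    + apply rderiv_opp_arg, Hg.
    + replace (k (- u)) with (opp (-1 * k (- u))) by (unfold opp; simpl; ring).
      apply (is_derive_opp (V := R_NormedModule) (fun s => K (- s))).
      apply (is_derive_comp (K := R_AbsRing) (V := R_NormedModule) K Ropp u
        (k (- u)) (-1)); [exact HK|].
      auto_derive; trivial; ring. }
set (S := Cmod (f c) + Cmod (g c)).
assert (HS : 0 <= S) by (unfold S; generalize (Cmod_ge_0 (f c)) (Cmod_ge_0 (g c)); lra).
(* The sharp constant would be sqrt 2; rounding it up to 2 cancels the k/2 of the hypothesis. *)
assert (HB : forall t, a <= t <= b -> Cmod (f t) + Cmod (g t) <= 2 * (exp D * S)).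
{ intros t Ht; specialize (HN t Ht).
  assert (He := exp_pos D).
  assert (H1 := Cmod_sum_sq_le (f t) (g t)).
  assert (H2 := sqnorm2_le (f c) (g c)); fold S in H2.
  replace (2 * D) with (D + D) in HN by ring; rewrite exp_plus in HN.
  apply Rsqr_incr_0_var; [rewrite !Rsqr_pow2|nra].
  apply Rle_trans with (2 * (S ^ 2 * (exp D * exp D))); [|nra].
  eapply Rle_trans; [exact H1|]; apply Rmult_le_compat_l; [lra|].
  eapply Rle_trans; [exact HN|]; apply Rmult_le_compat_r; [nra|exact H2]. }
assert (HI : forall h h', (forall t, a <= t <= b -> rderiv h t (h' t) /\
  Cmod (h' t) <= k t / 2 * (Cmod (f t) + Cmod (g t))) ->
  Cmod (h b - h a)%C <= D * exp D * S).
{ intros h h' Hh.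
  eapply Rle_trans; [apply (Cmod_increment_le h h' (fun t => K t * (exp D * S))
    (fun t => k t * (exp D * S)) a b Hab)|].
  - intros t Ht; apply Hh, Ht.
  - intros t Ht; apply (is_derive_ext (fun t => exp D * S * K t));
      [intros u; change (exp D * S * K u = K u * (exp D * S)); ring|].
    replace (k t * (exp D * S)) with (exp D * S * k t) by ring.
    apply (is_derive_scal K t (exp D * S) (k t)), H, Ht.
  - intros t Ht; eapply Rle_trans; [apply Hh, Ht|].
    destruct (H t Ht) as [_ [_ [_ [Hk _]]]]; specialize (HB t Ht).
    apply Rle_trans with (k t / 2 * (2 * (exp D * S))); [|right; field].
    apply Rmult_le_compat_l; lra.
  - unfold D; right; ring. }
split; [apply (HI f f')|apply (HI g g')]; intros t Ht;
  destruct (H t Ht) as [Hf [Hg [HK [Hk [B1 B2]]]]]; split; assumption.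
Qed.

(** * Connection along the first quadrant *)

Lemma cis_eq t : cis t = (cos t, sin t).
Proof.
unfold cis, Cexp; simpl.
replace (0 * t - 1 * 0) with 0 by ring; replace (0 * 0 + 1 * t) with t by ring.
rewrite exp_0, !Rmult_1_l; reflexivity.
Qed.

Lemma cis_plus s t : cis (s + t) = (cis s * cis t)%C.
Proof. unfold cis; rewrite <- Cexp_add, RtoC_plus; f_equal; ring. Qed.

Lemma cis_conj t : Cconj (cis t) = cis (- t).
Proof. rewrite !cis_eq, cos_neg, sin_neg; reflexivity. Qed.

Lemma Cmod_cis t : Cmod (cis t) = 1.
Proof.
unfold cis; rewrite Cmod_Cexp, <- exp_0; f_equal; simpl; ring.
Qed.

Lemma cis_PI2 : cis (PI / 2) = Ci.
Proof. rewrite cis_eq, cos_PI2, sin_PI2; reflexivity. Qed.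

Lemma cis_mult_PI m : cis (INR m * PI) = RtoC ((-1) ^ m).
Proof.
induction m as [|m IH].
- simpl; rewrite Rmult_0_l, cis_eq, cos_0, sin_0; reflexivity.
- rewrite S_INR, Rmult_plus_distr_r, cis_plus, IH, Rmult_1_l, cis_eq, cos_PI, sin_PI.
  apply C_ext; simpl; ring.
Qed.

Lemma Cexp_polar x t : Cexp (RtoC x + RtoC t * Ci)%C = (RtoC (exp x) * cis t)%C.
Proof.
rewrite Cexp_add, Cexp_R; unfold cis; f_equal; f_equal; ring.
Qed.

(** The amplitude A multiplied by e^(2 i zeta). In the upper half-plane A itself is not controlled
    by B, whereas this product obeys a system with bounded coupling to B. *)
Definition subdominant (U U' : C -> C) (w : C) : C :=
  (amp Ci U U' w * Cexp (Ci * Cexp w) * Cexp (Ci * Cexp w))%C.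

Lemma Ci_sqr : (Ci * Ci = - (1))%C.
Proof. apply C_ext; simpl; ring. Qed.

Lemma opp_Ci_sqr : (- Ci * - Ci = - (1))%C.
Proof. apply C_ext; simpl; ring. Qed.

(** The derivative of B; with the opposite sign it is also the coupling term in the equation of
    [subdominant]. *)
Definition drift (nu : R) (U U' : C -> C) (w : C) : C :=
  (Ci / 2 * (RtoC (kappa nu) / Cexp w) *
   (subdominant U U' w + amp (- Ci) U U' w))%C.

Lemma dominant_deriv nu U U' w : bessel_sol nu U U' ->
  cderiv (amp (- Ci) U U') w (drift nu U U' w).
Proof.
intros H; eapply cderiv_eq; [eapply amp_deriv; [apply opp_Ci_sqr|exact H]|].
unfold amp', drift; rewrite Liouville_amp with (U' := U').
replace (- (- Ci * Cexp w))%C with (Ci * Cexp w)%C by ring.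
unfold subdominant; rewrite (Cexp_opp (Ci * Cexp w)).
field; repeat split; try apply Cexp_ne0; apply C2_nz.
Qed.

Lemma subdominant_deriv nu U U' w : bessel_sol nu U U' ->
  cderiv (subdominant U U') w
    (RtoC 2 * Ci * Cexp w * subdominant U U' w +
     - drift nu U U' w)%C.
Proof.
intros H.
assert (He : cderiv (fun w => Cexp (Ci * Cexp w))%C w
  (Cexp (Ci * Cexp w) * (Ci * Cexp w))%C).
{ apply (cderiv_comp Cexp (fun z => Ci * Cexp z)%C); [apply cderiv_Cexp|].
  apply cderiv_scal, cderiv_Cexp. }
eapply cderiv_eq.
- apply (cderiv_mult (fun w => amp Ci U U' w * Cexp (Ci * Cexp w))%C); [|exact He].
  apply cderiv_mult; [|exact He].
  eapply amp_deriv; [apply Ci_sqr|exact H].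
- cbv beta; unfold amp', drift; rewrite Liouville_amp with (U' := U').
  unfold subdominant; rewrite (Cexp_opp (Ci * Cexp w)).
  field; repeat split; try apply Cexp_ne0; apply C2_nz.
Qed.

Lemma Cmod_drift nu U U' w :
  Cmod (drift nu U U' w) <= Rabs (kappa nu) * exp (- Re w) / 2 *
    (Cmod (subdominant U U' w) + Cmod (amp (- Ci) U U' w)).
Proof.
unfold drift, Cdiv; rewrite !Cmod_mult, Cmod_Ci, Cmod_R, <- Cexp_opp, Cmod_Cexp.
rewrite Cmod_inv, Cmod_R, (Rabs_pos_eq 2) by (try apply C2_nz; lra).
eapply Rle_trans; [apply Rmult_le_compat_l; [|apply Cmod_triangle]|].
- generalize (Rabs_pos (kappa nu)) (exp_pos (Re (- w)%C)); nra.
- right; change (Re (- w)%C) with (- Re w); field.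
Qed.

(** The path goes along the positive axis to e^r, then along the quarter circle to i e^r. On the arc
    the coupling has size |kappa| e^(-r) and the pair stays bounded independently of r, so B changes
    only by O(e^(-r)). *)
Lemma quadrant_connection nu U U' : bessel_sol nu U U' ->
  exists M, forall r, 0 <= r ->
    Cmod (amp (- Ci) U U' (RtoC r + RtoC (PI / 2) * Ci) -
          amp (- Ci) U U' (RtoC r))%C <= M * exp (- r).
Proof.
intros H; set (B := amp (- Ci) U U'); set (A := subdominant U U').
set (k0 := Rabs (kappa nu)); assert (Hk0 : 0 <= k0) by apply Rabs_pos.
assert (Hpi := PI_RGT_0).
(* On the ray the coefficient 2 i zeta is purely imaginary, and |kappa| e^(-t) has total integral at
   most |kappa|: the bound does not depend on r. *)
assert (Hray : forall r, 0 <= r -> sqnorm2 (A (RtoC r)) (B (RtoC r)) <=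
  sqnorm2 (A (RtoC 0)) (B (RtoC 0)) * exp (2 * k0)).
{ intros r Hr.
  set (g := fun t : R => (RtoC 0 + RtoC t * RtoC 1)%C).
  assert (Hg : forall t, g t = RtoC t) by (intros t; unfold g; ring).
  assert (Hg' : forall t, rderiv g t (RtoC 1)) by (intros t; apply rderiv_affine).
  rewrite <- !Hg; eapply Rle_trans.
  - apply (gronwall_forward (fun t => A (g t)) (fun t => B (g t))
      (fun t => - drift nu U U' (g t))%C
      (fun t => drift nu U U' (g t))
      (fun t => RtoC 2 * Ci * Cexp (g t))%C
      (fun t => - (k0 * exp (- t))) (fun t => k0 * exp (- t)) 0 r Hr).
    intros t Ht; assert (HRe : Re (g t) = t) by (rewrite Hg; reflexivity).
    refine (conj _ (conj _ (conj _ (conj _ (conj _ _))))).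
    + eapply rderiv_eq; [apply rderiv_comp; [eapply subdominant_deriv, H|apply Hg']|].
      unfold A, B; ring.
    + rewrite Hg, Cexp_R; simpl; right; ring.
    + eapply rderiv_eq; [apply rderiv_comp; [eapply dominant_deriv, H|apply Hg']|].
      unfold A, B; ring.
    + auto_derive; trivial; ring.
    + rewrite Cmod_opp; eapply Rle_trans; [apply Cmod_drift|].
      rewrite HRe; apply Rle_refl.
    + eapply Rle_trans; [apply Cmod_drift|]; rewrite HRe; apply Rle_refl.
  - apply Rmult_le_compat_l; [apply sqnorm2_ge0|apply exp_le].
    rewrite Ropp_0, exp_0; generalize (exp_pos (- r)); nra. }
set (N := sqnorm2 (A (RtoC 0)) (B (RtoC 0)) * exp (2 * k0) *
  exp (2 * (k0 * (PI / 2)))).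
assert (HN : 0 <= N).
{ apply Rmult_le_pos; [apply Rmult_le_pos; [apply sqnorm2_ge0|]|];
    apply Rlt_le, exp_pos. }
assert (Hd : forall r t, 0 <= r -> 0 <= t <= PI / 2 ->
  rderiv (fun t => B (RtoC r + RtoC t * Ci)%C) t
    (drift nu U U' (RtoC r + RtoC t * Ci) * Ci)%C).
{ intros r t Hr Ht; apply rderiv_comp; [eapply dominant_deriv, H|apply rderiv_affine]. }
assert (HRe : forall r t, Re (RtoC r + RtoC t * Ci)%C = r) by (intros; simpl; ring).
assert (Harc : forall r t, 0 <= r -> 0 <= t <= PI / 2 ->
  sqnorm2 (A (RtoC r + RtoC t * Ci)%C) (B (RtoC r + RtoC t * Ci)%C) <= N).
{ intros r t Hr Ht.
  assert (Hr1 : exp (- r) <= 1) by (rewrite <- exp_0; apply exp_le; lra).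
  assert (Hr0 := exp_pos (- r)).
  eapply Rle_trans.
  - apply (gronwall_forward
      (fun t => A (RtoC r + RtoC t * Ci)%C) (fun t => B (RtoC r + RtoC t * Ci)%C)
      (fun t => - drift nu U U' (RtoC r + RtoC t * Ci) * Ci)%C
      (fun t => drift nu U U' (RtoC r + RtoC t * Ci) * Ci)%C
      (fun t => RtoC 2 * Ci * Cexp (RtoC r + RtoC t * Ci) * Ci)%C
      (fun t => k0 * exp (- r) * t) (fun _ => k0 * exp (- r)) 0 t (proj1 Ht)).
    intros u Hu.
    refine (conj _ (conj _ (conj _ (conj _ (conj _ _))))).
    + eapply rderiv_eq;
        [apply rderiv_comp; [eapply subdominant_deriv, H|apply rderiv_affine]|].
      unfold A, B; ring.
    (* Along the arc dw = i dt, so the coefficient is 2 i zeta i = -2 zeta, whose real part is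
       nonpositive up to the imaginary axis. *)
    + rewrite Cexp_polar, cis_eq.
      replace (RtoC 2 * Ci * (RtoC (exp r) * (cos u, sin u)) * Ci)%C with
        (RtoC (- (2 * exp r)) * (cos u, sin u))%C by (apply C_ext; simpl; ring).
      rewrite re_scal_l; simpl.
      assert (0 <= cos u) by (apply cos_ge_0; lra).
      generalize (exp_pos r); nra.
    + apply Hd; lra.
    + auto_derive; trivial; ring.
    + rewrite Cmod_mult, Cmod_opp, Cmod_Ci, Rmult_1_r.
      eapply Rle_trans; [apply Cmod_drift|]; rewrite HRe; apply Rle_refl.
    + rewrite Cmod_mult, Cmod_Ci, Rmult_1_r.
      eapply Rle_trans; [apply Cmod_drift|]; rewrite HRe; apply Rle_refl.
  - cbv beta; replace (RtoC r + RtoC 0 * Ci)%C with (RtoC r) by ring.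
    unfold N; apply Rmult_le_compat.
    + apply sqnorm2_ge0.
    + apply Rlt_le, exp_pos.
    + apply Hray, Hr.
    + apply exp_le; apply Rmult_le_compat_l; [lra|].
      apply Rle_trans with (k0 * exp (- r) * t); [right; ring|].
      rewrite Rmult_assoc; apply Rmult_le_compat_l; [exact Hk0|nra]. }
exists (PI / 2 * (k0 * (N + 1))); intros r Hr.
assert (Hr0 := exp_pos (- r)).
assert (HI := Cmod_increment_le (fun t => B (RtoC r + RtoC t * Ci)%C)
  _ (fun t => k0 * exp (- r) * (N + 1) * t) (fun _ => k0 * exp (- r) * (N + 1))
  0 (PI / 2) ltac:(lra) (fun t Ht => Hd r t Hr Ht)).
cbv beta in HI; replace (RtoC r + RtoC 0 * Ci)%C with (RtoC r) in HI by ring.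
eapply Rle_trans; [apply HI|right; ring].
- intros t _; auto_derive; trivial; ring.
- intros t Ht; rewrite Cmod_mult, Cmod_Ci, Rmult_1_r.
  eapply Rle_trans; [apply Cmod_drift|]; rewrite HRe; fold k0.
  specialize (Harc r t Hr Ht).
  set (a := A (RtoC r + RtoC t * Ci)%C) in *.
  set (b := B (RtoC r + RtoC t * Ci)%C) in *.
  assert (Hs := Cmod_sum_sq_le a b).
  assert (Hab : Cmod a + Cmod b <= 2 * (N + 1)).
  { apply Rsqr_incr_0_var; [rewrite !Rsqr_pow2|lra].
    apply Rle_trans with (2 * N); [lra|nra]. }
  apply Rle_trans with (k0 * exp (- r) / 2 * (2 * (N + 1))); [|right; field].
  apply Rmult_le_compat_l; [nra|exact Hab].
Qed.

(** * Limits of the amplitudes *)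

Definition ctends (f : R -> C) (l : C) : Prop :=
  forall eps, 0 < eps -> exists r0, forall r, r0 < r -> Cmod (f r - l)%C < eps.

Lemma ctends_ext f g l : (forall r, f r = g r) -> ctends f l -> ctends g l.
Proof.
intros E H eps He; destruct (H eps He) as [r0 H0]; exists r0; intros r Hr.
rewrite <- E; apply H0, Hr.
Qed.

Lemma ctends_plus f g l m : ctends f l -> ctends g m ->
  ctends (fun r => f r + g r)%C (l + m)%C.
Proof.
intros Hf Hg eps He; destruct (Hf (eps / 2) ltac:(lra)) as [r1 H1].
destruct (Hg (eps / 2) ltac:(lra)) as [r2 H2].
exists (Rmax r1 r2); intros r Hr.
specialize (H1 r (Rle_lt_trans _ _ _ (Rmax_l _ _) Hr)).
specialize (H2 r (Rle_lt_trans _ _ _ (Rmax_r _ _) Hr)).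
replace (f r + g r - (l + m))%C with ((f r - l) + (g r - m))%C by ring.
eapply Rle_lt_trans; [apply Cmod_triangle|lra].
Qed.

Lemma ctends_scal c f l : ctends f l -> ctends (fun r => c * f r)%C (c * l)%C.
Proof.
intros Hf eps He; assert (Pc := Cmod_ge_0 c).
assert (Hq : 0 < eps / (Cmod c + 1)) by (apply Rdiv_lt_0_compat; lra).
destruct (Hf _ Hq) as [r1 H1]; exists r1; intros r Hr; specialize (H1 r Hr).
replace (c * f r - c * l)%C with (c * (f r - l))%C by ring.
rewrite Cmod_mult; assert (P := Cmod_ge_0 (f r - l)%C).
apply Rle_lt_trans with ((Cmod c + 1) * Cmod (f r - l)%C); [nra|].
apply Rlt_le_trans with ((Cmod c + 1) * (eps / (Cmod c + 1)));
  [apply Rmult_lt_compat_l; lra|right; field; lra].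
Qed.

Lemma ctends_RtoC f (l : R) : is_lim f p_infty l ->
  ctends (fun r => RtoC (f r)) (RtoC l).
Proof.
intros H eps He; apply is_lim_spec in H.
destruct (H (mkposreal eps He)) as [r0 H0]; exists r0; intros r Hr.
rewrite <- RtoC_minus, Cmod_R; apply H0, Hr.
Qed.

Lemma ctends_close f g l : ctends f l ->
  (forall eps, 0 < eps -> exists r0, forall r, r0 < r -> Cmod (g r - f r)%C < eps) ->
  ctends g l.
Proof.
intros Hf Hg; assert (Hd : ctends (fun r => g r - f r)%C (RtoC 0)).
{ intros eps He; destruct (Hg eps He) as [r0 H0]; exists r0; intros r Hr.
  replace (g r - f r - RtoC 0)%C with (g r - f r)%C by ring; apply H0, Hr. }
assert (HS := ctends_plus _ _ _ _ Hf Hd); rewrite Cplus_0_r in HS.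
eapply ctends_ext; [|exact HS]; intros r; cbv beta; ring.
Qed.

Lemma ctends_conj f l : ctends f l -> ctends (fun r => Cconj (f r)) (Cconj l).
Proof.
intros H eps He; destruct (H eps He) as [r0 H0]; exists r0; intros r Hr.
rewrite <- Cminus_conj, Cmod_conj; apply H0, Hr.
Qed.

Lemma ctends_exp_bound f M : (forall r, 0 <= r -> Cmod (f r) <= M * exp (- r)) ->
  ctends f (RtoC 0).
Proof.
intros H eps He.
assert (HL : is_lim (fun r => M * exp (- r)) p_infty 0).
{ replace (Finite 0) with (Finite (M * 0)) by (f_equal; ring).
  apply (is_lim_scal_l _ M _ 0), is_lim_exp_opp. }
apply is_lim_spec in HL; destruct (HL (mkposreal eps He)) as [r0 H0].
exists (Rmax 0 r0); intros r Hr.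
specialize (H0 r (Rle_lt_trans _ _ _ (Rmax_r _ _) Hr)); simpl in H0.
assert (Hr0 := Rle_lt_trans _ _ _ (Rmax_l _ _) Hr).
replace (f r - RtoC 0)%C with (f r) by ring.
eapply Rle_lt_trans; [apply H; lra|].
eapply Rle_lt_trans; [apply Rle_abs|]; rewrite Rminus_0_r in H0; exact H0.
Qed.

Lemma besselJ_sol nu : order_ok nu -> bessel_sol nu (besselJ nu) (besselJ' nu).
Proof.
intros H w; split; [apply besselJ_deriv, H|apply besselJ'_deriv, H].
Qed.

Lemma besselJ_opp_sol nu : order_ok (- nu) ->
  bessel_sol nu (besselJ (- nu)) (besselJ' (- nu)).
Proof.
intros H w; destruct (besselJ_sol (- nu) H w) as [E1 E2]; split; [exact E1|].
replace (nu * nu) with (- nu * - nu) by ring; exact E2.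
Qed.

Lemma CSeries_RtoC f : CSeries (fun m => RtoC (f m)) = RtoC (Series f).
Proof.
apply C_ext; simpl; [reflexivity|].
rewrite (Series_ext _ (fun _ => 0 * 0)) by (intros; ring).
rewrite Series_scal_l; ring.
Qed.

(** The factor i^(2m) cancels the alternating sign. The shift by ln 2 appears because [besselI]
    takes the logarithm of half the argument. *)
Lemma besselJ_imaginary nu r : order_ok nu ->
  besselJ nu (RtoC r + RtoC (PI / 2) * Ci)%C =
  (cis (nu * PI / 2) * RtoC (besselI nu (r - ln 2)))%C.
Proof.
intros H; rewrite besselJ_exps; unfold exps, besselI.
rewrite <- CSeries_RtoC, <- CSeries_scal.
- apply CSeries_ext; intros m; unfold exps_term, half_shift.
  replace (RtoC (2 * INR m + nu) * (RtoC r + RtoC (PI / 2) * Ci - RtoC (ln 2)))%C with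
    (RtoC ((2 * INR m + nu) * (r - ln 2)) +
     RtoC (INR m * PI + nu * PI / 2) * Ci)%C.
  + rewrite Cexp_polar, cis_plus, cis_mult_PI.
    unfold bessel_coef, besselI_term, Rdiv.
    rewrite !RtoC_mult.
    set (g := RtoC (/ (INR (fact m) * Gamma (INR m + nu + 1)))).
    set (e := RtoC (exp _)).
    transitivity (cis (nu * PI * / 2) * (e * g) * (RtoC ((-1) ^ m) * RtoC ((-1) ^ m)))%C;
      [ring|].
    rewrite <- RtoC_mult, <- Rpow_mult_distr.
    replace (-1 * -1) with 1 by ring; rewrite pow1; ring.
  + replace (INR m * PI + nu * PI / 2) with ((2 * INR m + nu) * (PI / 2)) by field.
    rewrite !RtoC_mult, RtoC_minus; ring.
- apply summable_le with
    (fun m => exp (nu * (r - ln 2)) *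
      (Rabs (bessel_coef nu m) * exp (2 * (r - ln 2)) ^ m)).
  + intros m; rewrite Cmod_R, besselI_term_abs; apply Rle_refl.
  + apply ex_series_Rscal, entire_bessel_coef; [exact H|apply Rlt_le, exp_pos].
Qed.

Lemma exp_PI4_sqr : (cis (PI / 4) * cis (PI / 4))%C = Ci.
Proof. rewrite <- cis_plus, <- cis_PI2; f_equal; field. Qed.

Lemma growth_norm_shift r :
  growth_norm (r - ln 2) = sqrt (2 * PI) * (exp (r / 2) * exp (- exp r)).
Proof.
unfold growth_norm.
assert (H2 : exp (ln 2 / 2) = sqrt 2).
{ rewrite <- Rpower_sqrt by lra; unfold Rpower; f_equal; field. }
assert (Hs : 0 < sqrt 2) by (apply sqrt_lt_R0; lra).
replace ((r - ln 2) / 2 - 2 * exp (r - ln 2)) with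
  (r / 2 + - (ln 2 / 2) + - exp r).
- rewrite !exp_plus, (exp_Ropp (ln 2 / 2)), H2.
  rewrite sqrt_mult by (generalize PI_RGT_0; lra).
  assert (E : sqrt 2 * sqrt 2 = 2) by (apply sqrt_sqrt; lra).
  rewrite <- E at 1; field; lra.
- replace (exp (r - ln 2)) with (exp r / 2); [field|].
  unfold Rminus; rewrite exp_plus, exp_Ropp, exp_ln by lra; reflexivity.
Qed.

(** At zeta = i e^r the amplitude B is e^(i zeta) (y + i y') / 2, and e^(i zeta) = e^(-e^r) is
    exactly the decay contained in [growth_norm]. The last summand vanishes in the limit, the first
    two tend to 1 each. *)
Lemma besselJ_dominant_imaginary nu r : order_ok nu ->
  amp (- Ci) (besselJ nu) (besselJ' nu) (RtoC r + RtoC (PI / 2) * Ci)%C =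
  (cis (nu * PI / 2 + PI / 4) * RtoC (/ (2 * sqrt (2 * PI)) *
    (besselI nu (r - ln 2) * growth_norm (r - ln 2) +
     besselI (nu + 1) (r - ln 2) * growth_norm (r - ln 2) +
     (nu + 1 / 2) / 2 * exp (- (r - ln 2)) *
       (besselI nu (r - ln 2) * growth_norm (r - ln 2)))))%C.
Proof.
intros H; unfold amp, Liouville, Liouville'.
rewrite (besselJ'_eq nu _ H), !besselJ_imaginary; [|apply nonpole_S|]; try exact H.
rewrite growth_norm_shift.
set (I0 := besselI nu (r - ln 2)); set (I1 := besselI (nu + 1) (r - ln 2)).
replace ((nu + 1) * PI / 2) with (nu * PI / 2 + PI / 2) by field.
rewrite !cis_plus, cis_PI2.
rewrite (Cexp_opp ((RtoC r + RtoC (PI / 2) * Ci) / 2)).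
assert (Ew : Cexp (RtoC r + RtoC (PI / 2) * Ci) = (RtoC (exp r) * Ci)%C)
  by (rewrite Cexp_polar, cis_PI2; reflexivity).
assert (Eh : Cexp ((RtoC r + RtoC (PI / 2) * Ci) / 2) =
  (RtoC (exp (r / 2)) * cis (PI / 4))%C).
{ rewrite <- Cexp_polar; f_equal; rewrite !RtoC_div by lra.
  field; split; intros E; apply RtoC_inj in E; lra. }
rewrite Ew, Eh.
replace (- (- Ci * (RtoC (exp r) * Ci)))%C with (RtoC (- exp r))
  by (rewrite RtoC_opp; transitivity ((Ci * Ci) * RtoC (exp r))%C;
      [rewrite Ci_sqr; ring|ring]).
rewrite Cexp_R.
set (p := cis (nu * PI / 2)); set (q := cis (PI / 4)).
assert (Hq : (q * q)%C = Ci) by apply exp_PI4_sqr.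
assert (Hqn : q <> RtoC 0).
{ intros E; rewrite E, Cmult_0_l in Hq; apply Ci_nz; symmetry; exact Hq. }
set (h := exp (r / 2)).
assert (Hh : 0 < h) by apply exp_pos.
assert (Hh2 : exp r = h * h).
{ unfold h; rewrite <- exp_plus; f_equal; field. }
assert (Hx : exp (- (r - ln 2)) = 2 / (h * h)).
{ replace (- (r - ln 2)) with (ln 2 + - r) by ring.
  rewrite exp_plus, exp_ln, exp_Ropp, Hh2 by lra; reflexivity. }
rewrite Hx, Hh2; set (E := exp (- (h * h))).
assert (Hs : 0 < sqrt (2 * PI)) by (apply sqrt_lt_R0; generalize PI_RGT_0; lra).
replace (/ (2 * sqrt (2 * PI)) * (I0 * (sqrt (2 * PI) * (h * E)) +
  I1 * (sqrt (2 * PI) * (h * E)) + (nu + 1 / 2) / 2 * (2 / (h * h)) *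
  (I0 * (sqrt (2 * PI) * (h * E))))) with
  (E / 2 * (h * (I0 + I1) + (nu + 1 / 2) / h * I0)) by (field; lra).
assert (Hhn : RtoC h <> RtoC 0) by (intros Eh0; apply RtoC_inj in Eh0; lra).
repeat (rewrite RtoC_mult || rewrite RtoC_plus || rewrite RtoC_div by lra).
transitivity (p * RtoC E / 2 * (RtoC h * q * RtoC I0 +
  - (Ci * Ci) * Ci / q * RtoC h * RtoC I1 +
  Ci / (RtoC h * q) * (RtoC nu + 1 / 2) * RtoC I0))%C.
- field; repeat split; try assumption; apply C2_nz.
- rewrite Ci_sqr, <- Hq; field; repeat split; try assumption; apply C2_nz.
Qed.

Lemma besselJ_dominant_limit nu : order_ok nu ->
  ctends (fun r => amp (- Ci) (besselJ nu) (besselJ' nu) (RtoC r))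
    (RtoC (/ sqrt (2 * PI)) * cis (nu * PI / 2 + PI / 4))%C.
Proof.
intros H.
assert (Hs : 0 < sqrt (2 * PI)) by (apply sqrt_lt_R0; generalize PI_RGT_0; lra).
assert (Hshift : forall f (l : R), is_lim f p_infty l ->
  is_lim (fun r => f (r - ln 2)) p_infty l).
{ intros f l Hf; apply (is_lim_comp f (fun r => r - ln 2) p_infty l p_infty);
    [exact Hf| |exists 0; intros; discriminate].
  eapply is_lim_minus; [apply is_lim_id|apply is_lim_const|reflexivity]. }
assert (G0 := besselI_growth nu H).
assert (G1 := besselI_growth (nu + 1) (nonpole_S _ H)).
assert (G2 := I_growth_small ((nu + 1 / 2) / 2) nu G0).
assert (HL := is_lim_scal_l _ (/ (2 * sqrt (2 * PI))) _ _
  (is_lim_plus' _ _ _ _ _ (is_lim_plus' _ _ _ _ _ (Hshift _ _ G0) (Hshift _ _ G1))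
    (Hshift _ _ G2))).
cbv beta in HL.
replace (Rbar_mult (/ (2 * sqrt (2 * PI))) (1 + 1 + 0)) with
  (Finite (/ sqrt (2 * PI))) in HL by (simpl; f_equal; field; lra).
apply ctends_RtoC in HL.
assert (HI := ctends_scal (cis (nu * PI / 2 + PI / 4)) _ _ HL).
destruct (quadrant_connection nu _ _ (besselJ_sol nu H)) as [M HM].
assert (HD : ctends (fun r =>
  - (1) * (amp (- Ci) (besselJ nu) (besselJ' nu) (RtoC r + RtoC (PI / 2) * Ci) -
     amp (- Ci) (besselJ nu) (besselJ' nu) (RtoC r)))%C (- (1) * RtoC 0)%C)
  by (apply ctends_scal, (ctends_exp_bound _ M), HM).
assert (HS := ctends_plus _ _ _ _ HI HD).
replace (cis (nu * PI / 2 + PI / 4) * RtoC (/ sqrt (2 * PI)) + - (1) * RtoC 0)%C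
  with (RtoC (/ sqrt (2 * PI)) * cis (nu * PI / 2 + PI / 4))%C in HS by ring.
eapply ctends_ext; [|exact HS].
intros r; cbv beta; rewrite (besselJ_dominant_imaginary nu r H); ring.
Qed.

Lemma besselJ'_conj nu w : besselJ' nu (Cconj w) = Cconj (besselJ' nu w).
Proof.
unfold besselJ'; rewrite <- exps_conj; f_equal.
unfold half_shift; apply C_ext; simpl; ring.
Qed.

Lemma Cconj_half w : Cconj (w / 2) = (Cconj w / 2)%C.
Proof. rewrite Cdiv_conj by apply C2_nz; f_equal; apply C_ext; simpl; ring. Qed.

Lemma besselJ_amp_conj nu w :
  amp Ci (besselJ nu) (besselJ' nu) (Cconj w) =
  Cconj (amp (- Ci) (besselJ nu) (besselJ' nu) w).
Proof.
assert (Hi : Cconj (- Ci) = Ci) by (apply C_ext; simpl; ring).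
unfold amp, Liouville, Liouville'.
rewrite besselJ_conj, besselJ'_conj, Cmult_conj, <- !Cexp_conj, Cconj_half,
  Cminus_conj, !Cmult_conj, Cplus_conj, !Copp_conj, Cmult_conj, Hi, <- !Cexp_conj,
  Copp_conj, !Cconj_half.
replace (- Cconj Ci)%C with Ci by (apply C_ext; simpl; ring).
reflexivity.
Qed.

Lemma besselJ_subdominant_limit nu : order_ok nu ->
  ctends (fun r => amp Ci (besselJ nu) (besselJ' nu) (RtoC r))
    (RtoC (/ sqrt (2 * PI)) * cis (- (nu * PI / 2 + PI / 4)))%C.
Proof.
intros H; assert (HL := ctends_conj _ _ (besselJ_dominant_limit nu H)).
rewrite Cmult_conj, cis_conj in HL.
replace (Cconj (RtoC (/ sqrt (2 * PI)))) with (RtoC (/ sqrt (2 * PI))) in HL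
  by (apply C_ext; simpl; ring).
eapply ctends_ext; [|exact HL].
intros r; cbv beta; rewrite <- besselJ_amp_conj; f_equal; apply C_ext; simpl; ring.
Qed.

(** * Asymptotics along horizontal lines *)

Lemma bessel_sol_lin nu U U' V V' (c d : C) :
  bessel_sol nu U U' -> bessel_sol nu V V' ->
  bessel_sol nu (fun w => c * U w + d * V w)%C (fun w => c * U' w + d * V' w)%C.
Proof.
intros HU HV w; destruct (HU w) as [U1 U2]; destruct (HV w) as [V1 V2]; split.
- apply cderiv_plus; apply cderiv_scal; assumption.
- eapply cderiv_eq; [apply cderiv_plus; apply cderiv_scal; eassumption|ring].
Qed.

Lemma amp_lin tau U U' V V' (c d : C) w :
  amp tau (fun w => c * U w + d * V w)%C (fun w => c * U' w + d * V' w)%C w =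
  (c * amp tau U U' w + d * amp tau V V' w)%C.
Proof. unfold amp, Liouville, Liouville'; field; apply C2_nz. Qed.

(* The point [ln (t + i b)], for [t > 0]. *)
Definition log_rect (t b : R) : C := (ln (t ^ 2 + b ^ 2) / 2, atan (b / t)).

Lemma Cexp_log_rect t b : 0 < t -> Cexp (log_rect t b) = (t, b).
Proof.
intros Ht; unfold Cexp, log_rect; cbn [Re Im fst snd].
assert (Hp : 0 < t ^ 2 + b ^ 2) by nra.
assert (Hq : 0 < 1 + (b / t) ^ 2) by (generalize (pow2_ge_0 (b / t)); lra).
replace (exp (ln (t ^ 2 + b ^ 2) / 2)) with (t * sqrt (1 + (b / t) ^ 2)).
- assert (Hs := sqrt_lt_R0 _ Hq).
  rewrite cos_atan, sin_atan; unfold Rsqr.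
  replace (b / t * (b / t)) with ((b / t) ^ 2) by ring.
  set (r := sqrt (1 + (b / t) ^ 2)) in *; f_equal; field; repeat split; lra.
- replace (ln (t ^ 2 + b ^ 2) / 2) with (/ 2 * ln (t ^ 2 + b ^ 2)) by field.
  change (exp (/ 2 * ln (t ^ 2 + b ^ 2))) with (Rpower (t ^ 2 + b ^ 2) (/ 2)).
  rewrite Rpower_sqrt by exact Hp.
  replace (t ^ 2 + b ^ 2) with (t ^ 2 * (1 + (b / t) ^ 2)) by (field; lra).
  rewrite sqrt_mult, sqrt_pow2 by (try apply pow2_ge_0; lra); reflexivity.
Qed.

Lemma log_rect_Cexp w : Rabs (Im w) < PI / 2 ->
  log_rect (exp (Re w) * cos (Im w)) (exp (Re w) * sin (Im w)) = w.
Proof.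
intros Hw; apply Rabs_lt_between in Hw; unfold log_rect.
assert (Hc : 0 < cos (Im w)) by (apply cos_gt_0; lra).
assert (He := exp_pos (Re w)).
apply C_ext; cbn [Re Im fst snd].
- replace ((exp (Re w) * cos (Im w)) ^ 2 + (exp (Re w) * sin (Im w)) ^ 2) with
    (exp (Re w) * exp (Re w)).
  + rewrite <- exp_plus, ln_exp; field.
  + assert (H := sin2_cos2 (Im w)); unfold Rsqr in H.
    transitivity (exp (Re w) * exp (Re w) *
      (sin (Im w) * sin (Im w) + cos (Im w) * cos (Im w))); [rewrite H; ring|ring].
- replace (exp (Re w) * sin (Im w) / (exp (Re w) * cos (Im w))) with (tan (Im w))
    by (unfold tan; field; split; lra).
  apply atan_tan; lra.
Qed.

Lemma rderiv_log_rect_h t b : 0 < t ->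
  rderiv (fun s => log_rect s b) t (/ (t, b))%C.
Proof.
intros Ht; assert (Hp : 0 < t ^ 2 + b ^ 2) by nra.
apply rderiv_of_Re_Im; simpl.
- auto_derive; [simpl in *; lra|simpl in *; field; lra].
- auto_derive; [lra|simpl in *; field; split; [lra|]].
  intros E; assert (0 <= b * (b * 1)) by nra; nra.
Qed.

Lemma rderiv_log_rect_v t b : 0 < t ->
  rderiv (fun s => log_rect t s) b (Ci / (t, b))%C.
Proof.
intros Ht; assert (Hp : 0 < t ^ 2 + b ^ 2) by nra.
apply rderiv_of_Re_Im; simpl.
- auto_derive; [simpl in *; lra|simpl in *; field; lra].
- auto_derive; [lra|simpl in *; field; split; [lra|]].
  intros E; assert (0 <= b * (b * 1)) by nra; nra.
Qed.

Lemma Cmod_rect_ge t b : 0 < t -> t <= Cmod (t, b).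
Proof.
intros Ht; generalize (Re_le_Cmod (t, b)); simpl Re; rewrite Rabs_pos_eq; lra.
Qed.

Lemma rect_ne0 t b : 0 < t -> (t, b) <> RtoC 0.
Proof. intros Ht H; apply (f_equal Re) in H; simpl in H; lra. Qed.

(** Here e is the direction of travel, 1 or i, and e / zeta is the velocity of w = ln zeta. The
    weight e^(2b) = |e^(-2 i zeta)| on B depends on the height alone; the same weight makes the
    bound for B identical. *)
Lemma amp_plus_deriv_bound nu U U' t b (e : C) : 0 < t ->
  Cmod e = 1 ->
  Cmod (amp' nu Ci U (log_rect t b) * (e / (t, b)))%C <=
  Rabs (kappa nu) / t ^ 2 / 2 * (Cmod (amp Ci U U' (log_rect t b)) +
    exp (2 * b) * Cmod (amp (- Ci) U U' (log_rect t b))).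
Proof.
intros Ht He; unfold amp'.
rewrite Liouville_amp with (U' := U'), !Cexp_log_rect by exact Ht.
set (A := amp Ci U U' _); set (B := amp (- Ci) U U' _).
replace (Cexp (- (Ci * (t, b))) *
  (A * Cexp (Ci * (t, b)) + B * Cexp (- (Ci * (t, b)))))%C with
  (A + Cexp (- (Ci * (t, b)) + - (Ci * (t, b))) * B)%C.
- unfold Cdiv; rewrite !Cmod_mult, He, Cmod_opp, !Cmod_mult, Cmod_Ci, Cmod_R,
    !Cmod_inv, Cmod_R, (Rabs_pos_eq 2) by
    (try apply rect_ne0; try apply C2_nz; lra).
  assert (HT : Cmod (A + Cexp (- (Ci * (t, b)) + - (Ci * (t, b))) * B)%C <=
    Cmod A + exp (2 * b) * Cmod B).
  { eapply Rle_trans; [apply Cmod_triangle|]; apply Rplus_le_compat_l.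
    rewrite Cmod_mult, Cmod_Cexp; right; f_equal; f_equal; simpl; ring. }
  assert (Hz := Cmod_rect_ge t b Ht).
  assert (Hi : / Cmod (t, b) * / Cmod (t, b) <= / t ^ 2).
  { rewrite <- Rinv_mult; apply Rinv_le_contravar; simpl; nra. }
  assert (Hk := Rabs_pos (kappa nu)).
  assert (Hi0 : 0 <= / Cmod (t, b) * / Cmod (t, b)).
  { apply Rmult_le_pos; apply Rlt_le, Rinv_0_lt_compat; lra. }
  set (S := Cmod A + exp (2 * b) * Cmod B) in *.
  assert (P := Cmod_ge_0 (A + Cexp (- (Ci * (t, b)) + - (Ci * (t, b))) * B)%C).
  set (T := Cmod (A + _)%C) in *.
  apply Rle_trans with (Rabs (kappa nu) / 2 * (T * (/ Cmod (t, b) * / Cmod (t, b))));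
    [right; unfold Rdiv; ring|].
  apply Rle_trans with (Rabs (kappa nu) / 2 * (S * / t ^ 2));
    [|right; unfold Rdiv; ring].
  apply Rmult_le_compat_l; [lra|]; apply Rmult_le_compat; assumption.
- rewrite Cexp_add, !(Cexp_opp (Ci * (t, b))); field; apply Cexp_ne0.
Qed.

Lemma amp_minus_deriv_bound nu U U' t b (e : C) : 0 < t ->
  Cmod e = 1 ->
  exp (2 * b) * Cmod (amp' nu (- Ci) U (log_rect t b) * (e / (t, b)))%C <=
  Rabs (kappa nu) / t ^ 2 / 2 * (Cmod (amp Ci U U' (log_rect t b)) +
    exp (2 * b) * Cmod (amp (- Ci) U U' (log_rect t b))).
Proof.
intros Ht He; eapply Rle_trans; [|exact (amp_plus_deriv_bound nu U U' t b e Ht He)].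
unfold amp'; rewrite Cexp_log_rect by exact Ht.
right; rewrite !Cmod_mult, !Cmod_opp; unfold Cdiv; rewrite !Cmod_mult, !Cmod_Cexp.
rewrite Cmod_opp.
replace (Re (- (- Ci * (t, b)))%C) with (- b) by (simpl; ring).
replace (Re (- (Ci * (t, b)))%C) with (2 * b + - b) by (simpl; ring).
rewrite exp_plus; ring.
Qed.

Lemma rderiv_amp_rect_h nu tau U U' t b : (tau * tau = - (1))%C ->
  bessel_sol nu U U' -> 0 < t ->
  rderiv (fun s => amp tau U U' (log_rect s b)) t
    (amp' nu tau U (log_rect t b) * (1 / (t, b)))%C.
Proof.
intros Ht H Hp; eapply rderiv_eq.
- apply (rderiv_comp (amp tau U U') (fun s => log_rect s b));
    [eapply amp_deriv; [exact Ht|exact H]|apply rderiv_log_rect_h, Hp].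
- f_equal; unfold Cdiv; ring.
Qed.

Lemma rderiv_amp_rect_v nu tau U U' t b : (tau * tau = - (1))%C ->
  bessel_sol nu U U' -> 0 < t ->
  rderiv (fun s => amp tau U U' (log_rect t s)) b
    (amp' nu tau U (log_rect t b) * (Ci / (t, b)))%C.
Proof.
intros Ht H Hp; apply (rderiv_comp (amp tau U U') (fun s => log_rect t s));
    [eapply amp_deriv; [exact Ht|exact H]|apply rderiv_log_rect_v, Hp].
Qed.

(** On a vertical segment the weight is not constant and is replaced by exp (2 beta). This is
    affordable because the height stays fixed while t tends to infinity, where D = O(1/t^2). *)
Lemma amp_vertical_bound nu U U' t b beta : bessel_sol nu U U' -> 0 < t ->
  Rabs b <= beta ->
  let D := Rabs (kappa nu) / t ^ 2 * exp (2 * beta) * beta in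
  let S := Cmod (amp Ci U U' (log_rect t 0)) +
           Cmod (amp (- Ci) U U' (log_rect t 0)) in
  Cmod (amp Ci U U' (log_rect t b) - amp Ci U U' (log_rect t 0))%C <=
    D * exp D * S /\
  Cmod (amp (- Ci) U U' (log_rect t b) - amp (- Ci) U U' (log_rect t 0))%C <=
    D * exp D * S.
Proof.
intros H Ht Hb D S; set (k := Rabs (kappa nu) / t ^ 2 * exp (2 * beta)).
assert (Hk1 : 0 <= Rabs (kappa nu) / t ^ 2).
{ apply Rmult_le_pos; [apply Rabs_pos|]; apply Rlt_le, Rinv_0_lt_compat; nra. }
assert (Hk : 0 <= k) by (apply Rmult_le_pos; [exact Hk1|apply Rlt_le, exp_pos]).
assert (Hcond : forall s, Rabs s <= beta ->
  rderiv (fun s => amp Ci U U' (log_rect t s)) s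
    (amp' nu Ci U (log_rect t s) * (Ci / (t, s)))%C /\
  rderiv (fun s => amp (- Ci) U U' (log_rect t s)) s
    (amp' nu (- Ci) U (log_rect t s) * (Ci / (t, s)))%C /\
  is_derive (fun s => k * s) s k /\ 0 <= k /\
  Cmod (amp' nu Ci U (log_rect t s) * (Ci / (t, s)))%C <=
    k / 2 * (Cmod (amp Ci U U' (log_rect t s)) +
      Cmod (amp (- Ci) U U' (log_rect t s))) /\
  Cmod (amp' nu (- Ci) U (log_rect t s) * (Ci / (t, s)))%C <=
    k / 2 * (Cmod (amp Ci U U' (log_rect t s)) +
      Cmod (amp (- Ci) U U' (log_rect t s)))).
{ intros s Hs; apply Rabs_le_between in Hs.
  assert (B1 := amp_plus_deriv_bound nu U U' t s Ci Ht Cmod_Ci).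
  assert (B2 := amp_minus_deriv_bound nu U U' t s Ci Ht Cmod_Ci).
  set (a := Cmod (amp Ci U U' (log_rect t s))) in *.
  set (b' := Cmod (amp (- Ci) U U' (log_rect t s))) in *.
  assert (Pa : 0 <= a) by apply Cmod_ge_0.
  assert (Pb : 0 <= b') by apply Cmod_ge_0.
  assert (E1 : exp (2 * s) <= exp (2 * beta)) by (apply exp_le; lra).
  assert (E0 : 1 <= exp (2 * beta)) by (rewrite <- exp_0; apply exp_le; lra).
  refine (conj _ (conj _ (conj _ (conj Hk (conj _ _))))).
  - apply rderiv_amp_rect_v; [apply Ci_sqr|exact H|exact Ht].
  - apply rderiv_amp_rect_v; [apply opp_Ci_sqr|exact H|exact Ht].
  - auto_derive; trivial; ring.
  - eapply Rle_trans; [exact B1|]; unfold k.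
    replace (Rabs (kappa nu) / t ^ 2 * exp (2 * beta) / 2 * (a + b')) with
      (Rabs (kappa nu) / t ^ 2 / 2 * (exp (2 * beta) * a + exp (2 * beta) * b'))
      by (unfold Rdiv; ring).
    apply Rmult_le_compat_l; [lra|]; nra.
  - assert (E2 := exp_pos (2 * s)).
    set (X := Cmod (amp' _ (- Ci) _ _ * _)%C) in *.
    assert (E3 : exp (- (2 * s)) * exp (2 * s) = 1)
      by (rewrite <- exp_plus, Rplus_opp_l; apply exp_0).
    assert (E4 : exp (- (2 * s)) <= exp (2 * beta)) by (apply exp_le; lra).
    assert (E5 := exp_pos (- (2 * s))).
    replace X with (exp (- (2 * s)) * (exp (2 * s) * X))
      by (rewrite <- Rmult_assoc, E3; ring).
    apply Rle_trans with (exp (- (2 * s)) *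
      (Rabs (kappa nu) / t ^ 2 / 2 * (a + exp (2 * s) * b'))).
    + apply Rmult_le_compat_l; lra.
    + replace (exp (- (2 * s)) *
      (Rabs (kappa nu) / t ^ 2 / 2 * (a + exp (2 * s) * b'))) with
      (Rabs (kappa nu) / t ^ 2 / 2 *
        (exp (- (2 * s)) * a + (exp (- (2 * s)) * exp (2 * s)) * b')) by ring.
      rewrite E3; unfold k.
      replace (Rabs (kappa nu) / t ^ 2 * exp (2 * beta) / 2 * (a + b')) with
      (Rabs (kappa nu) / t ^ 2 / 2 * (exp (2 * beta) * a + exp (2 * beta) * b'))
      by (unfold Rdiv; ring).
      apply Rmult_le_compat_l; [lra|]; nra. }
assert (HS : 0 <= S).
{ unfold S; generalize (Cmod_ge_0 (amp Ci U U' (log_rect t 0)))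
    (Cmod_ge_0 (amp (- Ci) U U' (log_rect t 0))); lra. }
assert (Hfin : forall d, 0 <= d <= D -> d * exp d * S <= D * exp D * S).
{ intros d Hd; apply Rmult_le_compat_r; [exact HS|].
  apply Rmult_le_compat; [lra|apply Rlt_le, exp_pos|lra|apply exp_le; lra]. }
assert (Hb0 := Rabs_pos b).
destruct (Rle_lt_dec 0 b) as [H0|H0].
- rewrite Rabs_pos_eq in Hb by exact H0.
  destruct (gronwall_increment _ _ _ _ (fun s => k * s) (fun _ => k) 0 b H0
    (fun s Hs => Hcond s ltac:(apply Rabs_le; lra)) 0 (or_introl eq_refl))
    as [G1 G2].
  split; (eapply Rle_trans; [eassumption|]); apply Hfin;
    (split; [nra|unfold D; fold k; nra]).
- rewrite Rabs_left in Hb by exact H0.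
  destruct (gronwall_increment _ _ _ _ (fun s => k * s) (fun _ => k) b 0 (Rlt_le _ _ H0)
    (fun s Hs => Hcond s ltac:(apply Rabs_le; lra)) 0 (or_intror eq_refl))
    as [G1 G2].
  rewrite <- (Cmod_opp (amp Ci U U' (log_rect t b) - _)),
    <- (Cmod_opp (amp (- Ci) U U' (log_rect t b) - _)), !Copp_minus_distr.
  split; (eapply Rle_trans; [eassumption|]); apply Hfin;
    (split; [nra|unfold D; fold k; nra]).
Qed.

Lemma log_rect_real t : 0 < t -> log_rect t 0 = RtoC (ln t).
Proof.
intros Ht; apply C_ext; simpl.
- replace (t * (t * 1) + 0 * (0 * 1)) with (t * t) by ring.
  rewrite ln_mult by exact Ht; field.
- unfold Rdiv; rewrite Rmult_0_l; apply atan_0.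
Qed.

Lemma ctends_ln f l : ctends f l -> ctends (fun t => f (ln t)) l.
Proof.
intros H eps He; destruct (H eps He) as [r0 H0]; exists (exp r0); intros t Ht.
apply H0; rewrite <- (ln_exp r0); apply ln_increasing; [apply exp_pos|exact Ht].
Qed.

Lemma amp_horizontal_limit nu U U' l m b : bessel_sol nu U U' ->
  ctends (fun r => amp Ci U U' (RtoC r)) l ->
  ctends (fun r => amp (- Ci) U U' (RtoC r)) m ->
  ctends (fun t => amp Ci U U' (log_rect t b)) l /\
  ctends (fun t => amp (- Ci) U U' (log_rect t b)) m.
Proof.
intros H HA HB; apply ctends_ln in HA; apply ctends_ln in HB.
set (K0 := Rabs (kappa nu) * exp (2 * Rabs b) * Rabs b).
assert (HK0 : 0 <= K0).
{ repeat apply Rmult_le_pos; try apply Rabs_pos; apply Rlt_le, exp_pos. }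
set (S0 := Cmod l + Cmod m + 2).
assert (HS0 : 0 < S0) by (unfold S0; generalize (Cmod_ge_0 l) (Cmod_ge_0 m); lra).
assert (Hsmall : forall eps, 0 < eps -> exists t0, forall t, t0 < t ->
  0 < t /\
  Cmod (amp Ci U U' (log_rect t b) - amp Ci U U' (RtoC (ln t)))%C < eps /\
  Cmod (amp (- Ci) U U' (log_rect t b) - amp (- Ci) U U' (RtoC (ln t)))%C < eps).
{ intros eps He.
  destruct (HA 1 ltac:(lra)) as [t1 H1]; destruct (HB 1 ltac:(lra)) as [t2 H2].
  (* For t >= 1 one has D <= K0 and D t <= K0, so D e^D S <= K0 e^K0 S0 / t, which is below eps once
     t exceeds this value. *)
  set (t3 := K0 * exp K0 * S0 / eps).
  exists (Rmax (Rmax t1 t2) (Rmax 1 t3)); intros t Ht.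
  assert (Ht12 := Rle_lt_trans _ _ _ (Rmax_l _ _) Ht).
  assert (Ht34 := Rle_lt_trans _ _ _ (Rmax_r _ _) Ht).
  specialize (H1 t (Rle_lt_trans _ _ _ (Rmax_l _ _) Ht12)).
  specialize (H2 t (Rle_lt_trans _ _ _ (Rmax_r _ _) Ht12)).
  assert (Ht1 := Rle_lt_trans _ _ _ (Rmax_l _ _) Ht34).
  assert (Ht3 := Rle_lt_trans _ _ _ (Rmax_r _ _) Ht34).
  assert (Ht0 : 0 < t) by lra.
  destruct (amp_vertical_bound nu U U' t b (Rabs b) H Ht0 (Rle_refl _)) as [V1 V2].
  rewrite (log_rect_real t Ht0) in V1, V2.
  set (S := Cmod (amp Ci U U' (RtoC (ln t))) + Cmod (amp (- Ci) U U' (RtoC (ln t)))) in *.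
  assert (HS : S <= S0).
  { unfold S, S0.
    assert (T1 := Cmod_le_sub (amp Ci U U' (RtoC (ln t))) l).
    assert (T2 := Cmod_le_sub (amp (- Ci) U U' (RtoC (ln t))) m).
    lra. }
  set (D := Rabs (kappa nu) / t ^ 2 * exp (2 * Rabs b) * Rabs b) in *.
  assert (HD : D = K0 / t ^ 2) by (unfold D, K0, Rdiv; ring).
  assert (HD0 : 0 <= D).
  { rewrite HD; apply Rmult_le_pos; [exact HK0|].
    apply Rlt_le, Rinv_0_lt_compat; nra. }
  assert (HDt : D * t <= K0).
  { rewrite HD; replace (K0 / t ^ 2 * t) with (K0 * / t) by (field; lra).
    rewrite <- (Rmult_1_r K0) at 2; apply Rmult_le_compat_l; [exact HK0|].
    rewrite <- Rinv_1; apply Rinv_le_contravar; lra. }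
  assert (HDK : D <= K0) by nra.
  assert (Hfin : D * exp D * S < eps).
  { apply Rle_lt_trans with (D * exp K0 * S0).
    - assert (HS' : 0 <= S) by (unfold S;
        generalize (Cmod_ge_0 (amp Ci U U' (RtoC (ln t))))
          (Cmod_ge_0 (amp (- Ci) U U' (RtoC (ln t)))); lra).
      apply Rmult_le_compat; [|exact HS'| |exact HS].
      + apply Rmult_le_pos; [exact HD0|apply Rlt_le, exp_pos].
      + apply Rmult_le_compat_l; [exact HD0|apply exp_le, HDK].
    - apply Rmult_lt_reg_r with t; [exact Ht0|].
      apply Rle_lt_trans with (K0 * exp K0 * S0).
      + replace (D * exp K0 * S0 * t) with (D * t * (exp K0 * S0)) by ring.
        rewrite (Rmult_assoc K0); apply Rmult_le_compat_r; [|exact HDt].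
        apply Rmult_le_pos; [apply Rlt_le, exp_pos|lra].
      + replace (K0 * exp K0 * S0) with (eps * t3) by (unfold t3; field; lra).
        apply Rmult_lt_compat_l; assumption. }
  split; [exact Ht0|]; split; lra. }
split; [apply (ctends_close _ _ _ HA)|apply (ctends_close _ _ _ HB)];
  intros eps He; destruct (Hsmall eps He) as [t0 H0];
  exists t0; intros t Ht; apply H0, Ht.
Qed.

(* Moving horizontally to infinity keeps [|e^(-2 i zeta)| = e^(2b)] fixed, so the
   recessive amplitude stays controlled on either side of the real axis. *)
Lemma recessive_bound nu U U' l t b : bessel_sol nu U U' ->
  ctends (fun r => amp Ci U U' (RtoC r)) l ->
  ctends (fun r => amp (- Ci) U U' (RtoC r)) (RtoC 0) ->
  0 < t ->
  let D := Rabs (kappa nu) / t in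
  Cmod (Liouville U (log_rect t b) * Cexp (- (Ci * (t, b))) - l)%C <=
    2 * (D * exp D * Cmod l).
Proof.
intros H HA HB Ht D.
destruct (amp_horizontal_limit nu U U' l (RtoC 0) b H HA HB) as [LA LB].
set (f := fun s => amp Ci U U' (log_rect s b)) in *.
set (g := fun s => (RtoC (exp (2 * b)) * amp (- Ci) U U' (log_rect s b))%C).
assert (LG : ctends g (RtoC 0)).
{ assert (HG := ctends_scal (RtoC (exp (2 * b))) _ _ LB).
  rewrite Cmult_0_r in HG; exact HG. }
assert (HD : 0 <= D).
{ apply Rmult_le_pos; [apply Rabs_pos|apply Rlt_le, Rinv_0_lt_compat, Ht]. }
assert (HDe : 0 <= D * exp D) by (apply Rmult_le_pos; [exact HD|apply Rlt_le, exp_pos]).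
assert (Hinc : forall s, t <= s ->
  Cmod (f s - f t)%C <= D * exp D * (Cmod (f s) + Cmod (g s)) /\
  Cmod (g s - g t)%C <= D * exp D * (Cmod (f s) + Cmod (g s))).
{ intros s Hs.
  assert (G := gronwall_increment f g
    (fun s => amp' nu Ci U (log_rect s b) * (1 / (s, b)))%C
    (fun s => RtoC (exp (2 * b)) *
     (amp' nu (- Ci) U (log_rect s b) * (1 / (s, b))))%C
    (fun s => - (Rabs (kappa nu) / s)) (fun s => Rabs (kappa nu) / s ^ 2) t s Hs).
  set (d := - (Rabs (kappa nu) / s) - - (Rabs (kappa nu) / t)) in G.
  assert (Hd : d <= D).
  { unfold d, D; assert (0 <= Rabs (kappa nu) / s); [|lra].
    apply Rmult_le_pos; [apply Rabs_pos|apply Rlt_le, Rinv_0_lt_compat; lra]. }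
  assert (Hd0 : 0 <= d).
  { unfold d; assert (Rabs (kappa nu) / s <= Rabs (kappa nu) / t); [|lra].
    apply Rmult_le_compat_l; [apply Rabs_pos|apply Rinv_le_contravar; lra]. }
  assert (Hdd : d * exp d * (Cmod (f s) + Cmod (g s)) <=
    D * exp D * (Cmod (f s) + Cmod (g s))).
  { apply Rmult_le_compat_r.
    - generalize (Cmod_ge_0 (f s)) (Cmod_ge_0 (g s)); lra.
    - apply Rmult_le_compat; [lra|apply Rlt_le, exp_pos|lra|apply exp_le, Hd]. }
  assert (HG : forall c, c = t \/ c = s ->
    Cmod (f s - f t)%C <= d * exp d * (Cmod (f c) + Cmod (g c)) /\
  Cmod (g s - g t)%C <= d * exp d * (Cmod (f c) + Cmod (g c))).
  { apply G; intros u Hu; assert (Hu0 : 0 < u) by lra.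
    assert (B1 := amp_plus_deriv_bound nu U U' u b 1 Hu0 Cmod_1).
    assert (B2 := amp_minus_deriv_bound nu U U' u b 1 Hu0 Cmod_1).
    assert (Eg : Cmod (g u) = exp (2 * b) * Cmod (amp (- Ci) U U' (log_rect u b))).
    { unfold g; rewrite Cmod_mult, Cmod_R, Rabs_pos_eq; [reflexivity|].
      apply Rlt_le, exp_pos. }
    rewrite Eg; refine (conj _ (conj _ (conj _ (conj _ (conj B1 _))))).
    - apply rderiv_amp_rect_h; [apply Ci_sqr|exact H|exact Hu0].
    - apply (rderiv_comp (fun z => RtoC (exp (2 * b)) * z)%C
        (fun s => amp (- Ci) U U' (log_rect s b)) u (RtoC (exp (2 * b)))).
      + eapply cderiv_eq; [apply cderiv_scal, cderiv_id|ring].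
      + apply rderiv_amp_rect_h; [apply opp_Ci_sqr|exact H|exact Hu0].
    - auto_derive; [lra|field; lra].
    - apply Rmult_le_pos; [apply Rabs_pos|apply Rlt_le, Rinv_0_lt_compat; nra].
    - rewrite Cmod_mult, Cmod_R, Rabs_pos_eq by apply Rlt_le, exp_pos.
      exact B2. }
  (* Gronwall is started from the far end s, where the amplitudes are already close to their limits
     l and 0. *)
  destruct (HG s (or_intror eq_refl)) as [G1 G2]; split; lra. }
assert (Hclose : forall eps, 0 < eps ->
  Cmod (f t - l)%C <= D * exp D * (Cmod l + 2 * eps) + eps /\
  Cmod (g t) <= D * exp D * (Cmod l + 2 * eps) + eps).
{ intros eps He; destruct (LA eps He) as [r1 H1]; destruct (LG eps He) as [r2 H2].
  set (s := Rmax t (Rmax r1 r2 + 1)).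
  assert (Hs : t <= s) by apply Rmax_l.
  assert (Hs' : Rmax r1 r2 < s) by (generalize (Rmax_r t (Rmax r1 r2 + 1)); unfold s; lra).
  specialize (H1 s (Rle_lt_trans _ _ _ (Rmax_l _ _) Hs')).
  specialize (H2 s (Rle_lt_trans _ _ _ (Rmax_r _ _) Hs')).
  cbv beta in H1; change (amp Ci U U' (log_rect s b)) with (f s) in H1.
  destruct (Hinc s Hs) as [I1 I2].
  replace (g s - RtoC 0)%C with (g s) in H2 by ring.
  assert (T1 := Cmod_le_sub (f s) l).
  assert (T2 := Cmod_minus_triangle (f s - l)%C (f s - f t)%C).
  replace (f s - l - (f s - f t))%C with (f t - l)%C in T2 by ring.
  assert (T3 := Cmod_minus_triangle (g s) (g s - g t)%C).
  replace (g s - (g s - g t))%C with (g t) in T3 by ring.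
  assert (HM : D * exp D * (Cmod (f s) + Cmod (g s)) <=
    D * exp D * (Cmod l + 2 * eps)) by (apply Rmult_le_compat_l; lra).
  split; lra. }
assert (HE : (Liouville U (log_rect t b) * Cexp (- (Ci * (t, b))) - l)%C =
  ((f t - l) + Cexp (- (Ci * (t, b)) + - (Ci * (t, b))) *
    amp (- Ci) U U' (log_rect t b))%C).
{ rewrite Liouville_amp with (U' := U'), Cexp_log_rect by exact Ht.
  unfold f; rewrite Cexp_add, !(Cexp_opp (Ci * (t, b))); field; apply Cexp_ne0. }
rewrite HE; clear HE.
assert (Hg : Cmod (Cexp (- (Ci * (t, b)) + - (Ci * (t, b))) *
    amp (- Ci) U U' (log_rect t b))%C = Cmod (g t)).
{ unfold g; rewrite !Cmod_mult, Cmod_Cexp, Cmod_R, Rabs_pos_eq by apply Rlt_le, exp_pos.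
  f_equal; f_equal; simpl; ring. }
eapply Rle_trans; [apply Cmod_triangle|]; rewrite Hg.
apply le_epsilon; intros eps He.
set (e := eps / (4 * (D * exp D) + 2)).
assert (He' : 0 < e) by (apply Rdiv_lt_0_compat; lra).
destruct (Hclose e He') as [C1 C2].
assert (Ee : e * (4 * (D * exp D) + 2) = eps) by (unfold e; field; lra).
nra.
Qed.

(** * The Hankel functions *)

Lemma hankel1_eq nu w : sin (nu * PI) <> 0 ->
  hankel1 nu w =
  (Ci * cis (- (nu * PI)) / RtoC (sin (nu * PI)) * besselJ nu w +
   - Ci / RtoC (sin (nu * PI)) * besselJ (- nu) w)%C.
Proof.
intros Hs; unfold hankel1, besselY; rewrite cis_eq, cos_neg, sin_neg.
assert (Hs' := RtoC_ne0 _ Hs).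
replace (cos (nu * PI), - sin (nu * PI)) with
  (RtoC (cos (nu * PI)) - Ci * RtoC (sin (nu * PI)))%C by (apply C_ext; simpl; ring).
transitivity ((- (Ci * Ci) * RtoC (sin (nu * PI)) +
  Ci * RtoC (cos (nu * PI))) / RtoC (sin (nu * PI)) * besselJ nu w +
  - Ci / RtoC (sin (nu * PI)) * besselJ (- nu) w)%C;
  [rewrite Ci_sqr|]; field; exact Hs'.
Qed.

Lemma hankel2_conj nu w : sin (nu * PI) <> 0 ->
  hankel2 nu (Cconj w) = Cconj (hankel1 nu w).
Proof.
intros Hs; assert (Hs' := RtoC_ne0 _ Hs).
assert (HR : forall x, Cconj (RtoC x) = RtoC x) by (intros; apply C_ext; simpl; ring).
unfold hankel1, hankel2, besselY.
rewrite Cplus_conj, Cmult_conj, Cdiv_conj, Cminus_conj, Cmult_conj, !HR, !besselJ_conj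
  by exact Hs'.
replace (Cconj Ci) with (- Ci)%C by (apply C_ext; simpl; ring).
ring.
Qed.

(** The classical leading coefficient sqrt (2/pi) e^(-i (nu pi/2 + pi/4)), written as twice the one
    found for J_nu. *)
Definition hankel_scale (nu : R) : C :=
  (RtoC (2 / sqrt (2 * PI)) * cis (- (nu * PI / 2 + PI / 4)))%C.

(** In the combination of J_nu and J_(-nu) the two limits of B cancel, because e^(-i nu pi) e^(i nu
    pi/2) = e^(-i nu pi/2). *)
Lemma hankel1_recessive nu : sin (nu * PI) <> 0 ->
  order_ok nu -> order_ok (- nu) ->
  exists U', bessel_sol nu (hankel1 nu) U' /\
  ctends (fun r => amp Ci (hankel1 nu) U' (RtoC r)) (hankel_scale nu) /\
  ctends (fun r => amp (- Ci) (hankel1 nu) U' (RtoC r)) (RtoC 0).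
Proof.
intros Hs H1 H2.
assert (Hs' := RtoC_ne0 _ Hs).
set (c := (Ci * cis (- (nu * PI)) / RtoC (sin (nu * PI)))%C).
set (d := (- Ci / RtoC (sin (nu * PI)))%C).
assert (S1 := besselJ_sol nu H1).
assert (S2 := besselJ_opp_sol nu H2).
assert (EH : hankel1 nu = (fun w => c * besselJ nu w + d * besselJ (- nu) w)%C).
{ apply functional_extensionality; intros w.
  apply hankel1_eq, Hs. }
exists (fun w => c * besselJ' nu w + d * besselJ' (- nu) w)%C.
rewrite EH; split; [apply bessel_sol_lin; assumption|].
assert (Hsq : 0 < sqrt (2 * PI)) by (apply sqrt_lt_R0; generalize PI_RGT_0; lra).
(* Used at x = sin (nu pi): the identity e^(-i t) = e^(i t) - 2 i sin t cancels the denominator in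
   the limit of A. *)
assert (Hcis : forall x, cis (- (nu * PI)) = (cis (nu * PI) - RtoC (2 * x) * Ci)%C \/
  x <> sin (nu * PI)).
{ intros x; destruct (Req_dec x (sin (nu * PI))) as [-> |Hx]; [left|right; exact Hx].
  rewrite !cis_eq, cos_neg, sin_neg; apply C_ext; simpl; ring. }
destruct (Hcis (sin (nu * PI))) as [Ec|]; [clear Hcis|congruence].
split; (eapply ctends_ext; [intros r; symmetry; apply amp_lin|]).
- assert (L := ctends_plus _ _ _ _
    (ctends_scal c _ _ (besselJ_subdominant_limit nu H1))
    (ctends_scal d _ _ (besselJ_subdominant_limit (- nu) H2))).
  match type of L with ctends _ ?z => replace (hankel_scale nu) with z; [exact L|] end.
  unfold hankel_scale.
  replace (- (- nu * PI / 2 + PI / 4)) with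
    (nu * PI + - (nu * PI / 2 + PI / 4)) by field.
  rewrite cis_plus, RtoC_div by lra; rewrite RtoC_inv by lra.
  unfold c, d; rewrite Ec, RtoC_mult.
  assert (Hsq' : RtoC (sqrt (2 * PI)) <> RtoC 0)
    by (apply RtoC_ne0; lra).
  set (p := cis (- (nu * PI / 2 + PI / 4))).
  transitivity (RtoC 2 * - (Ci * Ci) / RtoC (sqrt (2 * PI)) * p)%C;
    [|rewrite Ci_sqr]; field; try split; assumption.
- assert (L := ctends_plus _ _ _ _
    (ctends_scal c _ _ (besselJ_dominant_limit nu H1))
    (ctends_scal d _ _ (besselJ_dominant_limit (- nu) H2))).
  match type of L with ctends _ ?z => replace (RtoC 0) with z; [exact L|] end.
  replace (- nu * PI / 2 + PI / 4) with
    (- (nu * PI) + (nu * PI / 2 + PI / 4)) by field.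
  rewrite (cis_plus (- (nu * PI))), RtoC_inv by lra.
  assert (Hsq' : RtoC (sqrt (2 * PI)) <> RtoC 0)
    by (apply RtoC_ne0; lra).
  unfold c, d; field; split; assumption.
Qed.

Lemma hankel1_asymptotics nu w : sin (nu * PI) <> 0 ->
  order_ok nu -> order_ok (- nu) -> Rabs (Im w) < PI / 2 ->
  let D := Rabs (kappa nu) / (exp (Re w) * cos (Im w)) in
  Cmod (Cexp (w / 2) * hankel1 nu w * Cexp (- (Ci * Cexp w)) - hankel_scale nu)%C <=
    2 * (D * exp D * Cmod (hankel_scale nu)).
Proof.
intros Hs H1 H2 Hw D.
destruct (hankel1_recessive nu Hs H1 H2) as [U' [HS [LA LB]]].
assert (Ht : 0 < exp (Re w) * cos (Im w)).
{ apply Rabs_lt_between in Hw.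
  apply Rmult_lt_0_compat; [apply exp_pos|apply cos_gt_0; lra]. }
assert (HB := recessive_bound nu _ _ _ _ (exp (Re w) * sin (Im w)) HS LA LB Ht).
rewrite (log_rect_Cexp w Hw) in HB; exact HB.
Qed.

(** * Regularity of the amplitudes *)

(** The classical flat function e^(-1/x), with powers of 1/x included to make the family closed
    under derivation. *)
Definition flat (n : nat) (x : R) : R :=
  if Rlt_dec 0 x then (/ x) ^ n * exp (- / x) else 0.

Lemma pow_exp_bound m u : 0 < u -> u ^ m * exp (- u) <= INR m ^ m.
Proof.
intros Hu; destruct m as [|m].
- simpl; rewrite Rmult_1_l, <- exp_0; apply exp_le; lra.
- assert (Hm := INR_S_pos m).
  assert (H : (u / INR (S m)) ^ S m <= exp u).
  { replace u with (INR (S m) * (u / INR (S m))) at 2 by (field; lra).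
    rewrite exp_INR_mult; apply pow_incr; split.
    - apply Rlt_le, Rdiv_lt_0_compat; assumption.
    - generalize (exp_ineq1_le (u / INR (S m))); lra. }
  replace (u ^ S m) with (INR (S m) ^ S m * (u / INR (S m)) ^ S m).
  + rewrite Rmult_assoc; rewrite <- (Rmult_1_r (INR (S m) ^ S m)) at 2.
    apply Rmult_le_compat_l; [apply pow_le; lra|].
    rewrite exp_Ropp; assert (He := exp_pos u).
    apply Rmult_le_reg_r with (exp u); [exact He|].
    rewrite Rmult_assoc, Rinv_l; lra.
  + rewrite <- Rpow_mult_distr; f_equal; field; lra.
Qed.

Lemma flat_deriv n x : is_derive (flat n) x (flat (n + 2) x - INR n * flat (n + 1) x).
Proof.
destruct (Rtotal_order 0 x) as [Hx|[<-|Hx]].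
- apply (is_derive_ext_loc (fun y => (/ y) ^ n * exp (- / y))).
  + exists (mkposreal x Hx); intros y Hy.
    apply Rabs_lt_between' in Hy; simpl in Hy; unfold flat.
    destruct (Rlt_dec 0 y); [reflexivity|lra].
  + unfold flat; destruct (Rlt_dec 0 x); [|lra].
    assert (Hx0 : x <> 0) by lra.
    auto_derive; [repeat split; exact Hx0|].
    destruct n as [|n]; [simpl; field; exact Hx0|].
    replace (S n + 2)%nat with (S (S (S n))) by lia.
    replace (S n + 1)%nat with (S (S n)) by lia.
    simpl pred; rewrite <- !tech_pow_Rmult; field; exact Hx0.
- unfold flat; destruct (Rlt_dec 0 0); [lra|].
  replace (0 - INR n * 0) with 0 by ring.
  apply is_derive_Reals; intros eps He.
  set (K := INR (n + 2) ^ (n + 2) + 1).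
  assert (HK : 0 < K)
    by (unfold K; generalize (pow_le (INR (n + 2)) (n + 2) (pos_INR _)); lra).
  assert (Hd : 0 < eps / K) by (apply Rdiv_lt_0_compat; assumption).
  exists (mkposreal _ Hd); intros h Hh0 Hh; simpl in Hh.
  rewrite Rplus_0_l; destruct (Rlt_dec 0 0); [lra|].
  destruct (Rlt_dec 0 h) as [Hp|Hp].
  + rewrite !Rminus_0_r.
    assert (Hi : 0 < / h) by (apply Rinv_0_lt_compat, Hp).
    assert (HB := pow_exp_bound (n + 2) (/ h) Hi).
    (* One factor h is split off the quotient; the remaining u^(n+2) e^(-u), with u = 1/h, is
       bounded. *)
    replace ((/ h) ^ n * exp (- / h) / h) with
      (h * ((/ h) ^ (n + 2) * exp (- / h))) by (rewrite pow_add; simpl; field; lra).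
    rewrite Rabs_pos_eq in Hh by lra.
    assert (HP : 0 <= (/ h) ^ (n + 2) * exp (- / h)).
    { apply Rmult_le_pos; [apply pow_le; lra|apply Rlt_le, exp_pos]. }
    rewrite Rabs_pos_eq by (apply Rmult_le_pos; lra).
    apply Rle_lt_trans with (h * K).
    * apply Rmult_le_compat_l; [lra|unfold K; lra].
    * apply Rlt_le_trans with (eps / K * K); [apply Rmult_lt_compat_r; assumption|].
      right; field; lra.
  + replace ((0 - 0) / h - 0) with 0 by (field; exact Hh0).
    rewrite Rabs_R0; exact He.
- apply (is_derive_ext_loc (fun _ => 0)).
  + assert (Hx' : 0 < - x) by lra; exists (mkposreal _ Hx'); intros y Hy.
    apply Rabs_lt_between' in Hy; simpl in Hy; unfold flat.
    destruct (Rlt_dec 0 y); [lra|reflexivity].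
  + unfold flat; destruct (Rlt_dec 0 x); [lra|].
    replace (0 - INR n * 0) with 0 by ring.
    apply (is_derive_const (V := R_NormedModule)).
Qed.

(* A smooth positive extension of [a + x] from [[1, oo)] to the line. *)
Definition tame (a x : R) : R :=
  a + x + exp (2 / (a + 1)) * ((1 - x) * flat 0 (1 - x)).

Definition tame' (a x : R) : R :=
  1 - exp (2 / (a + 1)) * (flat 0 (1 - x) + (1 - x) * flat 2 (1 - x)).

Lemma tame_eq a x : 1 <= x -> tame a x = a + x.
Proof. intros Hx; unfold tame, flat; destruct (Rlt_dec 0 (1 - x)); lra. Qed.

(** With u = 1 - x the affine part is a + 1 - u, positive for u < a + 1. For larger u the factor
    e^(2/(a+1) - 1/u) is at least 1, so the correction is at least u and outweighs the deficit. *)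
Lemma tame_pos a x : 0 < a -> 0 < tame a x.
Proof.
intros Ha; destruct (Rle_lt_dec 1 x) as [Hx|Hx]; [rewrite tame_eq; lra|].
unfold tame, flat; destruct (Rlt_dec 0 (1 - x)) as [Hu|]; [|lra].
set (u := 1 - x) in *; replace x with (1 - u) by (unfold u; ring).
simpl pow; rewrite Rmult_1_l.
assert (He := exp_pos (2 / (a + 1))); assert (He' := exp_pos (- / u)).
destruct (Rlt_le_dec u (a + 1)) as [H|H].
- assert (0 < exp (2 / (a + 1)) * (u * exp (- / u)))
    by (repeat apply Rmult_lt_0_compat; assumption); lra.
- replace (exp (2 / (a + 1)) * (u * exp (- / u))) with
    (u * exp (2 / (a + 1) + - / u)) by (rewrite exp_plus; ring).
  assert (H1 : 1 <= exp (2 / (a + 1) + - / u)).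
  { apply Rle_trans with (exp 0); [rewrite exp_0; lra|apply exp_le].
    assert (/ u <= / (a + 1)) by (apply Rinv_le_contravar; lra).
    assert (0 < / (a + 1)) by (apply Rinv_0_lt_compat; lra).
    unfold Rdiv; lra. }
  assert (0 <= u * (exp (2 / (a + 1) + - / u) - 1)) by (apply Rmult_le_pos; lra).
  lra.
Qed.

Lemma flat_refl_deriv n x :
  is_derive (fun y => flat n (1 - y)) x
    (- (flat (n + 2) (1 - x) - INR n * flat (n + 1) (1 - x))).
Proof.
replace (- (flat (n + 2) (1 - x) - INR n * flat (n + 1) (1 - x))) with
  (scal (-1) (flat (n + 2) (1 - x) - INR n * flat (n + 1) (1 - x)))
  by (unfold scal; simpl; unfold mult; simpl; ring).
apply (is_derive_comp (K := R_AbsRing) (V := R_NormedModule) (flat n)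
  (fun y => 1 - y) x); [apply flat_deriv|].
auto_derive; trivial; ring.
Qed.

Lemma tame_deriv a x : is_derive (tame a) x (tame' a x).
Proof.
unfold tame.
replace (tame' a x) with (plus 1 (exp (2 / (a + 1)) *
  (plus (-1 * flat 0 (1 - x)) ((1 - x) * - (flat (0 + 2) (1 - x) -
    INR 0 * flat (0 + 1) (1 - x))))))
  by (unfold tame', plus; simpl; ring).
apply (is_derive_plus (V := R_NormedModule) (fun y => a + y)).
- auto_derive; trivial; ring.
- apply (is_derive_scal (fun y => (1 - y) * flat 0 (1 - y))).
  apply (is_derive_mult (K := R_AbsRing) (fun y => 1 - y) (fun y => flat 0 (1 - y)));
    [auto_derive; trivial; ring|apply flat_refl_deriv|exact Rmult_comm].
Qed.

Definition tame_log (a : R) (c : C) (x : R) : C := (c + RtoC (ln (tame a x)))%C.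

(* Stable under derivation, hence made of smooth functions. *)
Inductive smooth_alg (U U' : C -> C) (a : R) (c : C) : (R -> C) -> Prop :=
| sa_const d : smooth_alg U U' a c (fun _ => d)
| sa_id : smooth_alg U U' a c RtoC
| sa_flat n : smooth_alg U U' a c (fun x => RtoC (flat n (1 - x)))
| sa_sol : smooth_alg U U' a c (fun x => U (tame_log a c x))
| sa_sol' : smooth_alg U U' a c (fun x => U' (tame_log a c x))
| sa_exp d : smooth_alg U U' a c (fun x => Cexp (d * tame_log a c x))
| sa_expexp d : smooth_alg U U' a c (fun x => Cexp (d * Cexp (tame_log a c x)))
| sa_plus f g : smooth_alg U U' a c f -> smooth_alg U U' a c g ->
    smooth_alg U U' a c (fun x => f x + g x)%C
| sa_mult f g : smooth_alg U U' a c f -> smooth_alg U U' a c g ->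
    smooth_alg U U' a c (fun x => f x * g x)%C
| sa_ext f g : (forall x, f x = g x) -> smooth_alg U U' a c f ->
    smooth_alg U U' a c g.

Lemma rderiv_RtoC f x l : is_derive f x l -> rderiv (fun y => RtoC (f y)) x (RtoC l).
Proof.
intros H; apply rderiv_of_Re_Im; simpl; [exact H|].
apply (is_derive_const (V := R_NormedModule)).
Qed.

Lemma rderiv_plus f g t l m : rderiv f t l -> rderiv g t m ->
  rderiv (fun s => f s + g s)%C t (l + m)%C.
Proof.
intros Hf Hg; apply rderiv_Re_Im in Hf; apply rderiv_Re_Im in Hg.
apply rderiv_of_Re_Im; apply (is_derive_plus (V := R_NormedModule)); tauto.
Qed.

Lemma rderiv_mult f g t l m : rderiv f t l -> rderiv g t m ->
  rderiv (fun s => f s * g s)%C t (l * g t + f t * m)%C.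
Proof.
intros Hf Hg; apply rderiv_Re_Im in Hf; apply rderiv_Re_Im in Hg.
destruct Hf as [F1 F2]; destruct Hg as [G1 G2].
apply rderiv_of_Re_Im.
- replace (Re (l * g t + f t * m)%C) with
    (minus (plus (Re l * Re (g t)) (Re (f t) * Re m))
       (plus (Im l * Im (g t)) (Im (f t) * Im m)))
    by (unfold minus, plus, opp, Re, Im; simpl; ring).
  apply (is_derive_minus (V := R_NormedModule) (fun s => Re (f s) * Re (g s))
    (fun s => Im (f s) * Im (g s)));
  [apply (is_derive_mult (K := R_AbsRing) (fun s => Re (f s)) (fun s => Re (g s)))|
   apply (is_derive_mult (K := R_AbsRing) (fun s => Im (f s)) (fun s => Im (g s)))];
  try assumption; exact Rmult_comm.
- replace (Im (l * g t + f t * m)%C) with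
    (plus (plus (Re l * Im (g t)) (Re (f t) * Im m))
       (plus (Im l * Re (g t)) (Im (f t) * Re m)))
    by (unfold plus, Re, Im; simpl; ring).
  apply (is_derive_plus (V := R_NormedModule) (fun s => Re (f s) * Im (g s))
    (fun s => Im (f s) * Re (g s)));
  [apply (is_derive_mult (K := R_AbsRing) (fun s => Re (f s)) (fun s => Im (g s)))|
   apply (is_derive_mult (K := R_AbsRing) (fun s => Im (f s)) (fun s => Re (g s)))];
  try assumption; exact Rmult_comm.
Qed.

(** The reciprocal of [tame] is written as e^c times an exponential of [tame_log], so that it is
    built from generators of [smooth_alg]. *)
Definition tame_log' (a : R) (c : C) (x : R) : C :=
  (RtoC (tame' a x) * (Cexp c * Cexp (- (1) * tame_log a c x)))%C.

Lemma tame_log_deriv a c x : 0 < a -> rderiv (tame_log a c) x (tame_log' a c x).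
Proof.
intros Ha; assert (Hp := tame_pos a x Ha); eapply rderiv_eq.
- apply (rderiv_plus (fun _ => c) (fun y => RtoC (ln (tame a y))));
    [apply rderiv_const|apply rderiv_RtoC].
  apply (is_derive_comp (K := R_AbsRing) (V := R_NormedModule) ln (tame a) x
    (/ tame a x)); [apply is_derive_ln, Hp|apply tame_deriv].
- unfold tame_log', tame_log; change (scal (tame' a x) (/ tame a x)) with
    (tame' a x * / tame a x).
  replace (- (1) * (c + RtoC (ln (tame a x))))%C with
    (- c + RtoC (- ln (tame a x)))%C by (rewrite RtoC_opp; ring).
  rewrite Cexp_add, Cexp_R, exp_Ropp, exp_ln, Cexp_opp, RtoC_mult by exact Hp.
  field; apply Cexp_ne0.
Qed.

Lemma sa_tame_log' U U' a c : smooth_alg U U' a c (tame_log' a c).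
Proof.
apply sa_mult; [|apply sa_mult; [apply sa_const|apply sa_exp]].
apply (sa_ext U U' a c (fun x => RtoC 1 + RtoC (- exp (2 / (a + 1))) *
  (RtoC (flat 0 (1 - x)) + (RtoC 1 + RtoC (-1) * RtoC x) * RtoC (flat 2 (1 - x))))%C).
- intros x; unfold tame'.
  rewrite <- RtoC_mult, <- RtoC_plus, <- RtoC_mult, <- RtoC_plus, <- RtoC_mult,
    <- RtoC_plus; f_equal; ring.
- repeat first [apply sa_plus|apply sa_mult|apply sa_const|apply sa_id|apply sa_flat].
Qed.

(** Bessel's equation brings the derivative of U' back into the algebra. *)
Lemma smooth_alg_deriv nu U U' a c f : bessel_sol nu U U' -> 0 < a ->
  smooth_alg U U' a c f ->
  exists f', smooth_alg U U' a c f' /\ forall x, rderiv f x (f' x).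
Proof.
intros HU Ha; assert (HL := fun x => tame_log_deriv a c x Ha).
induction 1 as [d| |n| | |d|d|f g Hf [f' [IF DF]] Hg [g' [IG DG]]
  |f g Hf [f' [IF DF]] Hg [g' [IG DG]]|f g E Hf [f' [IF DF]]].
- exists (fun _ => RtoC 0); split; [apply sa_const|intros x; apply rderiv_const].
- exists (fun _ => RtoC 1); split; [apply sa_const|intros x].
  apply (rderiv_RtoC (fun y => y)); apply (is_derive_id (K := R_AbsRing)).
- exists (fun x => RtoC (-1) * RtoC (flat (n + 2) (1 - x)) +
    RtoC (INR n) * RtoC (flat (n + 1) (1 - x)))%C; split.
  + apply sa_plus; apply sa_mult; first [apply sa_const|apply sa_flat].
  + intros x; eapply rderiv_eq; [apply rderiv_RtoC, flat_refl_deriv|].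
    rewrite <- !RtoC_mult, <- RtoC_plus; f_equal; ring.
- exists (fun x => U' (tame_log a c x) * tame_log' a c x)%C; split.
  + apply sa_mult; [apply sa_sol'|apply sa_tame_log'].
  + intros x; apply rderiv_comp; [apply HU|apply HL].
- exists (fun x => (RtoC (nu * nu) + RtoC (-1) * Cexp (RtoC 2 * tame_log a c x)) *
    U (tame_log a c x) * tame_log' a c x)%C; split.
  + apply sa_mult; [apply sa_mult; [|apply sa_sol]|apply sa_tame_log'].
    apply sa_plus; [apply sa_const|apply sa_mult; [apply sa_const|apply sa_exp]].
  + intros x; eapply rderiv_eq; [apply rderiv_comp; [apply HU|apply HL]|].
    replace (RtoC 2 * tame_log a c x)%C with (tame_log a c x + tame_log a c x)%C by ring.
    rewrite Cexp_add; ring.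
- exists (fun x => Cexp (d * tame_log a c x) * d * tame_log' a c x)%C; split.
  + apply sa_mult; [apply sa_mult; [apply sa_exp|apply sa_const]|apply sa_tame_log'].
  + intros x; apply (rderiv_comp (fun w => Cexp (d * w))%C); [|apply HL].
    apply (cderiv_comp Cexp (fun w => d * w)%C); [apply cderiv_Cexp|].
    eapply cderiv_eq; [apply cderiv_scal, cderiv_id|ring].
- exists (fun x => Cexp (d * Cexp (tame_log a c x)) *
    (d * Cexp (1 * tame_log a c x)) * tame_log' a c x)%C; split.
  + apply sa_mult; [apply sa_mult; [apply sa_expexp|]|apply sa_tame_log'].
    apply sa_mult; [apply sa_const|apply sa_exp].
  + intros x; rewrite Cmult_1_l.
    apply (rderiv_comp (fun w => Cexp (d * Cexp w))%C); [|apply HL].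
    apply (cderiv_comp Cexp (fun w => d * Cexp w)%C); [apply cderiv_Cexp|].
    apply cderiv_scal, cderiv_Cexp.
- exists (fun x => f' x + g' x)%C; split; [apply sa_plus; assumption|].
  intros x; apply rderiv_plus; auto.
- exists (fun x => f' x * g x + f x * g' x)%C; split.
  + apply sa_plus; apply sa_mult; assumption.
  + intros x; apply rderiv_mult; auto.
- exists f'; split; [exact IF|intros x].
  apply (rderiv_ext f); auto.
Qed.

Lemma smooth_alg_Derive_n nu U U' a c n f : bessel_sol nu U U' -> 0 < a ->
  smooth_alg U U' a c f ->
  exists g, smooth_alg U U' a c g /\ forall x,
    Derive_n (fun y => Re (f y)) n x = Re (g x) /\
    Derive_n (fun y => Im (f y)) n x = Im (g x).
Proof.
intros HU Ha Hf; induction n as [|n [g [Hg E]]]; [exists f; split; [exact Hf|auto]|].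
destruct (smooth_alg_deriv nu U U' a c g HU Ha Hg) as [g' [Hg' D]].
exists g'; split; [exact Hg'|intros x; simpl].
destruct (rderiv_Re_Im _ _ _ (D x)) as [D1 D2].
rewrite (Derive_ext (Derive_n (fun y => Re (f y)) n) (fun y => Re (g y)))
  by (intros y; apply E).
rewrite (Derive_ext (Derive_n (fun y => Im (f y)) n) (fun y => Im (g y)))
  by (intros y; apply E).
split; apply is_derive_unique; assumption.
Qed.

Lemma smooth_alg_ex_derive_n nu U U' a c f n t : bessel_sol nu U U' -> 0 < a ->
  smooth_alg U U' a c f ->
  ex_derive_n (fun x => Re (f x)) n t /\ ex_derive_n (fun x => Im (f x)) n t.
Proof.
intros HU Ha Hf; destruct n as [|n]; [split; exact I|simpl].
destruct (smooth_alg_Derive_n nu U U' a c n f HU Ha Hf) as [g [Hg E]].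
destruct (smooth_alg_deriv nu U U' a c g HU Ha Hg) as [g' [Hg' D]].
destruct (rderiv_Re_Im _ _ _ (D t)) as [D1 D2].
split; [apply (ex_derive_ext (fun y => Re (g y)))|
        apply (ex_derive_ext (fun y => Im (g y)))];
  try (intros y; symmetry; apply E); eexists; eassumption.
Qed.

(* [d zeta^(1/2) e^(tau zeta) U] at [zeta = e^w]. *)
Definition amplitude (d tau : C) (U : C -> C) (w : C) : C :=
  (d * (Cexp (w / 2) * U w * Cexp (tau * Cexp w)))%C.

Lemma amplitude_smooth nu U U' a c d tau : bessel_sol nu U U' -> 0 < a ->
  smooth_from_1 (fun x => amplitude d tau U (c + RtoC (ln (a + x)))%C).
Proof.
intros HU Ha; exists (fun x => amplitude d tau U (tame_log a c x)); split.
- intros n t; apply (smooth_alg_ex_derive_n nu U U' a c _ n t HU Ha).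
  apply sa_mult; [apply sa_const|].
  apply sa_mult; [|apply sa_expexp].
  apply sa_mult; [|apply sa_sol].
  apply (sa_ext U U' a c (fun x => Cexp (/ 2 * tame_log a c x))%C);
    [|apply sa_exp].
  intros x; f_equal; unfold Cdiv; ring.
- intros x Hx; unfold tame_log; rewrite tame_eq by exact Hx; reflexivity.
Qed.

Lemma amplitude_holomorphic nu U U' b c d tau w : bessel_sol nu U U' ->
  holomorphic_at (fun v => amplitude d tau U (v / 2 + b + c)%C) w.
Proof.
intros HU.
assert (Hw : cderiv (fun v => v / 2 + b + c)%C w (/ 2 + RtoC 0 + RtoC 0)%C).
{ repeat apply cderiv_plus; [apply cderiv_half|apply cderiv_const..]. }
eapply cderiv_holomorphic, (cderiv_comp (amplitude d tau U)); [|exact Hw].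
apply cderiv_scal, cderiv_mult.
- apply (cderiv_mult (fun v => Cexp (v / 2))%C); [|apply HU].
  apply (cderiv_comp Cexp (fun v => v / 2)%C); [apply cderiv_Cexp|apply cderiv_half].
- apply (cderiv_comp Cexp (fun v => tau * Cexp v)%C);
    [apply cderiv_Cexp|apply cderiv_scal, cderiv_Cexp].
Qed.

(** * Rotation of the argument *)

Lemma cis_2PI_Z (n : Z) : cis (2 * (IZR n * PI)) = RtoC 1.
Proof.
assert (Hs : sin (IZR n * PI) = 0) by (apply sin_eq_0_1; exists n; reflexivity).
rewrite cis_eq, cos_2a_sin, sin_2a, Hs; apply C_ext; simpl; ring.
Qed.

(** The even part 2m of the exponents only contributes full turns. *)
Lemma besselJ_rotate nu w (k : Z) : order_ok nu ->
  besselJ nu (w + RtoC (IZR k * PI) * Ci)%C =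
  (cis (nu * (IZR k * PI)) * besselJ nu w)%C.
Proof.
intros H; rewrite !besselJ_exps; unfold exps.
rewrite <- CSeries_scal by apply summable_exps, entire_bessel_coef, H.
apply CSeries_ext; intros m; unfold exps_term, half_shift.
replace (RtoC (2 * INR m + nu) * (w + RtoC (IZR k * PI) * Ci - RtoC (ln 2)))%C with
  (RtoC (2 * INR m + nu) * (w - RtoC (ln 2)) +
   Ci * RtoC (2 * (IZR (Z.of_nat m * k) * PI) + nu * (IZR k * PI)))%C.
- rewrite Cexp_add; fold (cis (2 * (IZR (Z.of_nat m * k) * PI) + nu * (IZR k * PI))).
  rewrite cis_plus, cis_2PI_Z; ring.
- rewrite mult_IZR, <- INR_IZR_INZ.
  replace (2 * (INR m * IZR k * PI) + nu * (IZR k * PI)) with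
    ((2 * INR m + nu) * (IZR k * PI)) by ring.
  rewrite RtoC_mult; ring.
Qed.

Lemma hankel2_eq nu w : sin (nu * PI) <> 0 ->
  hankel2 nu w =
  (- Ci * cis (nu * PI) / RtoC (sin (nu * PI)) * besselJ nu w +
   Ci / RtoC (sin (nu * PI)) * besselJ (- nu) w)%C.
Proof.
intros Hs; unfold hankel2, besselY; rewrite cis_eq.
assert (Hs' := RtoC_ne0 _ Hs).
replace (cos (nu * PI), sin (nu * PI)) with
  (RtoC (cos (nu * PI)) + Ci * RtoC (sin (nu * PI)))%C by (apply C_ext; simpl; ring).
transitivity ((- (Ci * Ci) * RtoC (sin (nu * PI)) -
  Ci * RtoC (cos (nu * PI))) / RtoC (sin (nu * PI)) * besselJ nu w +
  Ci / RtoC (sin (nu * PI)) * besselJ (- nu) w)%C;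
  [rewrite Ci_sqr|]; field; exact Hs'.
Qed.

Lemma cis_ne0 t : cis t <> RtoC 0.
Proof. apply Cexp_ne0. Qed.

Lemma cis_opp t : cis (- t) = (/ cis t)%C.
Proof. unfold cis; rewrite <- Cexp_opp; f_equal; rewrite RtoC_opp; ring. Qed.

Lemma RtoC_sin t : RtoC (sin t) = (- Ci * (cis t - / cis t) / 2)%C.
Proof.
rewrite <- cis_opp, !cis_eq, cos_neg, sin_neg.
replace ((cos t, sin t) - (cos t, (- sin t)%R))%C with (Ci * RtoC (2 * sin t))%C
  by (apply C_ext; simpl; ring).
rewrite RtoC_mult; transitivity (- (Ci * Ci) * RtoC (sin t))%C;
  [rewrite Ci_sqr; ring|field; apply C2_nz].
Qed.

(** In the basis J_nu, J_(-nu) the rotation is diagonal. With X = e^(i k nu pi) and Y = e^(i nu pi)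
    all sines become Laurent polynomials, and the formulas are rational identities. *)
Lemma hankel_rotate nu w (k : Z) : sin (nu * PI) <> 0 ->
  order_ok nu -> order_ok (- nu) ->
  (RtoC (sin (nu * PI)) * hankel1 nu (w + RtoC (IZR k * PI) * Ci) =
   - (RtoC (sin (IZR (k - 1) * (nu * PI))) * hankel1 nu w) -
   cis (- (nu * PI)) * RtoC (sin (IZR k * (nu * PI))) * hankel2 nu w)%C /\
  (RtoC (sin (nu * PI)) * hankel2 nu (w + RtoC (IZR k * PI) * Ci) =
   cis (nu * PI) * RtoC (sin (IZR k * (nu * PI))) * hankel1 nu w +
   RtoC (sin (IZR (k + 1) * (nu * PI))) * hankel2 nu w)%C.
Proof.
intros Hs H1 H2.
assert (Hs' := RtoC_ne0 _ Hs).
rewrite !hankel1_eq, !hankel2_eq, !besselJ_rotate by assumption.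
set (j := besselJ nu w); set (j' := besselJ (- nu) w).
replace (nu * (IZR k * PI)) with (IZR k * (nu * PI)) by ring.
replace (- nu * (IZR k * PI)) with (- (IZR k * (nu * PI))) by ring.
rewrite minus_IZR, plus_IZR.
replace ((IZR k - 1) * (nu * PI)) with (IZR k * (nu * PI) + - (nu * PI)) by ring.
replace ((IZR k + 1) * (nu * PI)) with (IZR k * (nu * PI) + nu * PI) by ring.
rewrite (RtoC_sin (IZR k * (nu * PI))), (RtoC_sin (_ + - _)),
  (RtoC_sin (_ + nu * PI)).
rewrite !cis_plus, !cis_opp.
assert (Es := RtoC_sin (nu * PI)).
set (s := RtoC (sin (nu * PI))) in *.
set (X := cis (IZR k * (nu * PI))); set (Y := cis (nu * PI)) in *.
assert (HX : X <> RtoC 0) by apply cis_ne0.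
assert (HY : Y <> RtoC 0) by apply cis_ne0.
assert (K1 : (s * (Ci * X / Y * j - Ci / X * j') =
  - (- Ci * (X * / Y - / (X * / Y)) / 2) * (Ci / Y * j - Ci * j') -
  / Y * (- Ci * (X - / X) / 2) * (- Ci * Y * j + Ci * j'))%C).
{ rewrite Es; field; repeat split; try assumption; apply C2_nz. }
assert (K2 : (s * (- Ci * Y * X * j + Ci / X * j') =
  Y * (- Ci * (X - / X) / 2) * (Ci / Y * j - Ci * j') +
  (- Ci * (X * Y - / (X * Y)) / 2) * (- Ci * Y * j + Ci * j'))%C).
{ rewrite Es; field; repeat split; try assumption; apply C2_nz. }
split.
- transitivity (s * (Ci * X / Y * j - Ci / X * j') / s)%C; [field; auto|].
  rewrite K1; field; repeat split; try assumption; apply C2_nz.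
- transitivity (s * (- Ci * Y * X * j + Ci / X * j') / s)%C; [field; auto|].
  rewrite K2; field; repeat split; try assumption; apply C2_nz.
Qed.

Lemma hankel2_sol nu : sin (nu * PI) <> 0 -> order_ok nu -> order_ok (- nu) ->
  exists U', bessel_sol nu (hankel2 nu) U'.
Proof.
intros Hs H1 H2.
set (c := (- Ci * cis (nu * PI) / RtoC (sin (nu * PI)))%C).
set (d := (Ci / RtoC (sin (nu * PI)))%C).
exists (fun w => c * besselJ' nu w + d * besselJ' (- nu) w)%C.
assert (S2 := besselJ_opp_sol nu H2).
replace (hankel2 nu) with (fun w => c * besselJ nu w + d * besselJ (- nu) w)%C.
- apply bessel_sol_lin; [apply besselJ_sol, H1|exact S2].
- apply functional_extensionality; intros w.
  symmetry; apply hankel2_eq, Hs.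
Qed.

(** * The normalized amplitudes *)

Definition order (a : R) : R := (a + 1) / 2.

Lemma order_admissible a : 0 < a -> not_odd a ->
  sin (order a * PI) <> 0 /\ order_ok (order a) /\ order_ok (- order a).
Proof.
intros Ha Hodd; assert (Hpi := PI_RGT_0).
assert (Hs : sin (order a * PI) <> 0).
{ intros E; destruct (sin_eq_0_0 _ E) as [k Hk].
  apply Rmult_eq_reg_r in Hk; [|lra]; unfold order in Hk.
  assert (Hk0 : (0 < k)%Z) by (apply lt_IZR; lra).
  apply (Hodd (Z.to_nat (k - 1))).
  rewrite INR_IZR_INZ, Z2Nat.id, minus_IZR by lia; lra. }
split; [exact Hs|split].
- apply nonpole_S, nonpole_pos; unfold order; lra.
- intros n E; apply Hs.
  apply sin_eq_0_1; exists (Z.of_nat n + 1)%Z.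
  rewrite plus_IZR, <- INR_IZR_INZ; f_equal; lra.
Qed.

(** The inverse of [hankel_scale], in the shape in which eta provides it: sqrt (pi/2) i e^(i pi
    a/4). *)
Definition gain (a : R) : C :=
  (RtoC (sqrt (PI / 2)) * cis (order a * PI / 2 + PI / 4))%C.

Lemma gain_scale a : (gain a * hankel_scale (order a))%C = RtoC 1.
Proof.
assert (Hpi := PI_RGT_0); unfold gain, hankel_scale.
rewrite cis_opp.
assert (E : sqrt (PI / 2) * (2 / sqrt (2 * PI)) = 1).
{ assert (Hs : 0 < sqrt (2 * PI)) by (apply sqrt_lt_R0; lra).
  replace (2 * PI) with (2 ^ 2 * (PI / 2)) by field.
  assert (Hs' : 0 < sqrt (PI / 2)) by (apply sqrt_lt_R0; lra).
  rewrite sqrt_mult, sqrt_pow2 by lra; field; lra. }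
transitivity (RtoC (sqrt (PI / 2) * (2 / sqrt (2 * PI))))%C; [|rewrite E; reflexivity].
rewrite RtoC_mult; field; apply cis_ne0.
Qed.

Lemma amplitude1_near_1 a w : 0 < a -> not_odd a -> Rabs (Im w) < PI / 2 ->
  let D := Rabs (kappa (order a)) / (exp (Re w) * cos (Im w)) in
  Cmod (amplitude (gain a) (- Ci) (hankel1 (order a)) w - 1)%C <= 2 * (D * exp D).
Proof.
intros Ha Hodd Hw D; destruct (order_admissible a Ha Hodd) as [Hs [H1 H2]].
assert (H := hankel1_asymptotics (order a) w Hs H1 H2 Hw); fold D in H.
unfold amplitude; replace (- Ci * Cexp w)%C with (- (Ci * Cexp w))%C by ring.
replace (RtoC 1) with (gain a * hankel_scale (order a))%C by apply gain_scale.
match goal with |- Cmod (?g * ?u - ?g * ?v)%C <= _ =>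
  replace (g * u - g * v)%C with (g * (u - v))%C by ring end.
rewrite Cmod_mult; assert (P := Cmod_ge_0 (gain a)).
eapply Rle_trans; [apply Rmult_le_compat_l; [exact P|exact H]|].
right; transitivity (2 * (D * exp D) * Cmod (gain a * hankel_scale (order a))%C).
- rewrite Cmod_mult; ring.
- rewrite gain_scale, Cmod_1; ring.
Qed.

(** Transfers the estimate for the first Hankel function to the second, which is recessive in the
    lower half-plane. *)
Lemma amplitude2_conj a w : 0 < a -> not_odd a ->
  amplitude (Cconj (gain a)) Ci (hankel2 (order a)) w =
  Cconj (amplitude (gain a) (- Ci) (hankel1 (order a)) (Cconj w)).
Proof.
intros Ha Hodd; destruct (order_admissible a Ha Hodd) as [Hs _].
unfold amplitude; rewrite !Cmult_conj, <- hankel2_conj by exact Hs.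
rewrite <- !Cexp_conj, Cconj_half, Cmult_conj, Copp_conj, <- Cexp_conj, !Cconj_conj.
replace (- Cconj Ci)%C with Ci by (apply C_ext; simpl; ring); reflexivity.
Qed.

Lemma amplitude2_near_1 a w : 0 < a -> not_odd a -> Rabs (Im w) < PI / 2 ->
  let D := Rabs (kappa (order a)) / (exp (Re w) * cos (Im w)) in
  Cmod (amplitude (Cconj (gain a)) Ci (hankel2 (order a)) w - 1)%C <=
    2 * (D * exp D).
Proof.
intros Ha Hodd Hw D; rewrite amplitude2_conj by assumption.
replace (RtoC 1) with (Cconj (RtoC 1)) by (apply C_ext; simpl; ring).
rewrite <- Cminus_conj, Cmod_conj.
assert (H := amplitude1_near_1 a (Cconj w) Ha Hodd).
rewrite re_conj, im_conj, cos_neg, Rabs_Ropp in H; exact (H Hw).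
Qed.

(* [ln (l(a) (a + x) e^(v/2))] *)
Definition log_arg (rho : R -> R) (a : R) (v : C) (x : R) : C :=
  (v / 2 + RtoC (ln (ell rho a)) + RtoC (ln (a + x)))%C.

Lemma ell_ge (rho : R -> R) a : 0 < a -> 1 <= rho a ->
  Rpower 2 a / (order a * (order a + 1)) <= ell rho a.
Proof.
intros Ha Hr; unfold ell; fold (order a).
assert (Ho : 0 < order a) by (unfold order; lra).
assert (HG := Gamma_ge _ Ho); assert (H2 := Rpower_pos 2 a).
assert (HG0 := Gamma_pos _ Ho).
apply Rle_trans with (Rpower 2 a * Gamma (order a)).
- apply Rmult_le_compat_l; lra.
- rewrite <- (Rmult_1_r (Rpower 2 a * Gamma (order a))) at 1.
  apply Rmult_le_compat_l; nra.
Qed.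

Lemma ell_pos (rho : R -> R) a : 0 < a -> 1 <= rho a -> 0 < ell rho a.
Proof.
intros Ha Hr; eapply Rlt_le_trans; [|exact (ell_ge rho a Ha Hr)].
apply Rdiv_lt_0_compat; [apply Rpower_pos|unfold order; nra].
Qed.

(* [l(a)] grows exponentially and [kappa = O(a^2)]. *)
Lemma error_small (rho : R -> R) c eps del :
  (forall a, 0 < a -> 1 <= rho a) -> 0 < eps < PI -> 0 < del ->
  exists A, forall a, 0 < a -> A < a -> forall v x, 1 <= x -> c <= Re v ->
    Rabs (Im v) <= PI - eps ->
    let w := log_arg rho a v x in
    let D := Rabs (kappa (order a)) / (exp (Re w) * cos (Im w)) in
    Rabs (Im w) < PI / 2 /\ 2 * (D * exp D) < del.
Proof.
intros Hrho Heps Hdel.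
assert (Hsin : 0 < sin (eps / 2)) by (apply sin_gt_0; lra).
set (K := exp (c / 2) * sin (eps / 2)).
assert (HK : 0 < K) by (apply Rmult_lt_0_compat; [apply exp_pos|exact Hsin]).
assert (Hln2 : 0 < ln 2) by (rewrite <- ln_1; apply ln_increasing; lra).
(* Chosen so that D <= M / a for a > 1: |kappa| <= 3 a^2 / 4, a + x >= a and l(a) >= (a ln 2 / 4)^4
   / (2 a^2). The exponent 4 is the least integer that leaves a negative power of a. *)
set (M := 6 / (4 * K) * (4 / ln 2) ^ 4).
assert (HM : 0 < M).
{ apply Rmult_lt_0_compat; [apply Rdiv_lt_0_compat; lra|].
  apply pow_lt, Rdiv_lt_0_compat; lra. }
(* Beyond M one has D <= 1 and e^D <= 3; beyond 6 M / del also D < del / 6, whence 2 D e^D < del. *)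
exists (Rmax 1 (Rmax M (M * (6 / del)))); intros a Ha HA v x Hx Hv Hi w D.
assert (HA1 := Rle_lt_trans _ _ _ (Rmax_l _ _) HA).
assert (HA' := Rle_lt_trans _ _ _ (Rmax_r _ _) HA).
assert (HA2 := Rle_lt_trans _ _ _ (Rmax_l _ _) HA').
assert (HA3 := Rle_lt_trans _ _ _ (Rmax_r _ _) HA').
assert (Hl := ell_ge rho a Ha (Hrho a Ha)).
assert (Hl0 := ell_pos rho a Ha (Hrho a Ha)).
assert (HRe : exp (Re w) = exp (Re v / 2) * ell rho a * (a + x)).
{ replace (Re w) with (Re v / 2 + ln (ell rho a) + ln (a + x)).
  - rewrite !exp_plus, !exp_ln; [reflexivity|lra|exact Hl0].
  - unfold w, log_arg; destruct v; simpl; field. }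
assert (HIm : Im w = Im v / 2) by (unfold w, log_arg; destruct v; simpl; field).
apply Rabs_le_between in Hi.
assert (Hcos : sin (eps / 2) <= cos (Im w)).
{ rewrite HIm, <- cos_shift.
  assert (Hc : forall t, 0 <= t <= (PI - eps) / 2 ->
    cos (PI / 2 - eps / 2) <= cos t) by (intros t Ht; apply cos_decr_1; lra).
  destruct (Rle_lt_dec 0 (Im v)).
  - apply Hc; lra.
  - rewrite <- (cos_neg (Im v / 2)); apply Hc; lra. }
split; [apply Rabs_lt_between; lra|].
assert (Hpow : (a * ln 2 / 4) ^ 4 <= Rpower 2 a).
{ unfold Rpower; replace (a * ln 2) with (INR 4 * (a * ln 2 / 4)) at 2
    by (simpl; field).
  rewrite exp_INR_mult; apply pow_incr; split.
  - apply Rmult_le_pos; [nra|lra].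
  - generalize (exp_ineq1_le (a * ln 2 / 4)); lra. }
assert (Hkap : Rabs (kappa (order a)) = a * (a + 2) / 4).
{ unfold kappa, order; rewrite Rabs_pos_eq; [field|].
  replace ((a + 1) / 2 * ((a + 1) / 2) - 1 / 4) with (a * (a + 2) / 4) by field.
  nra. }
assert (Hden : K * a * (a * ln 2 / 4) ^ 4 / (2 * a * a) <= exp (Re w) * cos (Im w)).
{ assert (Hx1 : exp (c / 2) <= exp (Re v / 2)) by (apply exp_le; lra).
  assert (Hl' : (a * ln 2 / 4) ^ 4 / (2 * a * a) <= ell rho a).
  { eapply Rle_trans; [|exact Hl].
    assert (Ho : 0 < order a * (order a + 1)) by (unfold order; nra).
    assert (Ho2 : order a * (order a + 1) <= 2 * a * a) by (unfold order; nra).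
    unfold Rdiv; apply Rmult_le_compat.
    - apply pow_le; apply Rmult_le_pos; [nra|lra].
    - apply Rlt_le, Rinv_0_lt_compat; nra.
    - exact Hpow.
    - apply Rinv_le_contravar; assumption. }
  assert (Hp0 : 0 <= (a * ln 2 / 4) ^ 4 / (2 * a * a)).
  { apply Rmult_le_pos; [apply pow_le; apply Rmult_le_pos; [nra|lra]|].
    apply Rlt_le, Rinv_0_lt_compat; nra. }
  assert (He0 := exp_pos (c / 2)).
  rewrite HRe; unfold K.
  apply Rle_trans with
    (exp (c / 2) * ((a * ln 2 / 4) ^ 4 / (2 * a * a)) * a * sin (eps / 2));
    [right; unfold Rdiv; ring|].
  apply Rmult_le_compat; [|lra| |exact Hcos].
  - apply Rmult_le_pos; [apply Rmult_le_pos; lra|lra].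
  - apply Rmult_le_compat; [|lra| |lra].
    + apply Rmult_le_pos; lra.
    + apply Rmult_le_compat; lra. }
assert (Hden0 : 0 < K * a * (a * ln 2 / 4) ^ 4 / (2 * a * a)).
{ apply Rdiv_lt_0_compat; [|nra].
  apply Rmult_lt_0_compat; [nra|]; apply pow_lt, Rdiv_lt_0_compat; nra. }
assert (HD : D <= M / a).
{ unfold D; rewrite Hkap.
  apply Rle_trans with (a * (3 * a) / 4 / (K * a * (a * ln 2 / 4) ^ 4 / (2 * a * a))).
  - unfold Rdiv at 1 4; apply Rmult_le_compat.
    + nra.
    + apply Rlt_le, Rinv_0_lt_compat; lra.
    + nra.
    + apply Rinv_le_contravar; assumption.
  - right; unfold M; field; repeat split; lra. }
assert (HD0 : 0 <= D).
{ apply Rmult_le_pos; [apply Rabs_pos|apply Rlt_le, Rinv_0_lt_compat; lra]. }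
assert (HD1 : D <= 1).
{ eapply Rle_trans; [exact HD|].
  apply Rmult_le_reg_r with a; [exact Ha|].
  unfold Rdiv; rewrite Rmult_assoc, Rinv_l; lra. }
assert (HD2 : D < del / 6).
{ eapply Rle_lt_trans; [exact HD|].
  apply Rmult_lt_reg_r with (a * (6 / del)).
  - apply Rmult_lt_0_compat; [exact Ha|apply Rdiv_lt_0_compat; lra].
  - replace (M / a * (a * (6 / del))) with (M * (6 / del)) by (field; lra).
    replace (del / 6 * (a * (6 / del))) with a by (field; lra).
    exact HA3. }
assert (He : exp D <= 3).
{ eapply Rle_trans; [apply exp_le, HD1|apply exp_le_3]. }
assert (He0 := exp_pos D); nra.
Qed.

(** * The square root of the frequency *)

(** Half-angle formulas: cos (t/2) is nonnegative, and sin (t/2) has the sign of sin t on this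
    interval, as the branch test requires. *)
Lemma Csqrt_polar x t : - PI < t < PI ->
  Csqrt (RtoC (exp x) * cis t)%C = (RtoC (exp (x / 2)) * cis (t / 2))%C.
Proof.
intros Ht; assert (Hx := exp_pos x); assert (Hx2 := exp_pos (x / 2)).
assert (E2 : exp x = exp (x / 2) ^ 2).
{ replace (exp (x / 2) ^ 2) with (exp (x / 2) * exp (x / 2)) by ring.
  rewrite <- exp_plus; f_equal; field. }
assert (HM : Cmod (RtoC (exp x) * cis t)%C = exp x).
{ rewrite Cmod_mult, Cmod_cis, Cmod_R, Rabs_pos_eq; lra. }
unfold Csqrt; rewrite HM, re_scal_l, im_scal_l, !cis_eq; cbn [Re Im fst snd].
assert (Hc : cos t = 2 * cos (t / 2) ^ 2 - 1).
{ replace t with (2 * (t / 2)) at 1 by field; rewrite cos_2a_cos; ring. }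
assert (Hs : cos t = 1 - 2 * sin (t / 2) ^ 2).
{ replace t with (2 * (t / 2)) at 1 by field; rewrite cos_2a_sin; ring. }
assert (Hcp : 0 <= cos (t / 2)) by (apply cos_ge_0; lra).
apply C_ext; simpl Re; simpl Im.
- replace ((exp x + exp x * cos t) / 2) with ((exp (x / 2) * cos (t / 2)) ^ 2)
    by (rewrite Hc, E2; field).
  rewrite sqrt_pow2 by (apply Rmult_le_pos; lra); ring.
- replace ((exp x - exp x * cos t) / 2) with ((exp (x / 2) * sin (t / 2)) ^ 2)
    by (rewrite Hs, E2; field).
  destruct (Rle_dec 0 (exp x * sin t)) as [H|H].
  + assert (Ht0 : 0 <= t).
    { destruct (Rle_lt_dec 0 t) as [|Hneg]; [assumption|].
      assert (sin t < 0) by (apply sin_lt_0_var; lra); nra. }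
    assert (0 <= sin (t / 2)) by (apply sin_ge_0; lra).
    rewrite sqrt_pow2 by (apply Rmult_le_pos; lra); ring.
  + assert (Ht0 : t < 0).
    { destruct (Rlt_le_dec t 0) as [|Hpos]; [assumption|].
      assert (0 <= sin t) by (apply sin_ge_0; lra); exfalso; apply H; nra. }
    assert (sin (t / 2) < 0) by (apply sin_lt_0_var; lra).
    replace ((exp (x / 2) * sin (t / 2)) ^ 2) with
      ((exp (x / 2) * - sin (t / 2)) ^ 2) by ring.
    rewrite sqrt_pow2 by (apply Rmult_le_pos; lra); ring.
Qed.

Lemma Cexp_half_polar b :
  Cexp (b / 2) = (RtoC (exp (Re b / 2)) * cis (Im b / 2))%C.
Proof.
rewrite <- Cexp_polar; f_equal; apply C_ext; destruct b; simpl; field.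
Qed.

(** One factor (a + x)^(1/2) of (a + x)^nu joins the square root in eta to form zeta^(1/2); the
    rest, divided by a^(a/2), is (1 + x/a)^(a/2). The branch is right because |Im z_0 / 2| <=
    pi/2. *)
Lemma eta_scale rho a z x : 0 < a -> 1 <= rho a -> 1 <= x ->
  (RtoC (Rpower a (- (a / 2))) * Csqrt (RtoC PI * freq rho a z / 2) *
    RtoC (Rpower (a + x) (order a)) =
   RtoC (sqrt (PI / 2)) * RtoC (Rpower (1 + x / a) (a / 2)) *
     Cexp (log_arg rho a (z0 z) x / 2))%C.
Proof.
intros Ha Hr Hx; assert (Hpi := PI_RGT_0).
assert (Hl := ell_pos rho a Ha Hr); assert (Hz := z0_strip z).
unfold freq; set (b := z0 z) in *.
replace (RtoC PI * (RtoC (ell rho a) * Cexp (b / 2)) / 2)%C with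
  (RtoC (exp (ln (PI / 2) + ln (ell rho a) + Re b / 2)) * cis (Im b / 2))%C.
2:{ rewrite Cexp_half_polar, !exp_plus, !exp_ln by lra.
    rewrite !RtoC_mult, RtoC_div by lra; field; apply C2_nz. }
rewrite Csqrt_polar by lra.
rewrite (Cexp_half_polar (log_arg rho a b x)).
replace (Im (log_arg rho a b x) / 2) with (Im b / 2 / 2)
  by (unfold log_arg; destruct b; simpl; field).
replace (Re (log_arg rho a b x) / 2) with
  ((Re b / 2 + ln (ell rho a) + ln (a + x)) / 2)
  by (unfold log_arg; destruct b; simpl; field).
match goal with |- (RtoC ?p * (RtoC ?q * ?u) * RtoC ?r =
  RtoC ?p' * RtoC ?q' * (RtoC ?r' * ?u))%C =>
  transitivity (RtoC (p * q * r) * u)%C; [rewrite !RtoC_mult; ring|];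
  transitivity (RtoC (p' * q' * r') * u)%C; [|rewrite !RtoC_mult; ring];
  replace (p * q * r) with (p' * q' * r'); [reflexivity|] end.
rewrite <- Rpower_sqrt by lra; unfold Rpower; rewrite <- !exp_plus; f_equal.
replace (1 + x / a) with ((a + x) / a) by (field; lra).
rewrite (ln_div (a + x)) by lra; unfold order; field.
Qed.

(** * Algebra of the connection coefficients *)

Lemma cis_order a : cis (order a * PI) = (Ci * (cis (PI * a / 4) * cis (PI * a / 4)))%C.
Proof.
rewrite <- cis_plus, <- cis_PI2, <- cis_plus; f_equal; unfold order; field.
Qed.

Lemma gain_eq a : gain a = (RtoC (sqrt (PI / 2)) * (Ci * cis (PI * a / 4)))%C.
Proof.
unfold gain; rewrite <- cis_PI2, <- cis_plus; f_equal; f_equal; unfold order; field.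
Qed.

Lemma gain_conj a :
  Cconj (gain a) = (RtoC (sqrt (PI / 2)) * (- Ci / cis (PI * a / 4)))%C.
Proof.
rewrite gain_eq, !Cmult_conj, cis_conj, cis_opp.
replace (Cconj (RtoC (sqrt (PI / 2)))) with (RtoC (sqrt (PI / 2)))
  by (apply C_ext; simpl; ring).
replace (Cconj Ci) with (- Ci)%C by (apply C_ext; simpl; ring).
reflexivity.
Qed.

Lemma sink_order a k : sink a k = sin (IZR k * (order a * PI)).
Proof. unfold sink, order; f_equal; ring. Qed.

Lemma cos_order a : cos (PI * a / 2) = sin (order a * PI).
Proof. rewrite cos_sin; f_equal; unfold order; field. Qed.

(** Here h1, h2 are the Hankel functions at zeta and k1, k2 those at the rotated point; sk, sm, sp
    are the sines for k, k - 1, k + 1, sn = sin (nu pi) and g = e^(i pi a/4). Dividing by the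
    bracket normalizes the coefficient of h1, and the coefficient of h2 then contains xi without its
    exponential. *)
Lemma connection_coefficients (S h1 h2 k1 k2 sk sm sp sn g : C) :
  sn <> RtoC 0 -> g <> RtoC 0 ->
  let bracket := (sk / sn * g + Ci * S * (sm / sn) * / g)%C in
  bracket <> RtoC 0 ->
  (sn * k1 = - (sm * h1) - / (Ci * (g * g)) * sk * h2)%C ->
  (sn * k2 = Ci * (g * g) * sk * h1 + sp * h2)%C ->
  ((k2 + S * k1) * / bracket = Ci * g * h1 +
    (Ci * sp * (g * g) - S * sk) / (sk * (g * g) + Ci * S * sm) *
    (- Ci / g) * h2)%C.
Proof.
intros Hsn Hg bracket Hb E1 E2.
set (den := (sk * (g * g) + Ci * S * sm)%C).
assert (Eb : bracket = (den / (sn * g))%C)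
  by (unfold bracket, den; field; split; assumption).
assert (Hden : den <> RtoC 0).
{ intros E; apply Hb; rewrite Eb, E; unfold Cdiv; apply Cmult_0_l. }
assert (Ei : (/ (Ci * (g * g)) = - Ci / (g * g))%C).
{ transitivity (- (Ci * Ci) / (Ci * (g * g)))%C;
    [rewrite Ci_sqr|]; field; repeat split; try assumption; apply Ci_nz. }
rewrite Ei in E1.
assert (EN : (sn * (k2 + S * k1) =
  (Ci * den * h1 + (Ci * sp * (g * g) - S * sk) * (- Ci / (g * g)) * h2))%C).
{ transitivity (sn * k2 + S * (sn * k1))%C; [ring|]; rewrite E1, E2; unfold den.
  transitivity (Ci * (g * g) * sk * h1 + - (1) * S * sm * h1 - - (1) * sp * h2 +
    S * Ci * sk * h2 / (g * g))%C; [field; assumption|].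
  rewrite <- Ci_sqr; field; assumption. }
rewrite Eb; transitivity (sn * (k2 + S * k1) * g / den)%C;
  [field; repeat split; assumption|].
rewrite EN; field; repeat split; assumption.
Qed.

Lemma freq_log_arg rho a z x : 0 < a -> 1 <= rho a -> 1 <= x ->
  Cexp (log_arg rho a (z0 z) x) = ((RtoC a + RtoC x) * freq rho a z)%C.
Proof.
intros Ha Hr Hx; unfold log_arg, freq.
rewrite !Cexp_add, !Cexp_R, !exp_ln by (try apply ell_pos; lra).
rewrite RtoC_plus; ring.
Qed.

(** Halving z turns its 2 pi i k_z into a rotation of zeta by k_z pi. *)
Lemma zshift_log_arg rho a z x :
  (zshift rho a z / 2 + RtoC (ln (a + x)))%C =
  (log_arg rho a (z0 z) x + RtoC (IZR (kz z) * PI) * Ci)%C.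
Proof.
unfold zshift, log_arg, z0; apply C_ext; destruct z; simpl; field.
Qed.

Theorem theorem4p2 (M : surface_with_end) (g : R -> metric M) (rho : R -> R)
    (poles : R -> C -> Prop) (E : R -> C -> M -> C) (scat : R -> C -> C)
    (Psi : R -> C -> R -> R -> C)
    (Hg : forall a, 0 < a -> cusp_metric M a (g a))
    (Hrho1 : forall a, 0 < a -> 1 <= rho a)
    (Hrho : is_lim rho p_infty p_infty)
    (HE : forall a, 0 < a -> not_odd a ->
       generalized_eigenfunction M (g a) a (poles a) (E a) (scat a) (Psi a)) :
  exists p q : R -> C -> R -> C,
    (forall a, 0 < a -> not_odd a ->
       regular_amplitude (p a) /\ regular_amplitude (q a) /\
       forall z : C,
         (forall k : Z, Im z + 2 * IZR k * PI <> PI) ->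
         ~ poles a (zshift rho a z) ->
         eta_bracket rho a (scat a) z <> RtoC 0 ->
         let s := (1 / 2 + Ci * freq rho a z)%C in
         forall x y : R, 1 <= x ->
           (eigF M rho a (E a) (scat a) z (cyl (x, y)) -
            eta rho a (scat a) z * Psi a (zshift rho a z) x y)%C =
           (Cexp (RtoC x * s) * dressed a (p a) (z0 z) x +
            xi rho a (scat a) z * Cexp (RtoC x * (1 - s)) *
              dressed a (q a) (z0 z) x)%C) /\
    (forall c eps : R, 0 < eps < PI -> tends_to_1 p c eps /\ tends_to_1 q c eps).
Proof.
(* The amplitudes are the Hankel functions at zeta divided by their leading terms; the integer k_z
   enters only through eta and xi. *)
exists (fun a v x =>
  amplitude (gain a) (- Ci) (hankel1 (order a)) (log_arg rho a v x)).
exists (fun a v x =>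
  amplitude (Cconj (gain a)) Ci (hankel2 (order a)) (log_arg rho a v x)).
split.
2:{ intros c eps Heps; split; intros del Hdel;
      destruct (error_small rho c eps del Hrho1 Heps Hdel) as [A HA];
      exists A; intros a Ha HaA Hodd w x Hx Hc Hi;
      destruct (HA a Ha HaA w x Hx Hc Hi) as [Him Hsmall];
      (eapply Rle_lt_trans; [|exact Hsmall]).
    - apply amplitude1_near_1; assumption.
    - apply amplitude2_near_1; assumption. }
intros a Ha Hodd; destruct (order_admissible a Ha Hodd) as [Hs [H1 H2]].
destruct (hankel1_recessive (order a) Hs H1 H2) as [U1 [S1 _]].
destruct (hankel2_sol (order a) Hs H1 H2) as [U2 S2].
split; [|split].
- split; intros w; [intros x _ _; apply (amplitude_holomorphic (order a) _ U1), S1|].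
  intros _; apply (amplitude_smooth (order a) _ U1); assumption.
- split; intros w; [intros x _ _; apply (amplitude_holomorphic (order a) _ U2), S2|].
  intros _; apply (amplitude_smooth (order a) _ U2); assumption.
- intros z _ Hpole Hbr s x y Hx.
  unfold eigF; rewrite (E_on_Y _ _ _ _ _ _ _ (HE a Ha Hodd) _ x y Hpole Hx).
  cbv zeta; fold (order a); rewrite zshift_log_arg.
  set (w := log_arg rho a (z0 z) x); set (k := kz z).
  destruct (hankel_rotate (order a) w k Hs H1 H2) as [R1 R2].
  (* All phases are expressed by g = e^(i pi a/4), using e^(i nu pi) = i g^2 and cos (pi a/2) = sin
     (nu pi). *)
  rewrite cis_opp, cis_order in R1; rewrite cis_order in R2.
  assert (Hs' := RtoC_ne0 _ Hs).
  assert (Hbr' := Hbr); unfold eta_bracket in Hbr'.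
  rewrite cis_opp, cos_order, !sink_order, !RtoC_div in Hbr' by exact Hs.
  fold k in Hbr'.
  assert (K := connection_coefficients _ _ _ _ _ _ _ _ _ _ Hs' (cis_ne0 _)
    Hbr' R1 R2).
  assert (HS := eta_scale rho a z x Ha (Hrho1 a Ha) Hx); fold w in HS.
  assert (Hw := freq_log_arg rho a z x Ha (Hrho1 a Ha) Hx); fold w in Hw.
  unfold dressed, amplitude; fold w; rewrite gain_conj, gain_eq, Hw.
  unfold eta, xi, eta_bracket; fold k.
  rewrite (cis_opp (PI * a / 4)), cos_order, !sink_order, !RtoC_div by exact Hs.
  replace (cis (PI * a / 2)) with (cis (PI * a / 4) * cis (PI * a / 4))%C
    by (rewrite <- cis_plus; f_equal; field).
  set (f := freq rho a z) in *.
  (* Since e^(xs) = e^(x/2) e^(i x f), the factor e^(-x/2) of [dressed] leaves e^(i x f), which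
     cancels the x-dependence of e^(-i (a+x) f) and yields the e^(-i a f) of eta. In [X2] the factor
     e^(-2 i a f) of xi turns the remaining e^(i a f) into the same exponential. *)
  assert (X1 : (Cexp (RtoC x * s) * RtoC (exp (- (x / 2))) *
    Cexp (- Ci * ((RtoC a + RtoC x) * f)) = Cexp (- (Ci * RtoC a * f)))%C).
  { rewrite <- Cexp_R, <- !Cexp_add; f_equal.
    unfold s; rewrite RtoC_opp, RtoC_div by lra; field; apply C2_nz. }
  assert (X2 : (Cexp (- (Ci * RtoC (2 * a) * f)) * Cexp (RtoC x * (1 - s)) *
    RtoC (exp (- (x / 2))) * Cexp (Ci * ((RtoC a + RtoC x) * f)) =
    Cexp (- (Ci * RtoC a * f)))%C).
  { rewrite <- Cexp_R, <- !Cexp_add; f_equal.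
    unfold s; rewrite RtoC_opp, RtoC_mult, RtoC_div by lra; field; apply C2_nz. }
  match type of K with (?l = ?r)%C => set (lhs := l) in K; set (rhs := r) in K end.
  set (S := scat a (zshift rho a z)) in *.
  set (e := Cexp (- (Ci * RtoC a * f))) in *.
  match type of HS with (?l = ?r)%C => transitivity (l * e * lhs)%C end;
    [unfold lhs; ring|].
  rewrite HS, K; unfold rhs; rewrite !(RtoC_mult (Rpower (1 + x / a) (a / 2))).
  set (x1 := Cexp (RtoC x * s)) in *; set (x2 := Cexp (RtoC x * (1 - s))) in *.
  set (x3 := Cexp (- (Ci * RtoC (2 * a) * f))) in *.
  set (x4 := Cexp (- Ci * _)) in *; set (x5 := Cexp (Ci * _)) in *.
  set (d := RtoC (exp (- (x / 2)))) in *.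
  match goal with |- (?r * ?W * ?h * e * (?c1 * ?h1 + ?xi * ?c2 * ?h2) = _)%C =>
    transitivity (r * W * h * (x1 * d * x4 * (c1 * h1) +
      xi * (x3 * x2 * d * x5) * c2 * h2))%C; [rewrite X1, X2; ring|ring] end.
Qed.
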